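(* Let $L\subset\mathbb A^3$ be a line in affine $3$-space over $\mathbb C$, with ideal sheaf $\mathscr I_L=(x,y)\subset\mathbb C[x,y,z]$, and let $n\ge 0$. Then the Quot scheme $Q^n_L=\mathrm{Quot}_{\mathbb A^3}(\mathscr I_L,n)$ is a global critical locus, i.e. there exist a smooth variety $U$ and a regular function $f\colon U\to\mathbb A^1$ such that $Q^n_L\cong\mathrm{crit}(f)$ as schemes.
   Context: Everything is over $\mathbb C$. $Q^n_L=\mathrm{Quot}_{\mathbb A^3}(\mathscr I_L,n)$ is the Quot scheme parameterising (isomorphism classes of) surjections of $\mathscr O_{\mathbb A^3}$-modules $\mathscr I_L\twoheadrightarrow\mathscr F$ with $\mathscr F$ of zero-dimensional support and $\chi(\mathscr F)=n$. For a regular function $f\colon U\to\mathbb A^1$ on a smooth scheme $U$, $\mathrm{crit}(f)=Z(\mathrm df)\subset U$ denotes the scheme-theoretic zero locus of $\mathrm df$. *)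

(* Defs.v *)
From HB Require Import structures.
From mathcomp Require Import all_boot all_order all_algebra.
From mathcomp Require Import boolp classical_sets reals.
From mathcomp Require Export complex.
From mathcomp Require Import mpoly.

Set Implicit Arguments.
Unset Strict Implicit.
Unset Printing Implicit Defensive.

Import GRing.Theory.
Local Open Scope ring_scope.

(* Schemes over a field k are represented by their functors of points on      *)
(* commutative k-algebras (Demazure-Gabriel): a scheme is a Zariski sheaf     *)
(* covered by open subfunctors isomorphic to affine schemes, and morphisms of *)
(* schemes are natural transformations.  The algebras [comAlgType k] are      *)
(* nonzero; this loses nothing, since a sheaf takes a one-point value on the  *)
(* zero ring.                                                                 *)

Section Ideals.
Variable A : comNzRingType.

Definition is_ideal (J : set A) : Prop :=
  [/\ J 0, forall p q, J p -> J q -> J (p + q) & forall a p, J p -> J (a * p)].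

Definition ideal_gen (S : set A) : set A := fun p =>
  exists2 s : seq (A * A), (forall c, c \in s -> S c.2)
                         & p = \sum_(c <- s) c.1 * c.2.

Lemma ideal_gen_is_ideal (S : set A) : is_ideal (ideal_gen S).
Proof.
split.
- by exists [::] => //; rewrite big_nil.
- move=> _ _ [s hs ->] [t ht ->]; exists (s ++ t); last by rewrite big_cat.
  by move=> c; rewrite mem_cat => /orP[/hs|/ht].
- move=> a _ [s hs ->]; exists [seq (a * c.1, c.2) | c <- s].
    by move=> c /mapP[d /hs hd ->].
  by rewrite big_map mulr_sumr; apply: eq_bigr => c _; rewrite mulrA.
Qed.

Lemma ideal_gen_sub (S : set A) p : S p -> ideal_gen S p.
Proof.
move=> Sp; exists [:: (1, p)]; last by rewrite big_seq1 mul1r.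
by move=> c; rewrite inE => /eqP->.
Qed.

Lemma ideal_sum (J : set A) (I : eqType) (s : seq I) (F : I -> A) :
  is_ideal J -> (forall i, i \in s -> J (F i)) -> J (\sum_(i <- s) F i).
Proof.
move=> [J0 JD _] hF; rewrite big_seq_cond; elim/big_ind: _ => //.
by move=> i; rewrite andbT => /hF.
Qed.

Lemma ideal_gen_min (S J : set A) :
  is_ideal J -> (forall p, S p -> J p) -> forall p, ideal_gen S p -> J p.
Proof.
move=> idJ SJ _ [s hs ->]; apply: ideal_sum => // c /hs /SJ.
by case: idJ => _ _; apply.
Qed.

End Ideals.

Section Functors.
Variable k : fieldType.

Record kfunctor := KFunctor {
  pt :> comAlgType k -> Type;
  fmap : forall A B : comAlgType k, {lrmorphism A -> B} -> pt A -> pt B;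
  fmap_id : forall (A : comAlgType k) (h : {lrmorphism A -> A}) (x : pt A),
    h =1 id -> fmap h x = x;
  fmap_comp : forall (A B D : comAlgType k) (g : {lrmorphism A -> B})
      (h : {lrmorphism B -> D}) (gh : {lrmorphism A -> D}) (x : pt A),
    gh =1 h \o g -> fmap gh x = fmap h (fmap g x) }.

Record nattrans (X Y : kfunctor) := NatTrans {
  nt :> forall A : comAlgType k, X A -> Y A;
  nt_natural : forall (A B : comAlgType k) (h : {lrmorphism A -> B}) (x : X A),
    nt (fmap h x) = fmap h (nt x) }.

Definition isomorphic (X Y : kfunctor) : Prop :=
  exists phi : nattrans X Y, forall A, bijective (@nt X Y phi A).

Definition affine_line : kfunctor :=
  @KFunctor (fun A => A) (fun A B h => h) (fun A h x e => e x)
    (fun A B D g h gh x e => e x).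

(* h exhibits B as the localisation of A at the powers of s *)
Definition is_localisation (A B : comAlgType k) (s : A)
    (h : {lrmorphism A -> B}) : Prop :=
  [/\ exists b, h s * b = 1,
      forall b, exists m a, h s ^+ m * b = h a
    & forall a, h a = 0 -> exists m, s ^+ m * a = 0].

(* Sheaf condition for the cover of Spec A by the basic opens D(s_i).         *)
(* Compatibility is tested on all common refinements D of B_i and B_j over A, *)
(* i.e. on points of the fibre product of D(s_i) and D(s_j).                  *)
Definition zariski_sheaf (X : kfunctor) : Prop :=
  forall (A : comAlgType k) (N : nat) (s : 'I_N -> A)
    (B : 'I_N -> comAlgType k) (h : forall i, {lrmorphism A -> B i})
    (x : forall i, X (B i)),
  ideal_gen (range s) 1 ->
  (forall i, is_localisation (s i) (h i)) ->
  (forall i j (D : comAlgType k) (gi : {lrmorphism B i -> D})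
      (gj : {lrmorphism B j -> D}),
    gi \o h i =1 gj \o h j -> fmap gi (x i) = fmap gj (x j)) ->
  exists! y : X A, forall i, fmap (h i) y = x i.

(* V is an open subfunctor of X: its preimage under each point Spec A -> X is *)
(* the complement of the zero locus of some J in A.                           *)
Definition open_subfunctor (X : kfunctor) (V : forall A, set (X A)) : Prop :=
  forall (A : comAlgType k) (x : X A), exists J : set A,
  forall (B : comAlgType k) (h : {lrmorphism A -> B}),
    V B (fmap h x) <-> ideal_gen [set h a | a in J]%classic 1.

(* By Yoneda u : X R is a morphism Spec R -> X, and its image consists of the *)
(* points that are pulled back from u.                                        *)
Definition image_of (X : kfunctor) (R : comAlgType k) (u : X R)
    (A : comAlgType k) : set (X A) :=
  fun x => exists phi : {lrmorphism R -> A}, fmap phi u = x.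

Definition open_immersion (X : kfunctor) (R : comAlgType k) (u : X R) : Prop :=
  (forall (A : comAlgType k) (phi psi : {lrmorphism R -> A}),
     fmap phi u = fmap psi u -> phi =1 psi)
  /\ open_subfunctor (image_of u).

Definition is_field (A : comAlgType k) : Prop :=
  forall a : A, a != 0 -> exists b, a * b = 1.

(* Open subfunctors cover X iff they do so on points with values in fields.   *)
Definition affine_open_cover (X : kfunctor) (I : Type) (R : I -> comAlgType k)
    (u : forall i, X (R i)) : Prop :=
  (forall i, open_immersion (u i)) /\
  (forall (A : comAlgType k) (x : X A), is_field A ->
     exists i, image_of (u i) x).

Definition is_scheme (X : kfunctor) : Prop :=
  zariski_sheaf X /\
  exists (I : Type) (R : I -> comAlgType k) (u : forall i, X (R i)),
    affine_open_cover u.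

Definition finitely_generated (R : comAlgType k) : Prop :=
  exists m (p : {lrmorphism {mpoly k[m]} -> R}), forall r, exists q, p q = r.

Definition reduced (R : comAlgType k) : Prop :=
  forall (r : R) m, r ^+ m = 0 -> r = 0.

(* infinitesimal lifting along surjections p with square-zero kernel *)
Definition formally_smooth (R : comAlgType k) : Prop :=
  forall (A B : comAlgType k) (p : {lrmorphism A -> B}),
  (forall b, exists a, p a = b) ->
  (forall a a', p a = 0 -> p a' = 0 -> a * a' = 0) ->
  forall phi : {lrmorphism R -> B},
  exists psi : {lrmorphism R -> A}, p \o psi =1 phi.

(* Finitely generated algebras over a field are finitely presented, so the    *)
(* charts below are exactly spectra of smooth k-algebras.                     *)
Definition smooth (X : kfunctor) : Prop :=
  exists (I : Type) (R : I -> comAlgType k) (u : forall i, X (R i)),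
    affine_open_cover u /\
    (forall i, finitely_generated (R i) /\ formally_smooth (R i)).

(* the diagonal of X is a closed immersion *)
Definition separated (X : kfunctor) : Prop :=
  forall (A : comAlgType k) (x y : X A), exists J : set A,
  forall (B : comAlgType k) (h : {lrmorphism A -> B}),
    fmap h x = fmap h y <-> (forall a, J a -> h a = 0).

Definition irreducible (X : kfunctor) : Prop :=
  (exists A, inhabited (X A)) /\
  (forall V W : (forall A, set (X A)),
     open_subfunctor V -> open_subfunctor W ->
     (exists A x, V A x) -> (exists A x, W A x) ->
     exists A x, V A x /\ W A x).

(* Integral separated scheme of finite type; integral means irreducible and   *)
(* reduced, and reducedness is local.                                         *)
Definition variety (X : kfunctor) : Prop :=
  [/\ is_scheme X, separated X, irreducible X &
    exists (N : nat) (R : 'I_N -> comAlgType k) (u : forall i, X (R i)),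
      affine_open_cover u /\
      (forall i, finitely_generated (R i) /\ reduced (R i))].

Definition derivation (R : comAlgType k) (D : {linear R -> R}) : Prop :=
  forall a b, D (a * b) = a * D b + b * D a.

(* The zero scheme of a section s of a vector bundle E is cut out by the      *)
(* image of s : E^dual -> O.  For E the cotangent bundle of a smooth X and    *)
(* s = df, on an affine open u : Spec R -> X the dual of E is Der_k(R, R) and *)
(* the ideal of Z(df) is generated by the D(f|_u).  The point x lies in Z(df) *)
(* iff, wherever it factors through such a chart, it kills this ideal.        *)
Definition in_crit (X : kfunctor) (f : nattrans X affine_line)
    (A : comAlgType k) (x : X A) : Prop :=
  forall (R : comAlgType k) (u : X R), open_immersion u ->
  forall (B : comAlgType k) (h : {lrmorphism A -> B})
    (psi : {lrmorphism R -> B}), fmap psi u = fmap h x ->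
  forall D : {linear R -> R}, derivation D -> psi (D (f R u)) = 0.

Lemma in_crit_fmap (X : kfunctor) (f : nattrans X affine_line)
    (A B : comAlgType k) (h : {lrmorphism A -> B}) (x : X A) :
  in_crit f x -> in_crit f (fmap h x).
Proof.
move=> cx R u ou E g psi e; apply: (cx R u ou E (g \o h) psi).
by rewrite e; apply: esym; exact: fmap_comp.
Qed.

Program Definition crit (X : kfunctor) (f : nattrans X affine_line) :
    kfunctor :=
  @KFunctor (fun A => {x : X A | in_crit f x})
    (fun A B h x => exist _ (fmap h (sval x)) (in_crit_fmap (svalP x))) _ _.
Next Obligation. by apply: eq_exist; exact: fmap_id. Qed.
Next Obligation. by apply: eq_exist; exact: fmap_comp. Qed.

End Functors.

Section Quot.
Variables (k : fieldType) (r : nat).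

(* Ideal of B[x_1..x_r] generated by the image of K.  When A[x]/K is A-flat   *)
(* this is the base change of K along h; in particular the pullback to A of   *)
(* an ideal I of k[x_1..x_r] is [extend (in_alg A) I].                        *)
Definition extend (A B : comNzRingType) (h : {rmorphism A -> B})
    (K : set {mpoly A[r]}) : set {mpoly B[r]} :=
  ideal_gen [set map_mpoly h p | p in K]%classic.

Definition pullback (I : set {mpoly k[r]}) (A : comAlgType k) :
    set {mpoly A[r]} := extend (in_alg A) I.
Arguments pullback : clear implicits.

(* J/K is locally free of rank n over A: the s in S generate the unit ideal   *)
(* and for each of them the family e of elements of J becomes a basis of      *)
(* (J/K)_s over A_s.                                                          *)
Definition locally_free_quotient (A : comAlgType k) (J K : set {mpoly A[r]})
    (n : nat) : Prop :=
  exists2 S : set A, ideal_gen S 1 &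
  forall s, S s -> exists e : 'I_n -> {mpoly A[r]},
  [/\ forall j, J (e j),
      forall p, J p -> exists m (c : 'I_n -> A),
        K (s ^+ m *: p - \sum_j c j *: e j)
    & forall c : 'I_n -> A, K (\sum_j c j *: e j) ->
        exists m, forall j, s ^+ m * c j = 0].

(* Points of Quot(I, n) over A: isomorphism classes of surjections of         *)
(* A[x_1..x_r]-modules I (x) A ->> F with F locally free of rank n over A,    *)
(* each class being given by the kernel K of its members.                     *)
Definition is_quot (I : set {mpoly k[r]}) (n : nat) (A : comAlgType k)
    (K : set {mpoly A[r]}) : Prop :=
  [/\ is_ideal K, (forall p, K p -> pullback I A p)
    & locally_free_quotient (pullback I A) K n].


Section Extend.
Variables (A B : comNzRingType) (h : {rmorphism A -> B}).

Lemma extend_ideal K : is_ideal (extend h K).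
Proof. exact: ideal_gen_is_ideal. Qed.

Lemma extend_map K p : K p -> extend h K (map_mpoly h p).
Proof. by move=> Kp; apply: ideal_gen_sub; exists p. Qed.

Lemma extend_min (K : set {mpoly A[r]}) (J : set {mpoly B[r]}) :
  is_ideal J -> (forall p, K p -> J (map_mpoly h p)) ->
  forall q, extend h K q -> J q.
Proof. by move=> idJ KJ; apply: ideal_gen_min => // _ [p Kp <-]; exact: KJ. Qed.

(* elements of extend h K are B-linear combinations of elements of K *)
Lemma extend_span (K : set {mpoly A[r]}) q : is_ideal K -> extend h K q ->
  exists2 s : seq (B * {mpoly A[r]}), (forall c, c \in s -> K c.2)
     & q = \sum_(c <- s) c.1 *: map_mpoly h c.2.
Proof.
move=> [_ _ KM]; move: q; apply: extend_min; last first.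
  move=> p Kp; exists [:: (1, p)]; last by rewrite big_seq1 scale1r.
  by move=> c; rewrite inE => /eqP->.
have add p q : (exists2 s : seq (B * {mpoly A[r]}),
      (forall c, c \in s -> K c.2) & p = \sum_(c <- s) c.1 *: map_mpoly h c.2) ->
    (exists2 s : seq (B * {mpoly A[r]}),
      (forall c, c \in s -> K c.2) & q = \sum_(c <- s) c.1 *: map_mpoly h c.2) ->
    (exists2 s : seq (B * {mpoly A[r]}),
      (forall c, c \in s -> K c.2) & p + q = \sum_(c <- s) c.1 *: map_mpoly h c.2).
  move=> [s hs ->] [t ht ->]; exists (s ++ t); last by rewrite big_cat.
  by move=> c; rewrite mem_cat => /orP[/hs|/ht].
have zero : exists2 s : seq (B * {mpoly A[r]}),
    (forall c, c \in s -> K c.2) & 0 = \sum_(c <- s) c.1 *: map_mpoly h c.2.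
  by exists [::] => //; rewrite big_nil.
split=> //.
move=> a _ [s hs ->]; rewrite [a]mpolyE mulr_suml.
elim/big_ind: _ => //.
move=> m _; exists [seq (a@_m * c.1, 'X_[m] * c.2) | c <- s].
  by move=> c /mapP[d /hs hd ->]; apply: KM.
rewrite big_map mulr_sumr; apply: eq_bigr => c _.
by rewrite rmorphM /= map_mpolyX -scalerAl -scalerAr scalerA.
Qed.

End Extend.

Lemma map_mpoly_o (A B D : nzRingType) (g : {rmorphism A -> B})
    (h : {rmorphism B -> D}) (gh : {rmorphism A -> D}) (p : {mpoly A[r]}) :
  gh =1 h \o g -> map_mpoly gh p = map_mpoly h (map_mpoly g p).
Proof. by move=> e; apply/mpolyP => m; rewrite !mcoeff_map_mpoly; exact: e. Qed.

Lemma map_mpoly_in_alg (A B : comAlgType k) (h : {lrmorphism A -> B})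
    (p : {mpoly k[r]}) :
  map_mpoly h (map_mpoly (in_alg A) p) = map_mpoly (in_alg B) p.
Proof.
by apply/mpolyP => m; rewrite !mcoeff_map_mpoly /= [LHS]rmorph_alg.
Qed.

Lemma extend_id (A : comNzRingType) (h : {rmorphism A -> A}) K :
  h =1 id -> is_ideal K -> extend h K = K.
Proof.
move=> e idK; have E p : map_mpoly h p = p.
  by apply/mpolyP => m; rewrite mcoeff_map_mpoly; exact: e.
apply/seteqP; split=> p; last by move=> Kp; rewrite -[p]E; exact: extend_map.
by apply: extend_min => // q; rewrite E.
Qed.

Lemma extend_comp (A B D : comNzRingType) (g : {rmorphism A -> B})
    (h : {rmorphism B -> D}) (gh : {rmorphism A -> D}) (K : set {mpoly A[r]}) :
  gh =1 h \o g -> extend gh K = extend h (extend g K).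
Proof.
move=> e; apply/seteqP; split=> q.
  apply: extend_min; first exact: extend_ideal.
  by move=> p Kp; rewrite (map_mpoly_o _ e); do 2! apply: extend_map.
apply: extend_min; first exact: extend_ideal.
apply: extend_min.
  have [J0 JD JM] := extend_ideal gh K.
  split; first by rewrite rmorph0.
    by move=> p p' Jp Jp'; rewrite rmorphD; exact: JD.
  by move=> a p Jp; rewrite rmorphM; exact: JM.
by move=> p Kp; rewrite -(map_mpoly_o _ e); exact: extend_map.
Qed.

Lemma pullback_extend (I : set {mpoly k[r]}) (A B : comAlgType k)
    (h : {lrmorphism A -> B}) : extend h (pullback I A) = pullback I B.
Proof.
rewrite -(@extend_comp _ _ _ (in_alg A) h (in_alg B)) // => c /=.
by rewrite rmorph_alg.
Qed.

(* Linear relations over B between polynomials over k come from relations     *)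
(* over k.                                                                    *)
Lemma flat_relation (B : comAlgType k) (T : finType) (p : T -> {mpoly k[r]})
    (y : T -> B) : \sum_t y t *: map_mpoly (in_alg B) (p t) = 0 ->
  exists2 N : T -> T -> k, (forall t, \sum_u N t u *: p u = 0)
     & forall u, y u = \sum_t in_alg B (N t u) * y t.
Proof.
move=> y0; pose d := (\max_t msize (p t)).+1.
pose F := 'X_{1..r < d}.
pose P : 'M[k]_(#|T|, #|{: F}|) := \matrix_(i, j) (p (enum_val i))@_(enum_val j : F).
pose N : 'M[k]_#|T| := 1%:M - P *m pinvmx P.
have NP : N *m P = 0 by rewrite mulmxBl mul1mx mulmxKpV // subrr.
exists (fun t u => N (enum_rank t) (enum_rank u)) => [t|u].
  apply/mpolyP => m; rewrite mcoeff0 raddf_sum /=.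
  have [md|md] := ltnP (mdeg m) d; last first.
    rewrite big1 // => u _; rewrite mcoeffZ memN_msupp_eq0 ?mulr0 //.
    apply: contraTN md => /msize_mdeg_lt lt; rewrite -ltnNge.
    by apply: leq_trans lt _; apply/leqW; exact: leq_bigmax.
  have /matrixP/(_ (enum_rank t) (enum_rank (BMultinom md : F))) := NP.
  rewrite !mxE (reindex enum_rank) /=; last first.
    exact: onW_bij (enum_rank_bij _).
  move=> E0; rewrite -[RHS]E0; apply: eq_bigr => u _.
  by rewrite mcoeffZ [P _ _]mxE !enum_rankK.
have yP j : \sum_t in_alg B (P (enum_rank t) j) * y t = 0.
  have /mpolyP/(_ (enum_val j : F)) := y0.
  rewrite mcoeff0 raddf_sum /= => E0; rewrite -[RHS]E0; apply: eq_bigr => t _.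
  by rewrite mcoeffZ mcoeff_map_mpoly mxE enum_rankK mulrC.
have -> : y u = \sum_t in_alg B ((1%:M : 'M[k]_#|T|) (enum_rank t) (enum_rank u)) * y t.
  rewrite (bigD1 u) //= mxE eqxx scale1r mul1r big1 ?addr0 // => t tu.
  by rewrite mxE (inj_eq enum_rank_inj) (negPf tu) scale0r mul0r.
suff Q0 : \sum_t in_alg B ((P *m pinvmx P) (enum_rank t) (enum_rank u)) * y t = 0.
  rewrite -[LHS]subr0 -[X in _ - X]Q0 -sumrB; apply: eq_bigr => t _.
  by rewrite -mulrBl -rmorphB /N !mxE.
under eq_bigr => t _ do rewrite mxE rmorph_sum mulr_suml.
rewrite exchange_big big1 // => j _.
rewrite -[RHS](mulr0 (in_alg B (pinvmx P j (enum_rank u)))) -[X in _ = _ * X](yP j) mulr_sumr.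
by apply: eq_bigr => t _; rewrite rmorphM mulrA; congr (_ * _); rewrite mulrC.
Qed.

Lemma uniform_bound (T : finType) (P : T -> nat -> Prop) :
  (forall t m m', (m <= m')%N -> P t m -> P t m') ->
  (forall t, exists m, P t m) -> exists m, forall t, P t m.
Proof.
move=> mono /choice[f hf]; exists (\max_t f t)%N => t.
exact: mono (leq_bigmax t) (hf t).
Qed.

Section BaseChange.
Variables (I : set {mpoly k[r]}) (n : nat) (A B : comAlgType k).
Variables (h : {lrmorphism A -> B}) (K : set {mpoly A[r]}).
Hypotheses (idI : is_ideal I) (idK : is_ideal K).
Variables (s : A) (e : 'I_n -> {mpoly A[r]}).
Hypothesis eJ : forall j, pullback I A (e j).
Hypothesis span : forall p, pullback I A p -> exists m (c : 'I_n -> A),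
  K (s ^+ m *: p - \sum_j c j *: e j).
Hypothesis free : forall c : 'I_n -> A, K (\sum_j c j *: e j) ->
  exists m, forall j, s ^+ m * c j = 0.

Let KZ a p : K p -> K (a *: p).
Proof. by rewrite -mul_mpolyC; case: idK => _ _; apply. Qed.

Let KD p q : K p -> K q -> K (p + q).
Proof. by case: idK => _ + _; apply. Qed.

Let Ksum (T : finType) (F : T -> {mpoly A[r]}) :
  (forall t, K (F t)) -> K (\sum_t F t).
Proof. by move=> KF; apply: ideal_sum. Qed.

Let sum_e (T : finType) (a : T -> A) (c : T -> 'I_n -> A) :
  \sum_t a t *: (\sum_j c t j *: e j) = \sum_j (\sum_t a t * c t j) *: e j.
Proof.
under eq_bigr => t _ do rewrite scaler_sumr.
rewrite exchange_big; apply: eq_bigr => j _; rewrite scaler_suml.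
by apply: eq_bigr => t _; rewrite scalerA.
Qed.

Lemma uniform_span (T : finType) (x : T -> {mpoly A[r]}) :
  (forall t, pullback I A (x t)) ->
  exists m (c : T -> 'I_n -> A),
    forall t, K (s ^+ m *: x t - \sum_j c t j *: e j).
Proof.
move=> Jx.
suff [m hm] : exists m, forall t, exists c : 'I_n -> A,
    K (s ^+ m *: x t - \sum_j c j *: e j) by have [c hc] := choice hm; exists m, c.
apply: uniform_bound => [t i j ij [c Kc]|t]; last exact: span.
exists (fun l => s ^+ (j - i) * c l).
have := KZ (s ^+ (j - i)) Kc; rewrite scalerBr scalerA -exprD subnK //.
by rewrite scaler_sumr; under eq_bigr => l _ do rewrite scalerA.
Qed.

Lemma coords_base (T : finType) (p : T -> {mpoly k[r]}) (y : T -> B)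
    (m : nat) (c : T -> 'I_n -> A) :
  (forall t, K (s ^+ m *: map_mpoly (in_alg A) (p t) - \sum_j c t j *: e j)) ->
  \sum_t y t *: map_mpoly (in_alg B) (p t) = 0 ->
  exists M, forall j, h s ^+ M * (\sum_t y t * h (c t j)) = 0.
Proof.
move=> Kc /flat_relation[N Np yN].
have [M hM] : exists M, forall t j,
    s ^+ M * (\sum_u in_alg A (N t u) * c u j) = 0.
  apply: uniform_bound => [t i j ij Z l|t].
    by rewrite -(subnK ij) exprD -mulrA Z mulr0.
  apply: free; rewrite -sum_e.
  have := Ksum (fun u => KZ (- in_alg A (N t u)) (Kc u)).
  under eq_bigr => u _ do rewrite scalerBr !scaleNr opprK.
  rewrite big_split /= sumrN.
  suff -> : \sum_u in_alg A (N t u) *: (s ^+ m *: map_mpoly (in_alg A) (p u)) = 0.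
    by rewrite oppr0 add0r.
  have /(congr1 (map_mpoly (in_alg A))) := Np t; rewrite rmorph0 rmorph_sum /=.
  move=> /(congr1 ( *:%R (s ^+ m))); rewrite scaler0 scaler_sumr => E0; rewrite -[RHS]E0.
  by apply: eq_bigr => u _; rewrite map_mpolyZ !scalerA mulrC.
exists M => j.
under eq_bigr => u _ do rewrite yN mulr_suml.
rewrite exchange_big /= mulr_sumr big1 // => t _.
have /(congr1 h) := hM t j; rewrite rmorphM rmorphXn rmorph0 rmorph_sum /=.
move=> /(congr1 ( *%R (y t))); rewrite mulr0 mulrCA => E0; rewrite -[RHS]E0.
congr (_ * _); rewrite mulr_sumr; apply: eq_bigr => u _.
rewrite rmorphM /= -[(N t u)%:A]/(in_alg B (N t u)).
by rewrite linearZ /= rmorph1 mulrA [y t * _]mulrC.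
Qed.

Lemma coords_gen (L : finType) (x : L -> {mpoly A[r]}) (b : L -> B)
    (d : L -> 'I_n -> A) :
  (forall l, pullback I A (x l)) ->
  (forall l, K (x l - \sum_j d l j *: e j)) ->
  \sum_l b l *: map_mpoly h (x l) = 0 ->
  exists M, forall j, h s ^+ M * (\sum_l b l * h (d l j)) = 0.
Proof.
move=> Jx Kd bx.
have /choice[w hw] : forall l, exists w : seq (A * {mpoly k[r]}),
    (forall c, c \in w -> I c.2)
    /\ x l = \sum_(c <- w) c.1 *: map_mpoly (in_alg A) c.2.
  by move=> l; have [w w1 w2] := extend_span idI (Jx l); exists w.
pose T := {l : L & 'I_(size (w l))}.
pose tg l (i : 'I_(size (w l))) : T := Tagged (fun l => 'I_(size (w l))) i.
pose wt (t : T) := tnth (in_tuple (w (tag t))) (tagged t).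
have xE l : x l = \sum_(i < size (w l)) (tnth (in_tuple (w l)) i).1
                     *: map_mpoly (in_alg A) (tnth (in_tuple (w l)) i).2.
  by rewrite {1}(hw l).2 big_tnth.
have [t|m [c Kc]] := @uniform_span T (fun t => map_mpoly (in_alg A) (wt t).2).
  by apply: extend_map; apply: (hw (tag t)).1; exact: mem_tnth.
have sig (V : nmodType) (F : T -> V) :
    \sum_l \sum_(i < size (w l)) F (tg l i) = \sum_t F t.
  rewrite (@sig_big_dep _ _ _ L (fun l => 'I_(size (w l))) xpredT (fun _ => xpredT) (fun l i => F (tg l i))) /=.
  by apply: eq_bigr => -[].
pose y (t : T) := b (tag t) * h (wt t).1.
have [|M1 hM1] := @coords_base T (fun t => (wt t).2) y m c Kc.
  rewrite -sig -[RHS]bx; apply: eq_bigr => l _.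
  rewrite [x l]xE rmorph_sum scaler_sumr; apply: eq_bigr => i _ /=.
  rewrite map_mpolyZ scalerA; congr (_ *: _); apply: map_mpoly_o => a /=.
  by rewrite rmorph_alg.
have [M2 hM2] : exists M, forall l, forall j,
   s ^+ M * (s ^+ m * d l j - \sum_(i < size (w l))
      (tnth (in_tuple (w l)) i).1 * c (tg l i) j) = 0.
  apply: uniform_bound => [l i j ij Z u|l].
    by rewrite -(subnK ij) exprD -mulrA Z mulr0.
  apply: free.
  have K1 := KZ (- s ^+ m) (Kd l).
  have K2 := Ksum (fun i => KZ (tnth (in_tuple (w l)) i).1 (Kc (tg l i))).
  move: K2; under eq_bigr => i _ do rewrite scalerBr.
  rewrite sumrB sum_e => /(KD K1).
  rewrite scalerBr scaleNr [in X in - X]xE scaler_sumr.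
  under eq_bigr => i _ do rewrite scalerA mulrC -scalerA.
  rewrite addrACA addNr.
  rewrite add0r scaleNr opprK scaler_sumr -sumrB.
  by under eq_bigr => j _ do rewrite scalerA -scalerBl.
exists (M1 + (M2 + m))%N => j.
have -> : h s ^+ (M1 + (M2 + m)) * (\sum_l b l * h (d l j)) =
  h s ^+ M1 * \sum_l b l * h (s ^+ M2 * (s ^+ m * d l j)).
  rewrite exprD -mulrA; congr (_ * _); rewrite mulr_sumr; apply: eq_bigr => l _.
  by rewrite mulrCA !rmorphM !rmorphXn exprD !mulrA.
have E l : s ^+ M2 * (s ^+ m * d l j) = s ^+ M2 * \sum_(i < size (w l))
      (tnth (in_tuple (w l)) i).1 * c (tg l i) j.
  by apply/eqP; rewrite -subr_eq0 -mulrBr hM2.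
under eq_bigr => l _ do rewrite E rmorphM mulrCA.
rewrite -mulr_sumr mulrCA.
rewrite -[RHS](mulr0 (h (s ^+ M2))) -[X in _ = _ * X](hM1 j) -sig; congr (_ * (_ * _)).
apply: eq_bigr => l _; rewrite rmorph_sum mulr_sumr.
by apply: eq_bigr => i _; rewrite rmorphM mulrA.
Qed.

Lemma span_extend q : pullback I B q -> exists m (c : 'I_n -> B),
  extend h K (h s ^+ m *: q - \sum_j c j *: map_mpoly h (e j)).
Proof.
move=> /(extend_span idI)[w w1 ->].
have [t|m [c Kc]] := @uniform_span 'I_(size w)
    (fun t => map_mpoly (in_alg A) (tnth (in_tuple w) t).2).
  by apply: extend_map; apply: w1; exact: mem_tnth.
exists m, (fun j => \sum_t (tnth (in_tuple w) t).1 * h (c t j)).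
rewrite big_tnth scaler_sumr.
under [X in _ - X]eq_bigr => j _ do rewrite scaler_suml.
rewrite exchange_big -sumrB; apply: ideal_sum; first exact: extend_ideal.
move=> t _ /=; have := extend_map h (Kc t).
have [_ _ JM] := extend_ideal h K; move=> /(JM (tnth (in_tuple w) t).1%:MP).
rewrite mul_mpolyC rmorphB /= map_mpolyZ scalerBr.
rewrite map_mpoly_in_alg.
rewrite rmorphXn scalerA mulrC -scalerA.
suff -> : (tnth (in_tuple w) t).1 *: map_mpoly h (\sum_j c t j *: e j) =
    \sum_j ((tnth (in_tuple w) t).1 * h (c t j)) *: map_mpoly h (e j) by [].
rewrite rmorph_sum scaler_sumr; apply: eq_bigr => j _.
by rewrite -scalerA; congr (_ *: _); exact: map_mpolyZ.
Qed.

Lemma free_extend (c : 'I_n -> B) : (forall p, K p -> pullback I A p) ->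
  extend h K (\sum_j c j *: map_mpoly h (e j)) ->
  exists m, forall j, h s ^+ m * c j = 0.
Proof.
move=> KI /(extend_span idK)[w w1]; rewrite [in RHS]big_tnth => E.
pose tw i := tnth (in_tuple w) i.
have [| |//|m hm] := @coords_gen ('I_n + 'I_(size w))%type
   (fun l => match l with inl j => e j | inr i => (tw i).2 end)
   (fun l => match l with inl j => c j | inr i => - (tw i).1 end)
   (fun l j => match l with inl i => (i == j)%:R | inr i => 0 end).
- by case=> [j|i] //; apply: KI; apply: w1; exact: mem_tnth.
- case=> [j|i].
    rewrite (bigD1 j) //= eqxx scale1r big1 ?addr0 ?subrr; first by case: idK.
    by move=> i ij; rewrite eq_sym (negPf ij) scale0r.
  under eq_bigr => j _ do rewrite scale0r.
  by rewrite big1_eq subr0; apply: w1; exact: mem_tnth.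
- rewrite big_sumType /= E -big_split big1 // => i _ /=.
  by rewrite scaleNr subrr.
exists m => j; rewrite -[RHS](hm j) big_sumType /= (bigD1 j) //= eqxx rmorph1.
rewrite mulr1 big1 => [|i /negPf->]; last by rewrite rmorph0 mulr0.
rewrite big1 => [|i _]; last by rewrite rmorph0 mulr0.
by rewrite !addr0.
Qed.

End BaseChange.

Lemma is_quot_extend (I : set {mpoly k[r]}) (n : nat) (A B : comAlgType k)
    (h : {lrmorphism A -> B}) (K : set {mpoly A[r]}) :
  is_ideal I -> is_quot I n K -> is_quot I n (extend h K).
Proof.
move=> idI [idK KI [S S1 HS]]; split; first exact: extend_ideal.
  move=> q; rewrite -(pullback_extend I h); apply: extend_min.
    exact: extend_ideal.
  by move=> p Kp; apply: extend_map; exact: KI.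
exists [set h a | a in S]%classic.
  have [w w1 E] := S1; rewrite -(rmorph1 h) E rmorph_sum.
  have idg := ideal_gen_is_ideal [set h a | a in S]%classic.
  apply: ideal_sum => // c /w1 Sc; rewrite rmorphM; case: (idg) => _ _; apply.
  by apply: ideal_gen_sub; exists c.2.
move=> _ [s Ss <-]; have [e [eJ span free]] := HS s Ss.
exists (fun j => map_mpoly h (e j)); split.
- by move=> j; rewrite -(pullback_extend I h); exact: extend_map.
- by move=> q; exact: span_extend.
- by move=> c; apply: (free_extend idI idK eJ span free KI).
Qed.

(* Quot_{A^r}(I, n) as a functor on k-algebras, for an ideal I of k[x_1..x_r] *)
Program Definition Quot (I : set {mpoly k[r]}) (idI : is_ideal I) (n : nat) :
    kfunctor k :=
  @KFunctor k (fun A => {K : set {mpoly A[r]} | is_quot I n K})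
    (fun A B h K => exist _ (extend h (sval K)) (is_quot_extend h idI (svalP K)))
    _ _.
Next Obligation.
by apply: eq_exist; apply: extend_id => //; case: (H0).
Qed.
Next Obligation. by apply: eq_exist; exact: extend_comp. Qed.

End Quot.

(* the ideal (x, y) of k[x, y, z] *)
Definition line_ideal (k : fieldType) : set {mpoly k[3]} :=
  ideal_gen [set 'X_(@Ordinal 3 0 isT); 'X_(@Ordinal 3 1 isT)]%classic.
Arguments line_ideal : clear implicits.

Lemma line_ideal_is_ideal (k : fieldType) : is_ideal (line_ideal k).
Proof. exact: ideal_gen_is_ideal. Qed.

(* Main.v *)
From HB Require Import structures.
Require Import Defs.
From mathcomp Require Import all_boot all_order all_algebra.
From mathcomp Require Import boolp classical_sets reals complex.
From mathcomp Require Import ssrcomplements mpoly ring_quotient ring.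

(** The ideal (x, y) of k[x, y, z] has two generators a = x, b = y and the
    single relation y a = x b.  Hence a quotient of length n is a vector space
    V of dimension n with commuting operators X, Y, Z and two vectors a, b that
    generate V and satisfy Y a = X b, up to the action of GL_n.

    Forget the equations and add a covector w.  Let U be the space of all
    (X, Y, Z, a, b, w) such that a and b generate V under words in X, Y, Z, up to
    GL_n, and let
      f = tr (X (Y Z - Z Y)) + w (Y a - X b).
    The derivatives of f vanish iff
      [Y, Z] = b w,  [Z, X] = - a w,  [X, Y] = 0,
      Y a = X b,  w X = 0,  w Y = 0.
    These equations force w = 0 ([line_equations_of_critical]): multiplying the
    second by Z^N and taking traces gives w Z^N a = 0, likewise w Z^N b = 0, hence
    w Z^N X = w Z^N Y = 0 for all N; so w kills every word in X, Y, Z applied to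
    a or b, and these words span V.  With w = 0 the equations are those of the
    Quot scheme, so that crit f is the Quot scheme.

    U is a smooth variety because it is covered by affine spaces.  A tree is a
    recipe that names, for each basis vector, either a, b or X, Y or Z applied to
    an earlier basis vector.  Locally each point has a basis of this kind for some
    tree ([generating_locally_normal]), and in such a basis the columns named by the
    tree are columns of the identity matrix while the other entries are free
    ([chart_rep]).  Irreducibility follows from a generic representation, which
    lies in all charts ([generic_chart]).

    GL_n acts freely on the locus considered, so a point of U over A is a
    GL_n-torsor with an equivariant map to representations.  It is recorded by
    the family of its trivialisations in normal form over all A-algebras
    ([is_point]); pulling back is then composition.  All gluing goes through one
    notion, [locally], of a property that holds over the members of a Zariski
    cover of Spec A.

    That df vanishes at a point is tested over the dual numbers: a derivation at
    a point is a lift of this point to C[eps], and the coefficient of eps in f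
    is the derivative ([potential_variation]).  This gives both directions of
    the comparison of crit f with the equations ([in_crit_of_equations],
    [equations_of_in_crit]), the second one because each lift of a t-normal
    representation can be brought to t-normal form again.

    Finally, a kernel K in the Quot scheme corresponds to the representations m
    for which K is the kernel of the map I_C -> C^n given by m ([quot_family]),
    and the monomials named by a tree are a basis of the quotient by K
    ([crit_kernel_basis]). *)

Set Implicit Arguments.
Unset Strict Implicit.
Unset Printing Implicit Defensive.

Import GRing.Theory.
Local Open Scope ring_scope.

(** * Morphisms and quotients of algebras *)

Lemma lrmorphism_of (k : fieldType) (A B : comAlgType k) (f : A -> B) :
  {morph f : a b / a + b} -> {morph f : a b / a * b} -> f 1 = 1 ->
  (forall c, {morph f : a / c *: a}) ->
  exists F : {lrmorphism A -> B}, F =1 f.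
Proof.
move=> fD fM f1 fZ.
have fB : zmod_morphism f.
  by move=> a b; rewrite fD -[- b]scaleN1r fZ scaleN1r.
pose F : {lrmorphism A -> B} := HB.pack f (GRing.isZmodMorphism.Build A B f fB)
  (GRing.isMonoidMorphism.Build A B f (f1, fM))
  (GRing.isScalable.Build k A B *:%R f fZ).
by exists F.
Qed.

Section QuotientAlgebra.
Variables (k : fieldType) (R : comNzRingType) (iota : {rmorphism k -> R}).
Variables (J : set R) (idJ : is_ideal J) (J1 : ~ J 1).

Let S : R -> bool := fun x => `[<J x>].

Let S_idealr : idealr_closed (S : {pred R}).
Proof.
case: idJ => J0 JD JM; split.
- exact/asboolP.
- by apply/asboolP.
- move=> a u v /asboolP Ju /asboolP Jv; apply/asboolP; apply: JD => //.
  exact: JM.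
Qed.

Let I : idealr R := HB.pack S (isIdealr.Build R S S_idealr).
Let Q : comNzRingType := {ideal_quot I}.
Let pr : {rmorphism R -> Q} := \pi_({ideal_quot I})%qT.
(** The scalars act through iota, not through an algebra structure on R; this
    covers R = {poly A} over a k-algebra A. *)
Definition quotient_algebra : Type := Q.
HB.instance Definition _ := GRing.ComNzRing.on quotient_algebra.

Let scale (c : k) (x : quotient_algebra) : quotient_algebra := pr (iota c) * x.

Let scaleA a b v : scale a (scale b v) = scale (a * b) v.
Proof. by rewrite /scale !rmorphM mulrA. Qed.
Let scale1 : left_id 1 scale.
Proof. by move=> x; rewrite /scale !rmorph1 mul1r. Qed.
Let scaleDr : right_distributive scale +%R.
Proof. by move=> a x y; rewrite /scale mulrDr. Qed.
Let scaleDl v : {morph scale^~ v : a b / a + b}.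
Proof. by move=> a b; rewrite /scale !rmorphD mulrDl. Qed.
HB.instance Definition _ := GRing.Zmodule_isLmodule.Build k quotient_algebra
  scaleA scale1 scaleDr scaleDl.
Let scaleAl (a : k) (u v : quotient_algebra) : a *: (u * v) = (a *: u) * v.
Proof. exact: mulrA. Qed.
HB.instance Definition _ := GRing.Lmodule_isLalgebra.Build k quotient_algebra scaleAl.
Let scaleAr (a : k) (u v : quotient_algebra) : a *: (u * v) = u * (a *: v).
Proof. exact: mulrCA. Qed.
HB.instance Definition _ := GRing.Lalgebra_isAlgebra.Build k quotient_algebra scaleAr.

Lemma quotient_algebra_exists :
  exists (B : comAlgType k) (p : {rmorphism R -> B}),
  [/\ forall b, exists a, p a = b, forall a, p a = 0 <-> J a
    & forall c, p (iota c) = c%:A].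
Proof.
exists quotient_algebra, pr; split.
- by move=> b; exists (repr b); exact: reprK.
- move=> a; have E : (a \in I) = (pr a == pr 0).
    by have := @Quotient.idealrBE R I a 0; rewrite subr0.
  rewrite rmorph0 in E; split=> [/eqP|Ja].
    by rewrite -[_ == _]E => /asboolP.
  by apply/eqP; rewrite -[_ == _]E; apply/asboolP.
- by move=> c; rewrite /GRing.scale /= /scale mulr1.
Qed.
End QuotientAlgebra.

Lemma quotient_exists (k : fieldType) (A : comAlgType k) (J : set A) : is_ideal J -> ~ J 1 ->
  exists (B : comAlgType k) (p : {lrmorphism A -> B}),
    (forall b, exists a, p a = b) /\ (forall a, p a = 0 <-> J a).
Proof.
move=> idJ J1; have [B [p [psur pker pA]]] := quotient_algebra_exists
  (in_alg A : {rmorphism k -> A}) idJ J1.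
have [||||q qE] := @lrmorphism_of k A B p.
- exact: rmorphD.
- exact: rmorphM.
- exact: rmorph1.
- by move=> c a; rewrite -mulr_algl rmorphM [p c%:A]pA mulr_algl.
exists B, q; split=> [b|a]; last by rewrite qE.
by have [a <-] := psur b; exists a.
Qed.

(** * Units and unit ideals *)

Section Units.
Variable A : comNzRingType.

Definition invertible (a : A) : Prop := exists b, a * b = 1.

Lemma invertible_inj a x y : invertible a -> a * x = a * y -> x = y.
Proof.
by move=> [b ab] E; rewrite -[x]mul1r -ab mulrAC E mulrAC ab mul1r.
Qed.

Lemma invertible1 : invertible 1.
Proof. by exists 1; rewrite mul1r. Qed.

Lemma invertibleM a b : invertible a -> invertible b -> invertible (a * b).
Proof. by move=> [x ax] [y byE]; exists (x * y); rewrite mulrACA ax byE mul1r. Qed.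

Lemma invertible_mull a b : invertible (a * b) -> invertible a.
Proof. by move=> [x ax]; exists (b * x); rewrite mulrA. Qed.

Lemma invertible_mulr a b : invertible (a * b) -> invertible b.
Proof. by rewrite mulrC; exact: invertible_mull. Qed.

Lemma invertibleX a m : invertible a -> invertible (a ^+ m).
Proof.
by move=> ia; elim: m => [|m]; [exact: invertible1 | rewrite exprS; exact: invertibleM].
Qed.

(** The elements that have a power in J form an ideal.  It contains S, hence 1,
    and then so does J. *)
Lemma unit_ideal_of_powers (S J : set A) : is_ideal J ->
  (forall s, S s -> exists m, J (s ^+ m)) -> ideal_gen S 1 -> J 1.
Proof.
move=> idJ SJ S1; case: (idJ) => J0 JD JM.
pose rad a := exists m, J (a ^+ m).
(* each term of (p + q) ^ (m + l) contains p ^ m or q ^ l *)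
have idR : is_ideal rad.
  split; first by exists 1%N; rewrite expr1.
    move=> p q [m Jp] [l Jq]; exists (m + l)%N; rewrite exprDn.
    apply: ideal_sum => // i _; rewrite -mulr_natl; apply: (JM).
    have [li|il] := leqP l i; first by rewrite -(subnK li) exprD mulrA; apply: JM.
    have mi : (m <= m + l - i)%N by rewrite -addnBA ?leq_addr // ltnW.
    by rewrite mulrC -(subnK mi) exprD mulrA; apply: JM.
  by move=> a p [m Jp]; exists m; rewrite exprMn; apply: JM.
by have [m] := ideal_gen_min idR SJ S1; rewrite expr1n.
Qed.

Lemma ideal_gen_range (I : finType) (f : I -> A) a :
  ideal_gen (range f) a -> exists e : I -> A, a = \sum_i e i * f i.
Proof.
apply: (ideal_gen_min (J := fun a => exists e : I -> A, a = \sum_i e i * f i)).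
  split.
  - by exists (fun=> 0); rewrite big1 // => i _; rewrite mul0r.
  - move=> _ _ [e ->] [e' ->]; exists (fun i => e i + e' i).
    by rewrite -big_split; apply: eq_bigr => i _; rewrite mulrDl.
  - move=> b _ [e ->]; exists (fun i => b * e i).
    by rewrite mulr_sumr; apply: eq_bigr => i _; rewrite mulrA.
move=> _ [i _ <-]; exists (fun j => (j == i)%:R).
rewrite (bigD1 i) //= eqxx mul1r big1 ?addr0 // => j /negPf->.
by rewrite mul0r.
Qed.

Lemma partition_of_unity (I : finType) (s : I -> A) m :
  ideal_gen (range s) 1 -> exists e : I -> A, 1 = \sum_i e i * s i ^+ m.
Proof.
move=> s1; apply: (@ideal_gen_range I (fun i => s i ^+ m)).
apply: unit_ideal_of_powers s1; first exact: ideal_gen_is_ideal.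
by move=> _ [i _ <-]; exists m; apply: ideal_gen_sub; exists i.
Qed.

End Units.

Lemma ideal_gen_map (A B : comNzRingType) (h : {rmorphism A -> B}) (S : set A)
    (J : set B) a :
  is_ideal J -> (forall s, S s -> J (h s)) -> ideal_gen S a -> J (h a).
Proof.
move=> [J0 JD JM] SJ; apply: (ideal_gen_min (J := fun a => J (h a))) => //.
split; first by rewrite rmorph0.
  by move=> p q; rewrite rmorphD; exact: JD.
by move=> b p; rewrite rmorphM; exact: JM.
Qed.

Lemma invertible_map (A B : comNzRingType) (h : {rmorphism A -> B}) a :
  invertible a -> invertible (h a).
Proof. by move=> [b ab]; exists (h b); rewrite -rmorphM ab rmorph1. Qed.

(** * Localisation at one element *)

Section Localisation.
Variable k : fieldType.
Implicit Types A B C D : comAlgType k.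

(** Comparing coefficients gives q`_i = - s^i a, and q has finitely many
    nonzero coefficients. *)
Let poly_telescope (A : comNzRingType) (s a : A) (q : {poly A}) :
  a%:P = (s *: 'X - 1) * q -> exists m, s ^+ m * a = 0.
Proof.
move=> E; have Eq i : q`_i = - (s ^+ i * a).
  elim: i => [|i IHi].
    have /(congr1 (fun p : {poly A} => p`_0)) := E.
    rewrite coefC eqxx mulrBl coefB -scalerAl coefZ coefXM eqxx mulr0 mul1r.
    by rewrite sub0r expr0 mul1r => ->; rewrite opprK.
  have /(congr1 (fun p : {poly A} => p`_i.+1)) := E.
  rewrite coefC /= mulrBl coefB -scalerAl coefZ coefXM /= mul1r IHi.
  by move/esym/eqP; rewrite subr_eq0 => /eqP <-; rewrite mulrN exprS mulrA.
exists (size q); have := Eq (size q); rewrite nth_default //.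
by move/eqP; rewrite eq_sym oppr_eq0 => /eqP.
Qed.

(** A[T]/(sT - 1) is the localisation of A at s.  It is the zero ring exactly
    when s is nilpotent. *)
Lemma localisation_exists A (s : A) : (exists m, s ^+ m = 0) \/
  exists (B : comAlgType k) (h : {lrmorphism A -> B}), is_localisation s h.
Proof.
pose J : set {poly A} := fun p => exists q, p = (s *: 'X - 1) * q.
have idJ : is_ideal J.
  split; first by exists 0; rewrite mulr0.
    by move=> _ _ [p ->] [q ->]; exists (p + q); rewrite mulrDr.
  by move=> a _ [p ->]; exists (a * p); rewrite mulrCA.
have [[q]|J1] := pselect (J 1).
  rewrite -polyC1 => /poly_telescope[m].
  by rewrite mulr1; left; exists m.
right; have [B [p [psur pker pA]]] :=
  quotient_algebra_exists (polyC \o in_alg A : {rmorphism k -> {poly A}}) idJ J1.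
have [||||h hE] := @lrmorphism_of k A B (fun a => p a%:P).
- by move=> a b; rewrite polyCD rmorphD.
- by move=> a b; rewrite polyCM rmorphM.
- by rewrite polyC1 rmorph1.
- by move=> c a; rewrite -mulr_algl polyCM rmorphM pA mulr_algl.
have sX : h s * p 'X = 1.
  apply/eqP; rewrite -subr_eq0 hE -rmorphM -(rmorph1 p) -rmorphB mul_polyC.
  by apply/eqP/pker; exists 1; rewrite mulr1.
exists B, h; split; first by exists (p 'X).
- move=> b; have [q <-] := psur b; elim/poly_ind: q => [|q c [m [a IH]]].
    by exists 0, 0; rewrite !rmorph0 mulr0.
  exists m.+1, (a + s ^+ m.+1 * c).
  rewrite !rmorphD !rmorphM rmorphXn mulrDr -hE; congr (_ + _).
  by rewrite [p q * _]mulrC mulrA exprSr -[_ * _ * p 'X]mulrA sX mulr1.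
- by move=> a; rewrite hE => /pker[q /poly_telescope].
Qed.

(** Two elements that agree in the localisation differ by an element killed by a
    power of s. *)
Lemma localisation_inj A B (s : A) (h : {lrmorphism A -> B}) C
    (g : {lrmorphism A -> C}) a b :
  is_localisation s h -> invertible (g s) -> h a = h b -> g a = g b.
Proof.
move=> [_ _ ker] gs hab; have [m sm] : exists m, s ^+ m * (a - b) = 0.
  by apply: ker; rewrite rmorphB /= hab subrr.
apply: (invertible_inj (invertibleX m gs)); apply/eqP.
by rewrite -subr_eq0 -mulrBr -rmorphB -rmorphXn -rmorphM sm rmorph0.
Qed.

Lemma localisation_lift A B (s : A) (h : {lrmorphism A -> B}) C
    (g : {lrmorphism A -> C}) : is_localisation s h -> invertible (g s) ->
  exists l : {lrmorphism B -> C}, l \o h =1 g.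
Proof.
move=> loc gs; have [sinv surj ker] := loc.
have hs : invertible (h s) by [].
have /choice[f fE] b : exists c, forall m a, h s ^+ m * b = h a -> g s ^+ m * c = g a.
  have [m [a ma]] := surj b; have [i im] := invertibleX m gs.
  exists (i * g a) => m' a' ma'; apply: (invertible_inj (invertibleX m gs)).
  rewrite mulrCA [X in _ * X]mulrA im mul1r.
  rewrite -!rmorphXn -!rmorphM; apply: (localisation_inj loc gs).
  by rewrite !rmorphM !rmorphXn /= -ma -ma' mulrCA.
have uniq b c m a : h s ^+ m * b = h a -> g s ^+ m * c = g a -> f b = c.
  move=> ma mc; apply: (invertible_inj (invertibleX m gs)).
  by rewrite (fE _ _ _ ma).
have [||||F FE] := @lrmorphism_of k B C f.
- move=> b b'; have [m [a ma]] := surj b; have [m' [a' ma']] := surj b'.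
  apply: (uniq _ _ (m + m')%N (s ^+ m' * a + s ^+ m * a')).
    rewrite rmorphD !rmorphM !rmorphXn /= -ma -ma' mulrDr exprD.
    by rewrite -mulrA mulrCA -mulrA.
  rewrite rmorphD !rmorphM !rmorphXn /= -(fE _ _ _ ma) -(fE _ _ _ ma') mulrDr exprD.
  by rewrite -mulrA mulrCA -mulrA.
- move=> b b'; have [m [a ma]] := surj b; have [m' [a' ma']] := surj b'.
  apply: (uniq _ _ (m + m')%N (a * a')).
    by rewrite rmorphM /= -ma -ma' exprD mulrACA.
  by rewrite rmorphM /= -(fE _ _ _ ma) -(fE _ _ _ ma') exprD mulrACA.
- by apply: (uniq _ _ 0 1); rewrite !rmorph1 mulr1.
- move=> c b; have [m [a ma]] := surj b; apply: (uniq _ _ m (c *: a)).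
    by rewrite linearZ /= -ma scalerAr.
  by rewrite linearZ /= -(fE _ _ _ ma) scalerAr.
exists F => a /=; rewrite FE; apply: (uniq _ _ 0 a); by rewrite !mul1r.
Qed.

(** An element of J that becomes a unit in the localisation divides a power of
    s there, hence divides a power of s up to torsion. *)
Lemma power_in_ideal A (s : A) (J : set A) : is_ideal J ->
  (forall (D : comAlgType k) (d : {lrmorphism A -> D}), is_localisation s d ->
     exists2 a, J a & invertible (d a)) ->
  exists m, J (s ^+ m).
Proof.
move=> [J0 JD JM] H; have [[m sm]|[D [d loc]]] := localisation_exists s.
  by exists m; rewrite sm.
have [a Ja [y dy]] := H D d loc; have [_ surj ker] := loc.
have [q [b qb]] := surj y.
have [m mE] : exists m, s ^+ m * (s ^+ q - b * a) = 0.
  by apply: ker; rewrite rmorphB rmorphM rmorphXn /= -qb -mulrA [y * _]mulrC dy mulr1 subrr.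
exists (m + q)%N; have -> : s ^+ (m + q) = s ^+ m * (b * a); last by do 2!apply: (JM).
by apply/eqP; rewrite -subr_eq0 exprD -mulrBr mE.
Qed.

Lemma common_denominator A B (s : A) (l : {lrmorphism A -> B}) (T : finType)
    (y : T -> B) : is_localisation s l ->
  exists m (a : T -> A), forall t, l s ^+ m * y t = l (a t).
Proof.
move=> [_ surj _].
have [t m m' mm' [a aE]|t|m /boolp.choice[a aE]] := @uniform_bound T
    (fun t m => exists a, l s ^+ m * y t = l a); last by exists m, a.
  exists (s ^+ (m' - m) * a).
  by rewrite rmorphM rmorphXn /= -aE mulrA -exprD subnK.
exact: surj.
Qed.

Lemma common_annihilator A B (s : A) (l : {lrmorphism A -> B}) (T : finType)
    (z : T -> A) : is_localisation s l -> (forall t, l (z t) = 0) ->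
  exists m, forall t, s ^+ m * z t = 0.
Proof.
move=> [_ _ ker] z0; apply: uniform_bound => [t m m' mm' E|t]; last exact: ker.
by rewrite -(subnK mm') exprD -mulrA E mulr0.
Qed.

End Localisation.

(** * Zariski-local properties of algebras *)

Section Locally.
Variable k : fieldType.
Implicit Types A B C D : comAlgType k.

Definition lrid A : {lrmorphism A -> A} := idfun.
Definition lrcomp A B C (h : {lrmorphism B -> C}) (g : {lrmorphism A -> B}) :
  {lrmorphism A -> C} := h \o g.

Definition algpred A := forall C : comAlgType k, {lrmorphism A -> C} -> Prop.

Definition algpred_ext A (Phi : algpred A) :=
  forall C (g g' : {lrmorphism A -> C}), g =1 g' -> Phi C g -> Phi C g'.

(** Phi holds over the basic open set D(s).  Testing it on all algebras in which
    s is a unit avoids the choice of a localisation, which may be the zero ring. *)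
Definition holds_on A (Phi : algpred A) : set A :=
  fun s => forall C (g : {lrmorphism A -> C}), invertible (g s) -> Phi C g.

Definition locally A (Phi : algpred A) : Prop := ideal_gen (holds_on Phi) 1.

Lemma locally_all A (Phi : algpred A) : (forall C g, Phi C g) -> locally Phi.
Proof. by move=> H; apply: ideal_gen_sub => C g _; exact: H. Qed.

Lemma locally_impl A (Phi Psi : algpred A) :
  (forall C g, Phi C g -> Psi C g) -> locally Phi -> locally Psi.
Proof.
move=> H; apply: ideal_gen_min; first exact: ideal_gen_is_ideal.
by move=> s gs; apply: ideal_gen_sub => C g /gs; exact: H.
Qed.

(** The products of the members of two covers form a cover. *)
Lemma locally_and A (Phi Psi : algpred A) : locally Phi -> locally Psi ->
  locally (fun C g => Phi C g /\ Psi C g).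
Proof.
rewrite /locally => LP LQ; set T := holds_on _.
have [J0 JD JM] := ideal_gen_is_ideal T.
apply: (unit_ideal_of_powers (ideal_gen_is_ideal T) _ LP) => s sP.
exists 1%N; rewrite expr1 -[s]mulr1.
apply: (ideal_gen_min (J := fun a => ideal_gen T (s * a)) _ _ LQ).
  split; first by rewrite mulr0.
    by move=> p q; rewrite mulrDr; exact: JD.
  by move=> a p; rewrite mulrCA; exact: JM.
move=> t tQ; apply: ideal_gen_sub => C g; rewrite rmorphM => st; split.
  exact/sP/(invertible_mull st).
exact/tQ/(invertible_mulr st).
Qed.

Lemma locally_base A B (l : {lrmorphism A -> B}) (Phi : algpred A) :
  locally Phi -> locally (fun C g => Phi C (lrcomp g l)).
Proof.
move=> LP; rewrite /locally -(rmorph1 l).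
apply: (ideal_gen_map (ideal_gen_is_ideal _) _ LP) => s gs.
by apply: ideal_gen_sub => C g; exact: (gs C (lrcomp g l)).
Qed.

(** If Phi holds over D(t) in the localisation A_s, where t = a / s^m, then it
    holds over D(s a) in A. *)
Lemma locally_trans A (Phi : algpred A) : algpred_ext Phi ->
  locally (fun C (g : {lrmorphism A -> C}) =>
             locally (fun D (h : {lrmorphism C -> D}) => Phi D (lrcomp h g))) ->
  locally Phi.
Proof.
move=> ext; pose J := ideal_gen (holds_on Phi).
have idJ : is_ideal J by exact: ideal_gen_is_ideal.
have [J0 JD JM] := idJ.
apply: (unit_ideal_of_powers idJ) => s gs.
have [[m sm]|[B [h loc]]] := localisation_exists s; first by exists m; rewrite sm.
have [hs surj ker] := loc.
(* the elements of the localisation that have a numerator in J *)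
pose J' : set B := fun b => exists m a, h s ^+ m * b = h a /\ J a.
have idJ' : is_ideal J'.
  split; first by exists 0, 0; rewrite mulr0 rmorph0.
    move=> b b' [m [a [ma Ja]]] [m' [a' [ma' Ja']]].
    exists (m + m')%N, (s ^+ m' * a + s ^+ m * a'); split; last first.
      by apply: JD; apply: JM.
    rewrite rmorphD !rmorphM !rmorphXn /= -ma -ma' mulrDr exprD.
    by rewrite -mulrA mulrCA -mulrA.
  move=> c b [m [a [ma Ja]]]; have [m' [a' ma']] := surj c.
  exists (m' + m)%N, (a' * a); split; last exact: JM.
  by rewrite rmorphM /= -ma -ma' exprD mulrACA.
have [m [a [ma Ja]]] : J' 1.
  apply: (ideal_gen_min idJ' _ (gs B h hs)) => t gt.
  have [m [a ma]] := surj t; exists m.+1, (s * a); split.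
    by rewrite exprS -mulrA ma rmorphM.
  apply: ideal_gen_sub => C g; rewrite rmorphM => gsa.
  have [l lE] := localisation_lift loc (invertible_mull gsa).
  apply: (ext _ (lrcomp l h)) => //; apply: gt.
  have : invertible (l (h a)) by rewrite [l _]lE; exact: invertible_mulr gsa.
  by rewrite -ma rmorphM; exact: invertible_mulr.
have [M sM] : exists M, s ^+ M * (s ^+ m - a) = 0.
  by apply: ker; rewrite rmorphB /= -ma mulr1 rmorphXn subrr.
exists (M + m)%N; have -> : s ^+ (M + m) = s ^+ M * a; last exact: JM.
by apply/eqP; rewrite -subr_eq0 exprD -mulrBr sM.
Qed.

Lemma locally_eq A (a b : A) : locally (fun C g => g a = g b) -> a = b.
Proof.
pose J : set A := fun c => c * (a - b) = 0.
move=> L; apply/eqP; rewrite -subr_eq0 -[_ - _]mul1r; apply/eqP.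
apply: (unit_ideal_of_powers (J := J) _ _ L).
  split; first exact: mul0r.
    by move=> p q pE qE; rewrite /J mulrDl pE qE addr0.
  by move=> c p pE; rewrite /J -mulrA pE mulr0.
move=> s gs; have [[m sm]|[B [h loc]]] := localisation_exists s.
  by exists m; rewrite /J sm mul0r.
have [hs _ ker] := loc; apply: ker.
by rewrite rmorphB /= (gs B h hs) subrr.
Qed.

(** The nilpotent members of a family that generates the unit ideal can be left
    out. *)
Lemma locally_cover A (Phi : algpred A) : locally Phi ->
  exists N (s : 'I_N -> A) (B : 'I_N -> comAlgType k)
    (h : forall i, {lrmorphism A -> B i}),
  ideal_gen (range s) 1 /\
  forall i, is_localisation (s i) (h i) /\ Phi (B i) (h i).
Proof.
move=> [w wS w1].
pose nilp (a : A) := `[<exists m, a ^+ m = 0>].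
pose v := [seq c.2 | c <- w & ~~ nilp c.2].
have vP i : exists (B : comAlgType k) (h : {lrmorphism A -> B}),
    is_localisation (tnth (in_tuple v) i) h /\ Phi B h.
  have : tnth (in_tuple v) i \in v by exact: mem_tnth.
  case/mapP=> c; rewrite mem_filter => /andP[/asboolP nc cw] ->.
  have [//|[B [h loc]]] := localisation_exists c.2.
  by exists B, h; split=> //; apply: (wS _ cw); case: loc.
exists (size v), (tnth (in_tuple v)), (fun i => projT1 (cid (vP i))).
exists (fun i => projT1 (cid (projT2 (cid (vP i))))); split; last first.
  by move=> i; exact: projT2 (cid (projT2 (cid (vP i)))).
apply: (unit_ideal_of_powers (S := fun a => exists2 c, c \in w & a = c.2)).
- exact: ideal_gen_is_ideal.
- move=> _ [c cw ->]; have [[m cm]|nc] := pselect (exists m, c.2 ^+ m = 0).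
    by exists m; rewrite cm; case: (ideal_gen_is_ideal (range (tnth (in_tuple v)))).
  exists 1%N; rewrite expr1; apply: ideal_gen_sub.
  have /tnthP[i ->] : c.2 \in in_tuple v; last by exists i.
  by apply/mapP; exists c => //; rewrite mem_filter cw andbT; apply/asboolP.
- by exists w => // c cw; exists c.
Qed.

Lemma locally_of_cover A N (s : 'I_N -> A) (B : 'I_N -> comAlgType k)
    (h : forall i, {lrmorphism A -> B i}) :
  ideal_gen (range s) 1 -> (forall i, is_localisation (s i) (h i)) ->
  locally (fun C g => exists i (l : {lrmorphism B i -> C}), l \o h i =1 g).
Proof.
move=> s1 loc; apply: ideal_gen_min s1; first exact: ideal_gen_is_ideal.
move=> _ [i _ <-]; apply: ideal_gen_sub => C g gs; exists i.
exact: localisation_lift (loc i) gs.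
Qed.

(** The structure sheaf is a sheaf.  Uniqueness makes the local solutions agree on
    the overlaps; after a common choice of exponents their numerators are glued
    with a partition of unity. *)
Lemma locally_glue A (T : finType)
    (Psi : forall C, {lrmorphism A -> C} -> (T -> C) -> Prop) :
  (forall C D (g : {lrmorphism A -> C}) (h : {lrmorphism C -> D})
     (gh : {lrmorphism A -> D}) x,
     gh =1 h \o g -> Psi C g x -> Psi D gh (h \o x)) ->
  (forall C g x y, Psi C g x -> Psi C g y -> x =1 y) ->
  locally (fun C g => exists x, Psi C g x) ->
  exists a : T -> A, locally (fun C g => Psi C g (g \o a)).
Proof.
move=> nat uniq /locally_cover[N [s [B [h [s1 /all_and2[loc]]]]]].
move=> ex; have x i : {x | Psi (B i) (h i) x} by exact: cid.
have [m am] : exists m, forall it : 'I_N * T, exists a,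
    h it.1 (s it.1) ^+ m * sval (x it.1) it.2 = h it.1 a.
  apply: uniform_bound => [[i t] m m' mm' [a E]|[i t]]; last first.
    by case: (loc i) => _ + _; apply.
  exists (s i ^+ (m' - m) * a).
  by rewrite rmorphM rmorphXn /= -E mulrA -exprD subnK.
have [a' aE] := choice am; pose a i t := a' (i, t).
have {}aE i t : h i (s i) ^+ m * sval (x i) t = h i (a i t) by exact: (aE (i, t)).
(* both numerators give the same section on the overlap *)
have [M ME] : exists M, forall ijt : 'I_N * 'I_N * T,
    (s ijt.1.1 * s ijt.1.2) ^+ M *
    (s ijt.1.2 ^+ m * a ijt.1.1 ijt.2 - s ijt.1.1 ^+ m * a ijt.1.2 ijt.2) = 0.
  apply: uniform_bound => [[[i j] t] p q pq E|[[i j] t] /=].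
    by rewrite -(subnK pq) exprD -mulrA E mulr0.
  have [[p sp]|[D [d locd]]] := localisation_exists (s i * s j).
    by exists p; rewrite sp mul0r.
  have [dij _ ker] := locd; apply: ker; rewrite rmorphM in dij.
  have [li liE] := localisation_lift (loc i) (invertible_mull dij).
  have [lj ljE] := localisation_lift (loc j) (invertible_mulr dij).
  have E : li (sval (x i) t) = lj (sval (x j) t).
    apply: (uniq D d (li \o sval (x i)) (lj \o sval (x j))).
      by apply: nat (svalP (x i)) => b; rewrite liE.
    by apply: nat (svalP (x j)) => b; rewrite ljE.
  apply/eqP; rewrite rmorphB subr_eq0 !rmorphM /=.
  rewrite -[d (a i t)]liE -[d (a j t)]ljE /= -!aE !rmorphM /= E !rmorphXn /=.
  by rewrite [li (h i _)]liE [lj (h j _)]ljE mulrCA.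
pose b i t := s i ^+ M * a i t.
have bE i j t : s j ^+ (M + m) * b i t = s i ^+ (M + m) * b j t.
  have /eqP := ME (i, j, t); rewrite mulrBr subr_eq0 /= exprMn => /eqP E.
  rewrite /b !exprD; transitivity (s i ^+ M * s j ^+ M * (s j ^+ m * a i t)).
    by ring.
  by rewrite E; ring.
have [e e1] := partition_of_unity (M + m) s1.
pose c t := \sum_i e i * b i t.
have cE j t : s j ^+ (M + m) * c t = b j t.
  rewrite -[RHS]mul1r e1 mulr_suml mulr_sumr; apply: eq_bigr => i _.
  by rewrite mulrCA bE mulrA.
have hc j t : h j (c t) = sval (x j) t.
  have hs : invertible (h j (s j)) by case: (loc j).
  apply: (invertible_inj (invertibleX (M + m) hs)).
  transitivity (h j (b j t)); first by rewrite -cE rmorphM rmorphXn.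
  by rewrite exprD -mulrA aE /b rmorphM rmorphXn.
exists c; apply: locally_impl (locally_of_cover s1 loc) => C g [i [l lE]].
have -> : g \o c = l \o sval (x i).
  by apply/funext => t /=; rewrite -[g _]lE /= hc.
by apply: nat (svalP (x i)) => y; rewrite lE.
Qed.

End Locally.

(** * Representations and trees *)

Notation ix := (@Ordinal 3 0 isT).
Notation iy := (@Ordinal 3 1 isT).
Notation iz := (@Ordinal 3 2 isT).
Notation ca := (@Ordinal 2 0 isT).
Notation cb := (@Ordinal 2 1 isT).

Lemma ord2P (c : 'I_2) : c = ca \/ c = cb.
Proof. by case: c => -[|[|//]] c2; [left | right]; exact: val_inj. Qed.

Lemma ord3P (i : 'I_3) : [\/ i = ix, i = iy | i = iz].
Proof.
by case: i => -[|[|[|//]]] i3; [constructor 1|constructor 2|constructor 3]; exact: val_inj.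
Qed.

Lemma eq_cols (C : nmodType) a b (M N : 'M[C]_(a, b)) :
  (forall j, col j M = col j N) -> M = N.
Proof.
move=> E; apply/matrixP => i j.
by have /colP/(_ i) := E j; rewrite !mxE.
Qed.

Lemma col_mulmx (C : comNzRingType) a b c (M : 'M[C]_(a, b)) (N : 'M_(b, c)) j :
  col j (M *m N) = M *m col j N.
Proof. by rewrite !colE mulmxA. Qed.

Section Representations.
Variable n : nat.

(** The columns of (a, b, X, Y, Z): a representation on C^n assigns a vector to
    each source. *)
Definition source := ('I_2 + 'I_3 * 'I_n)%type.
Definition slot := (source * 'I_n + 'I_n)%type.
HB.instance Definition _ := Finite.on source.
HB.instance Definition _ := Finite.on slot.

Definition rep (C : Type) := slot -> C.

Section Accessors.
Variable C : comNzRingType.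
Implicit Type m : rep C.

Definition rcol m (s : source) : 'cV[C]_n := \col_p m (inl (s, p)).
Definition rvec m (c : 'I_2) : 'cV[C]_n := rcol m (inl c).
Definition rmx m (i : 'I_3) : 'M[C]_n := \matrix_(p, q) m (inl (inr (i, q), p)).
Definition rform m : 'rV[C]_n := \row_p m (inr p).

Definition mk_rep (v : 'I_2 -> 'cV[C]_n) (X : 'I_3 -> 'M[C]_n) (w : 'rV[C]_n) :
    rep C := fun x =>
  match x with
  | inl (inl c, p) => v c p 0
  | inl (inr (i, q), p) => X i p q
  | inr p => w 0 p
  end.

Lemma rvec_mk v X w c : rvec (mk_rep v X w) c = v c.
Proof. by apply/colP => p; rewrite !mxE. Qed.

Lemma rmx_mk v X w i : rmx (mk_rep v X w) i = X i.
Proof. by apply/matrixP => p q; rewrite !mxE. Qed.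

Lemma rform_mk v X w : rform (mk_rep v X w) = w.
Proof. by apply/rowP => p; rewrite !mxE. Qed.

Lemma rcol_mx m i j : rcol m (inr (i, j)) = rmx m i *m delta_mx j 0.
Proof. by rewrite -colE; apply/colP => p; rewrite !mxE. Qed.

Lemma eq_rep m m' : (forall c, rvec m c = rvec m' c) ->
  (forall i, rmx m i = rmx m' i) -> rform m = rform m' -> m = m'.
Proof.
move=> ev eX ew; apply/funext => -[[[c|[i q]] p]|p].
- by have /colP/(_ p) := ev c; rewrite !mxE.
- by have /matrixP/(_ p q) := eX i; rewrite !mxE.
- by have /rowP/(_ p) := ew; rewrite !mxE.
Qed.

End Accessors.

Section MapRep.
Variables (C D : comNzRingType) (h : {rmorphism C -> D}) (m : rep C).

Lemma rcol_map s : rcol (h \o m) s = map_mx h (rcol m s).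
Proof. by apply/colP => p; rewrite !mxE. Qed.

Lemma rvec_map c : rvec (h \o m) c = map_mx h (rvec m c).
Proof. exact: rcol_map. Qed.

Lemma rmx_map i : rmx (h \o m) i = map_mx h (rmx m i).
Proof. by apply/matrixP => p q; rewrite !mxE. Qed.

Lemma rform_map : rform (h \o m) = map_mx h (rform m).
Proof. by apply/rowP => p; rewrite !mxE. Qed.

End MapRep.

(** A recipe for a basis: vector j is a, b, or one of X, Y, Z applied to an
    earlier vector. *)
Definition valid_tree (t : {ffun 'I_n -> source}) : bool :=
  injectiveb t &&
  [forall j, if t j is inr (_, j') then (j' < j)%N else true].

Definition tree := {t : {ffun 'I_n -> source} | valid_tree t}.
HB.instance Definition _ := Finite.on tree.

Implicit Type t : tree.

Definition tsrc t : 'I_n -> source := sval t.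

Lemma tsrc_inj t : injective (tsrc t).
Proof. by case/andP: (svalP t) => /injectiveP. Qed.

Lemma tsrc_lt t j i j' : tsrc t j = inr (i, j') -> (j' < j)%N.
Proof. by case/andP: (svalP t) => _ /forallP/(_ j); rewrite /tsrc => + E; rewrite E. Qed.

Lemma tree_ind t (P : 'I_n -> Prop) :
  (forall j, (forall i j', tsrc t j = inr (i, j') -> P j') -> P j) ->
  forall j, P j.
Proof.
move=> IH j; have [N] := ubnP (j : nat); elim: N j => // N IHN j jN.
apply: IH => i j' /tsrc_lt lt; apply: IHN; exact: leq_trans lt _.
Qed.

Section TreeEval.
Variables (T : Type) (t : tree) (base : 'I_2 -> T) (step : 'I_3 -> T -> T).

(** The fuel j is enough to evaluate at j because parents have smaller indices. *)
Fixpoint tree_eval_rec (N : nat) (j : 'I_n) : T :=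
  match tsrc t j, N with
  | inl c, _ => base c
  | inr (i, j'), N'.+1 => step i (tree_eval_rec N' j')
  | _, _ => base ord0
  end.

Definition tree_eval (j : 'I_n) : T := tree_eval_rec j j.

Lemma tree_evalE j : tree_eval j =
  match tsrc t j with inl c => base c | inr (i, j') => step i (tree_eval j') end.
Proof.
suff E N N' (l : 'I_n) : (l <= N)%N -> (l <= N')%N -> tree_eval_rec N l = tree_eval_rec N' l.
  rewrite /tree_eval; case jE: (tsrc t j) => [c|[i j']].
    by case: (j : nat) => [|N] /=; rewrite jE.
  have := tsrc_lt jE; case: (j : nat) => //= N jN; rewrite jE; congr step.
  exact: E.
elim: N N' l => [|N IHN] [|N'] l //=.
- by case lE: (tsrc t l) => [//|[i l']] /= l0; have := leq_trans (tsrc_lt lE) l0.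
- by case lE: (tsrc t l) => [//|[i l']] /= _ l0; have := leq_trans (tsrc_lt lE) l0.
case lE: (tsrc t l) => [//|[i l']] lN lN'; congr step; apply: IHN.
  exact: leq_trans (tsrc_lt lE) lN.
exact: leq_trans (tsrc_lt lE) lN'.
Qed.

End TreeEval.

Lemma tree_eval_map (T T' : Type) (f : T -> T') t base base' step step' :
  (forall c, f (base c) = base' c) -> (forall i x, f (step i x) = step' i (f x)) ->
  forall j, f (tree_eval t base step j) = tree_eval t base' step' j.
Proof.
move=> fb fs; apply: (@tree_ind t) => j IH; rewrite !tree_evalE.
by case jE: (tsrc t j) => [c|[i j']] //; rewrite fs (IH _ _ jE).
Qed.

Section Frames.
Variable C : comNzRingType.
Implicit Type m : rep C.

Definition normal_for t m : Prop := forall j, rcol m (tsrc t j) = delta_mx j 0.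
Definition normal m : Prop := exists t, normal_for t m.

Definition frame t m : 'M[C]_n := \matrix_(p, j)
  (tree_eval t (rvec m) (fun i v => rmx m i *m v) j) p 0.

Lemma frame_col t m j :
  col j (frame t m) = tree_eval t (rvec m) (fun i v => rmx m i *m v) j.
Proof. by apply/colP => p; rewrite !mxE. Qed.

Definition intertwines (g : 'M[C]_n) m m' : Prop :=
  [/\ forall c, g *m rvec m c = rvec m' c,
      forall i, g *m rmx m i = rmx m' i *m g & rform m = rform m' *m g].

Definition iso m m' : Prop :=
  exists g, intertwines g m m' /\ exists g', g *m g' = 1%:M.

Lemma frame_intertwines g m m' t : intertwines g m m' ->
  g *m frame t m = frame t m'.
Proof.
case=> gv gX _; apply: eq_cols => j.
rewrite col_mulmx !frame_col; apply: tree_eval_map => // i v.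
by rewrite !mulmxA gX.
Qed.

Lemma frame_normal t m : normal_for t m -> frame t m = 1%:M.
Proof.
move=> nm; apply: eq_cols => j; rewrite frame_col col1.
move: j; apply: (@tree_ind t) => j IH; rewrite tree_evalE -nm.
by case jE: (tsrc t j) => [//|[i j']]; rewrite (IH _ _ jE) rcol_mx.
Qed.

Lemma iso_refl m : iso m m.
Proof.
exists 1%:M; split; last by exists 1%:M; rewrite mulmx1.
by split=> *; rewrite ?mul1mx ?mulmx1.
Qed.

Lemma iso_sym m m' : iso m m' -> iso m' m.
Proof.
move=> [g [[gv gX gw] [g' gg']]]; have g'g := mulmx1C gg'.
exists g'; split; last by exists g.
split=> [c|i|]; first by rewrite -gv mulmxA g'g mul1mx.
  by rewrite -[LHS]mulmx1 -gg' !mulmxA -[_ *m g]mulmxA -gX !mulmxA g'g mul1mx.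
by rewrite gw -mulmxA gg' mulmx1.
Qed.

Lemma iso_trans m m' m'' : iso m m' -> iso m' m'' -> iso m m''.
Proof.
move=> [g [[gv gX gw] [g' gg']]] [d [[dv dX dw] [d' dd']]].
exists (d *m g); split.
  split=> [c|i|]; first by rewrite -mulmxA gv dv.
    by rewrite -mulmxA gX !mulmxA dX.
  by rewrite gw dw mulmxA.
by exists (g' *m d'); rewrite !mulmxA -[_ *m g']mulmxA gg' mulmx1.
Qed.

(** An intertwiner out of a t-normal representation carries the standard basis to
    the t-frame of its target, so it is unique and given by a formula.  This turns
    the existence of an isomorphism into equations. *)
Lemma normal_iso t m m' : normal_for t m -> normal m' ->
  iso m m' <-> intertwines (frame t m') m m'.
Proof.
move=> nm [t' nm']; split.
  by move=> [g [ig _]]; rewrite -(frame_intertwines t ig) (frame_normal nm) mulmx1.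
move=> ig; exists (frame t m'); split=> //; exists (frame t' m).
by rewrite (frame_intertwines t' ig) (frame_normal nm').
Qed.

Lemma normal_iso_eq t m m' : normal_for t m -> normal_for t m' -> iso m m' ->
  m = m'.
Proof.
move=> nm nm'; have nm'' : normal m' by exists t.
move=> /(normal_iso nm nm''); rewrite (frame_normal nm') => -[gv gX gw].
apply: eq_rep => [c|i|]; first by rewrite -gv mul1mx.
  by rewrite -[LHS]mul1mx gX mulmx1.
by rewrite gw mulmx1.
Qed.

Definition transport (g g' : 'M[C]_n) m : rep C :=
  mk_rep (fun c => g *m rvec m c) (fun i => g *m rmx m i *m g') (rform m *m g').

Lemma transport_iso g g' m : g *m g' = 1%:M -> iso m (transport g g' m).
Proof.
move=> gg'; have g'g := mulmx1C gg'; exists g; split; last by exists g'.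
split=> [c|i|]; rewrite ?rvec_mk ?rmx_mk ?rform_mk //.
  by rewrite -mulmxA g'g mulmx1.
by rewrite -mulmxA g'g mulmx1.
Qed.

(** Express the representation in the basis given by its t-frame. *)
Lemma normalise t m g : g *m frame t m = 1%:M ->
  normal_for t (transport g (frame t m) m).
Proof.
move=> gf; have fg := mulmx1C gf; set m' := transport _ _ _ => j.
have fm' l : tree_eval t (rvec m') (fun i v => rmx m' i *m v) l = delta_mx l 0.
  rewrite -col1 -gf col_mulmx frame_col; symmetry; apply: tree_eval_map => [c|i v].
    by rewrite rvec_mk.
  by rewrite rmx_mk -[RHS]mulmxA [frame t m *m _]mulmxA fg mul1mx mulmxA.
rewrite -fm' tree_evalE; case jE: (tsrc t j) => [//|[i j']].
by rewrite rcol_mx fm'.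
Qed.

End Frames.

Section MapFrames.
Variables (C D : comNzRingType) (h : {rmorphism C -> D}).
Implicit Type m : rep C.

Lemma frame_map t m : frame t (h \o m) = map_mx h (frame t m).
Proof.
apply: eq_cols => j; rewrite -map_col !frame_col; symmetry.
apply: tree_eval_map => [c|i v]; first by rewrite rvec_map.
by rewrite map_mxM rmx_map.
Qed.

Lemma normal_for_map t m : normal_for t m -> normal_for t (h \o m).
Proof. by move=> nm j; rewrite rcol_map nm map_delta_mx. Qed.

Lemma normal_map m : normal m -> normal (h \o m).
Proof. by move=> [t nm]; exists t; exact: normal_for_map. Qed.

Lemma intertwines_map g m m' :
  intertwines g m m' -> intertwines (map_mx h g) (h \o m) (h \o m').
Proof.
move=> [gv gX gw]; split=> [c|i|].
- by rewrite !rvec_map -map_mxM gv.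
- by rewrite !rmx_map -!map_mxM gX.
- by rewrite !rform_map -map_mxM gw.
Qed.

Lemma iso_map m m' : iso m m' -> iso (h \o m) (h \o m').
Proof.
move=> [g [ig [g' gg']]]; exists (map_mx h g); split.
  exact: intertwines_map.
by exists (map_mx h g'); rewrite -map_mxM gg' map_mx1.
Qed.

End MapFrames.

Section Potential.
Variable C : comNzRingType.
Implicit Type m : rep C.

(** The function f of the introduction. *)
Definition potential m : C :=
  \tr (rmx m ix *m (rmx m iy *m rmx m iz - rmx m iz *m rmx m iy))
  + (rform m *m (rmx m iy *m rvec m ca - rmx m ix *m rvec m cb)) 0 0.

Lemma potential_iso m m' : iso m m' -> potential m = potential m'.
Proof.
move=> [g [[gv gX gw] [g' gg']]]; have g'g := mulmx1C gg'.
have X'E i : rmx m' i = g *m rmx m i *m g'.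
  by rewrite gX -mulmxA gg' mulmx1.
have w'E : rform m' = rform m *m g' by rewrite gw -mulmxA gg' mulmx1.
have E A B : (g *m A *m g') *m (g *m B *m g') = g *m (A *m B) *m g'.
  by rewrite !mulmxA -[_ *m g' *m g]mulmxA g'g mulmx1.
have F A v : (g *m A *m g') *m (g *m v : 'cV_n) = g *m (A *m v).
  by rewrite !mulmxA -[_ *m g' *m g]mulmxA g'g mulmx1.
rewrite /potential; congr (_ + _).
  by rewrite !X'E !E -mulmxBl -mulmxBr E [RHS]mxtrace_mulC !mulmxA g'g mul1mx.
by rewrite !X'E -!gv !F -mulmxBr w'E -mulmxA [g' *m _]mulmxA g'g mul1mx.
Qed.

End Potential.

Lemma potential_map (C D : comNzRingType) (h : {rmorphism C -> D}) (m : rep C) :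
  potential (h \o m) = h (potential m).
Proof.
rewrite /potential !rmx_map rform_map !rvec_map -!map_mxM -!map_mxB -!map_mxM.
by rewrite rmorphD /= trace_map_mx mxE.
Qed.

End Representations.

Arguments tsrc {n} t _.

Section LocalIso.
Variables (k : fieldType) (n : nat).

Lemma locally_mx_eq (A : comAlgType k) (a b : nat) (M N : 'M[A]_(a, b)) :
  locally (fun C (g : {lrmorphism A -> C}) => map_mx g M = map_mx g N) -> M = N.
Proof.
move=> L; apply/matrixP => i j; apply: locally_eq.
by apply: locally_impl L => C g /matrixP/(_ i j); rewrite !mxE.
Qed.

(** By [normal_iso] isomorphy of normal representations is a system of equations
    in the entries. *)
Lemma locally_iso (A : comAlgType k) (m m' : rep n A) : normal m -> normal m' ->
  locally (fun C (g : {lrmorphism A -> C}) => iso (g \o m) (g \o m')) -> iso m m'.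
Proof.
move=> [t nm] nm' L; apply/(normal_iso nm nm').
have {}L : locally (fun C (g : {lrmorphism A -> C}) =>
    intertwines (map_mx g (frame t m')) (g \o m) (g \o m')).
  apply: locally_impl L => C g /(normal_iso (normal_for_map g nm) (normal_map g nm')).
  by rewrite frame_map.
split=> [c|i|]; apply: locally_mx_eq; apply: locally_impl L => C g [gv gX gw].
- by rewrite map_mxM -!rvec_map gv.
- by rewrite !map_mxM -!rmx_map gX.
- by rewrite map_mxM -!rform_map gw.
Qed.

Lemma locally_normal_for (A : comAlgType k) t (m : rep n A) :
  locally (fun C (g : {lrmorphism A -> C}) => normal_for t (g \o m)) -> normal_for t m.
Proof.
move=> L j; apply: locally_mx_eq; apply: locally_impl L => C g /(_ j).
by rewrite rcol_map map_delta_mx.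
Qed.

End LocalIso.

(** * The moduli functor U and its sheaf property *)

Section ModuliFunctor.
Variables (k : fieldType) (n : nat).
Implicit Types A B C D : comAlgType k.

Definition rep_family A := forall C : comAlgType k, {lrmorphism A -> C} -> rep n C -> Prop.

(** The three clauses say that the trivialisations over each algebra are an
    isomorphism class compatible with base change, that they exist locally, and
    that they form a sheaf. *)
Definition is_point A (P : rep_family A) : Prop :=
  [/\ forall C (g : {lrmorphism A -> C}) m, P C g m ->
        forall D (h : {lrmorphism C -> D}) (gh : {lrmorphism A -> D}), gh =1 h \o g ->
        forall m', P D gh m' <-> normal m' /\ iso (h \o m) m',
      locally (fun C (g : {lrmorphism A -> C}) => exists m, P C g m)
    & forall C (g : {lrmorphism A -> C}) m, normal m ->
        locally (fun D (h : {lrmorphism C -> D}) => P D (lrcomp h g) (h \o m)) ->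
        P C g m].

Section Points.
Variables (A : comAlgType k) (P : rep_family A).
Hypothesis ptP : is_point P.
Variables (C : comAlgType k) (g : {lrmorphism A -> C}).
Implicit Types m : rep n C.

Lemma point_normal m : P g m -> normal m.
Proof. by case: ptP => sat _ _ Pm; have /(sat _ _ _ Pm _ (lrid C))[] := Pm. Qed.

Lemma point_map m D (h : {lrmorphism C -> D}) (gh : {lrmorphism A -> D}) :
  gh =1 h \o g -> P g m -> P gh (h \o m).
Proof.
move=> E Pm; case: ptP => sat _ _; apply/(sat _ _ _ Pm _ h) => //; split.
  exact/normal_map/point_normal.
exact: iso_refl.
Qed.

Lemma point_ext m (g' : {lrmorphism A -> C}) : g =1 g' -> P g m -> P g' m.
Proof. by move=> E; apply: (@point_map m _ (lrid C)) => a; rewrite -E. Qed.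

Lemma point_iso m m' : P g m -> P g m' -> iso m m'.
Proof. by case: ptP => sat _ _ Pm /(sat _ _ _ Pm _ (lrid C))[]. Qed.

Lemma point_move m m' : P g m -> normal m' -> iso m m' -> P g m'.
Proof. by case: ptP => sat _ _ Pm nm' im; apply/(sat _ _ _ Pm _ (lrid C)). Qed.

Lemma point_locally : locally (fun D (h : {lrmorphism C -> D}) =>
  exists m : rep n D, P (lrcomp h g) m).
Proof. by case: ptP => _ loc _; exact: locally_base loc. Qed.

Lemma point_sheaf m : normal m ->
  locally (fun D (h : {lrmorphism C -> D}) => P (lrcomp h g) (h \o m)) -> P g m.
Proof. by case: ptP => _ _; apply. Qed.

End Points.

(** Local trivialisations of P are trivialisations of Q as well, and those of Q
    form one isomorphism class. *)
Lemma point_sub A (P Q : rep_family A) : is_point P -> is_point Q ->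
  (forall C (g : {lrmorphism A -> C}) m, P C g m -> Q C g m) ->
  forall C (g : {lrmorphism A -> C}) m, Q C g m -> P C g m.
Proof.
move=> ptP ptQ PQ C g m Qm; apply: (point_sheaf ptP); first exact: point_normal Qm.
apply: locally_impl (point_locally ptP g) => D h [m0 Pm0].
have Qhm : Q D (lrcomp h g) (h \o m) by exact: point_map Qm.
apply: (point_move ptP Pm0); first exact: point_normal Qhm.
exact: point_iso (PQ _ _ _ Pm0) Qhm.
Qed.

(** A family ranges over all A-algebras, so families do not form a set.  The
    fractions a / s that are trivialisations over D(s) do, and they determine the
    family. *)
Definition code A (P : rep_family A) : A -> rep n A -> Prop := fun s a =>
  forall C (g : {lrmorphism A -> C}) (m : rep n C), invertible (g s) ->
  (forall v, g s * m v = g (a v)) -> P C g m.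

(** Each trivialisation over a localisation of A at s is a fraction a / s^m; so
    two points with the same code have a trivialisation in common over the
    members of a cover. *)
Lemma code_inj A (P Q : rep_family A) : is_point P -> is_point Q ->
  code P = code Q -> forall C (g : {lrmorphism A -> C}) m, P C g m <-> Q C g m.
Proof.
wlog suff : P Q / is_point P -> is_point Q -> code P = code Q ->
    forall C (g : {lrmorphism A -> C}) m, P C g m -> Q C g m.
  move=> H ptP ptQ E C g m; split; exact: H.
move=> ptP ptQ E.
have [_ /locally_cover[N [s [B [h [s1 /all_and2[loc Pm]]]]]] _] := ptP.
have L : locally (fun C (g : {lrmorphism A -> C}) => exists m, P C g m /\ Q C g m).
  apply: locally_impl (locally_of_cover s1 loc) => C g [i [l lE]].
  have [m Pi] := Pm i; exists (l \o m); split.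
    by apply: point_map Pi => // a; rewrite -lE.
  apply: (@point_map _ Q ptQ _ (h i)) => [a|]; first by rewrite -lE.
  have [p [a pa]] := common_denominator m (loc i).
  have hs : invertible (h i (s i)) by case: (loc i).
  have cP : code P (s i ^+ p.+1) (fun v => s i * a v).
    move=> D d m'; rewrite rmorphXn /= exprSr => /invertible_mulr ds m'E.
    have [l' l'E] := localisation_lift (loc i) ds.
    suff -> : m' = l' \o m by apply: point_map Pi => // x; rewrite -l'E.
    apply/funext => v; apply: (invertible_inj (invertibleX p.+1 ds)).
    rewrite exprSr m'E rmorphM /=; rewrite -[d (a v)]l'E /= -pa rmorphM rmorphXn /=.
    by rewrite [l' (h i _)]l'E mulrA; congr (_ * _); exact: commrX.
  move: cP; rewrite E; apply; first by rewrite rmorphXn; exact: invertibleX.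
  by move=> v; rewrite rmorphXn rmorphM /= -pa exprS mulrA.
move=> C g m Pgm; apply: (point_sheaf ptQ); first exact: point_normal Pgm.
apply: locally_impl (locally_base g L) => D d [m0 [Pm0 Qm0]].
have Pdm : P D (lrcomp d g) (d \o m) by exact: point_map Pgm.
apply: (point_move ptQ Qm0); first exact: point_normal Pdm.
exact: point_iso Pm0 Pdm.
Qed.

Definition moduli A : Type :=
  {c : A -> rep n A -> Prop | exists P, is_point P /\ c = code P}.

Definition fam A (x : moduli A) : rep_family A := projT1 (cid (svalP x)).

Lemma fam_point A (x : moduli A) : is_point (fam x).
Proof. by case: (projT2 (cid (svalP x))). Qed.

Lemma fam_code A (x : moduli A) : sval x = code (fam x).
Proof. by case: (projT2 (cid (svalP x))). Qed.

Definition moduli_of_point A (P : rep_family A) (ptP : is_point P) : moduli A :=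
  exist _ (code P) (ex_intro _ P (conj ptP erefl)).

Lemma famE A (P : rep_family A) (ptP : is_point P) C (g : {lrmorphism A -> C}) m :
  fam (moduli_of_point ptP) g m <-> P C g m.
Proof. by apply: code_inj => //; [exact: fam_point | rewrite -fam_code]. Qed.

Lemma moduli_eq A (x y : moduli A) :
  (forall C (g : {lrmorphism A -> C}) m, fam x g m -> fam y g m) -> x = y.
Proof.
move=> xy; have yx := point_sub (fam_point x) (fam_point y) xy.
suff : sval x = sval y.
  by clear; case: x y => [c pc] [d pd]; exact: eq_exist.
rewrite !fam_code; apply/funext => s; apply/funext => a.
apply/propext; split=> H C g m gs E; [exact/xy/H | exact/yx/H].
Qed.

Definition pull_family A B (h : {lrmorphism A -> B}) (P : rep_family A) : rep_family B :=
  fun C g m => P C (lrcomp g h) m.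

Lemma pull_family_point A B (h : {lrmorphism A -> B}) (P : rep_family A) :
  is_point P -> is_point (pull_family h P).
Proof.
move=> ptP; have [sat loc sh] := ptP; split.
- move=> C g m Pm D d gd E m'; apply: (sat _ _ _ Pm _ d) => a /=.
  exact: E.
- exact: locally_base loc.
- move=> C g m nm L; apply: sh => //; apply: locally_impl L => D d.
  by apply: (point_ext ptP (g := lrcomp (lrcomp d g) h)).
Qed.

Definition moduli_map A B (h : {lrmorphism A -> B}) (x : moduli A) : moduli B :=
  moduli_of_point (pull_family_point h (fam_point x)).

Lemma fam_map A B (h : {lrmorphism A -> B}) (x : moduli A) C
    (g : {lrmorphism B -> C}) m : fam (moduli_map h x) g m <-> fam x (lrcomp g h) m.
Proof. exact: famE. Qed.

Lemma moduli_map_id A (h : {lrmorphism A -> A}) (x : moduli A) :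
  h =1 id -> moduli_map h x = x.
Proof.
move=> E; apply: moduli_eq => C g m /fam_map.
by apply: point_ext => [|a /=]; [exact: fam_point | rewrite E].
Qed.

Lemma moduli_map_comp A B D (g : {lrmorphism A -> B}) (h : {lrmorphism B -> D})
    (gh : {lrmorphism A -> D}) (x : moduli A) :
  gh =1 h \o g -> moduli_map gh x = moduli_map h (moduli_map g x).
Proof.
move=> E; apply: moduli_eq => C l m /fam_map H; apply/fam_map/fam_map.
by apply: point_ext H => [|a /=]; [exact: fam_point | rewrite E].
Qed.

Definition moduli_functor : kfunctor k :=
  KFunctor moduli_map_id moduli_map_comp.

(** A normal representation is declared to be a trivialisation of the glued point
    when it is one of each given point on all common refinements. *)
Lemma moduli_sheaf : zariski_sheaf moduli_functor.
Proof.
move=> A N s B h x s1 loc compat.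
pose P : rep_family A := fun C g m => normal m /\
  forall i D (d : {lrmorphism C -> D}) (l : {lrmorphism B i -> D}),
  d \o g =1 l \o h i -> fam (x i) l (d \o m).
have LB := locally_of_cover s1 loc.
have intro_P C (g : {lrmorphism A -> C}) i (l : {lrmorphism B i -> C}) m :
    l \o h i =1 g -> fam (x i) l m -> P C g m.
  move=> lE xm; split; first exact: point_normal (fam_point _) _ _ _ xm.
  move=> j D d l' dE.
  have E : moduli_map (lrcomp d l) (x i) = moduli_map l' (x j).
    by apply: (compat i j D (lrcomp d l) l') => a; rewrite /= [l _]lE; exact: dE.
  have : fam (moduli_map (lrcomp d l) (x i)) (lrid D) (d \o m).
    by apply/fam_map; apply: point_map xm => //; exact: fam_point.
  by rewrite E => /fam_map; apply: point_ext; first exact: fam_point.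
have ptP : is_point P.
  split.
  - move=> C g m [nm Pm] D d gd E m'; split=> [[nm' Pm']|[nm' im]].
      split=> //; apply: locally_iso => //; first exact: normal_map.
      apply: locally_impl (locally_base gd LB) => F f [i [l lE]].
      apply: (point_iso (fam_point (x i)) (g := l)).
        by apply: (Pm i F (lrcomp f d)) => a; rewrite lE /= E.
      by apply: Pm' => a; rewrite lE.
    split=> // i F f l fl; apply: (point_move (fam_point (x i)) (m := f \o (d \o m))).
    - by apply: (Pm i F (lrcomp f d)) => a; rewrite -fl /= E.
    - exact: normal_map.
    - exact: iso_map.
  - apply: (@locally_trans _ _ (fun C g => exists m, P C g m)).
      move=> C g g' gg' [m [nm Pm]]; exists m; split=> // i D d l dl.
      by apply: Pm => a; rewrite /= gg'; exact: dl.
    apply: locally_impl LB => C g [i [l lE]].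
    apply: locally_impl (point_locally (fam_point (x i)) l) => D d [m xm].
    by exists m; apply: intro_P xm => a; rewrite /= [l _]lE.
  - move=> C g m nm L; split=> // i D d l dl.
    apply: (point_sheaf (fam_point (x i))); first exact: normal_map.
    apply: locally_impl (locally_base d L) => F f [_ Pm].
    by apply: (Pm i F (lrid F)) => a /=; rewrite [d _]dl.
exists (moduli_of_point ptP); split.
  move=> i; symmetry; apply: moduli_eq => C g m xm; apply/fam_map/famE.
  by apply: intro_P xm.
move=> y yE; symmetry; apply: moduli_eq => C g m ym; apply/famE; split.
  exact: point_normal (fam_point _) _ _ _ ym.
move=> i D d l dl; rewrite -yE; apply/fam_map.
by apply: point_map ym => [|a]; [exact: fam_point | exact: esym (dl a)].
Qed.

(** The potential is invariant under isomorphism, so its values on the local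
    trivialisations agree. *)
Lemma moduli_function_exists A (x : moduli A) : exists c : A,
  forall C (g : {lrmorphism A -> C}) m, fam x g m -> potential m = g c.
Proof.
have px := fam_point x.
have [|C g a b [m [xm ma]] [m' [xm' mb]] []||c L] :=
  @locally_glue k A unit (fun C g c => exists m, fam x g m /\ potential m = c tt).
- move=> C D g h gh c E [m [xm mc]]; exists (h \o m); split.
    exact: point_map xm.
  by rewrite potential_map mc.
- by rewrite -ma -mb; apply: potential_iso; exact: point_iso xm xm'.
- apply: locally_impl (point_locally px (lrid A)) => C g [m xm].
  by exists (fun=> potential m), m; split=> //; apply: point_ext xm.
exists (c tt) => C g m xm; apply: locally_eq.
apply: locally_impl (locally_base g L) => D h [m' [xm' E]].
rewrite -potential_map; transitivity (potential m'); last exact: E.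
apply: potential_iso.
by apply: (point_iso px) xm'; exact: point_map xm.
Qed.

Definition moduli_value A (x : moduli A) : A :=
  projT1 (cid (moduli_function_exists x)).

Lemma moduli_valueE A (x : moduli A) C (g : {lrmorphism A -> C}) m :
  fam x g m -> potential m = g (moduli_value x).
Proof. exact: (projT2 (cid (moduli_function_exists x)) C g m). Qed.

Lemma moduli_value_natural A B (h : {lrmorphism A -> B}) (x : moduli A) :
  moduli_value (moduli_map h x) = h (moduli_value x).
Proof.
apply: locally_eq.
apply: locally_impl (point_locally (fam_point (moduli_map h x)) (lrid B)) => C g [m xm].
have ym : fam (moduli_map h x) g m by apply: point_ext xm => //; exact: fam_point.
by rewrite -(moduli_valueE ym); move/fam_map: ym => /moduli_valueE.
Qed.

Definition moduli_function : nattrans moduli_functor (affine_line k) :=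
  @NatTrans k moduli_functor (affine_line k) moduli_value moduli_value_natural.

End ModuliFunctor.

(** * Polynomial algebras *)

Section PolynomialAlgebras.
Variable k : fieldType.
Implicit Types A B C : comAlgType k.

Lemma mpoly_hom N C (y : 'I_N -> C) :
  exists phi : {lrmorphism {mpoly k[N]} -> C}, forall i, phi 'X_i = y i.
Proof.
have [||||phi phiE] := @lrmorphism_of k {mpoly k[N]} C (mmap (in_alg C) y).
- by move=> p q; rewrite rmorphD.
- by move=> p q; rewrite rmorphM.
- by rewrite rmorph1.
- by move=> c p; rewrite mmapZ mulr_algl.
by exists phi => i; rewrite phiE mmapX mmap1U.
Qed.

Lemma mpoly_hom_ext N C (phi psi : {lrmorphism {mpoly k[N]} -> C}) :
  (forall i, phi 'X_i = psi 'X_i) -> phi =1 psi.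
Proof.
move=> E p; rewrite [p]mpolyE !rmorph_sum /=; apply: eq_bigr => m _.
rewrite !linearZ /=; congr (_ *: _); rewrite mpolyXE_id !rmorph_prod /=.
by apply: eq_bigr => i _; rewrite !rmorphXn /= E.
Qed.

Lemma mpoly_finitely_generated N : finitely_generated ({mpoly k[N]} : comAlgType k).
Proof. by exists N, (lrid _) => p; exists p. Qed.

Lemma mpoly_formally_smooth N : formally_smooth ({mpoly k[N]} : comAlgType k).
Proof.
move=> A B p surj _ phi; have [y yE] := boolp.choice (fun i : 'I_N => surj (phi 'X_i)).
have [psi psiE] := mpoly_hom y; exists psi.
by apply: (@mpoly_hom_ext N B (lrcomp p psi)) => i /=; rewrite psiE yE.
Qed.

Lemma mpoly_reduced N : reduced ({mpoly k[N]} : comAlgType k).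
Proof. by move=> p m /eqP; rewrite expf_eq0 => /andP[_ /eqP]. Qed.

End PolynomialAlgebras.

(** * Charts of U *)

Section FreeCoordinates.
Variables (k : fieldType) (n : nat) (free : pred (slot n)) (c : slot n -> k).

Definition free_slot : predArgType := {v : slot n | free v}.
HB.instance Definition _ := Finite.on free_slot.
Definition coordinate_ring : comAlgType k := {mpoly k[#|free_slot|]}.

(** The free entries are independent variables, the others take the values c. *)
Definition universal_rep : rep n coordinate_ring := fun v =>
  if insub v is Some v' then 'X_(enum_rank (v' : free_slot)) else (c v)%:A.

Lemma universal_rep_fixed v : ~~ free v -> universal_rep v = (c v)%:A.
Proof. by move=> nf; rewrite /universal_rep insubN. Qed.

Lemma universal_rep_free (u : free_slot) : universal_rep (val u) = 'X_(enum_rank u).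
Proof. by rewrite /universal_rep valK. Qed.

Lemma universal_rep_lift (C : comAlgType k) (m : rep n C) :
  (forall v, ~~ free v -> m v = (c v)%:A) ->
  exists phi : {lrmorphism coordinate_ring -> C}, phi \o universal_rep = m.
Proof.
move=> mc; have [phi phiE] := @mpoly_hom k #|free_slot| C (fun i => m (val (enum_val i))).
exists phi; apply/funext => v; rewrite /comp /universal_rep.
case: insubP => [u _ <-|nf]; first by rewrite phiE enum_rankK.
by rewrite mc // [LHS]rmorph_alg.
Qed.

Lemma universal_rep_ext (C : comAlgType k) (phi psi : {lrmorphism coordinate_ring -> C}) :
  phi \o universal_rep = psi \o universal_rep -> phi =1 psi.
Proof.
move=> E; apply: mpoly_hom_ext => i; rewrite -(enum_valK i).
by rewrite -universal_rep_free; exact: (congr1 (fun m : rep n C => m _) E).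
Qed.

End FreeCoordinates.

Section Charts.
Variables (k : fieldType) (n : nat).
Implicit Types A B C D : comAlgType k.
Implicit Type t : tree n.

Definition chart_free t : pred (slot n) := fun v =>
  if v is inl (s, _) then s \notin codom (tsrc t) else true.

(** Column t p of a t-normal representation is the p-th column of the identity
    matrix. *)
Definition chart_value t : slot n -> k := fun v =>
  if v is inl (s, p) then (s == tsrc t p)%:R else 0.

Lemma normal_forP C t (m : rep n C) :
  normal_for t m <-> forall v, ~~ chart_free t v -> m v = (chart_value t v)%:A.
Proof.
split=> [nm [[s p]|//] /=|H j].
  rewrite negbK => /codomP[j ->]; have /colP/(_ p) := nm j; rewrite !mxE => ->.
  by rewrite (inj_eq (@tsrc_inj _ t)) eqxx andbT eq_sym scaler_nat.
apply/colP => p; rewrite !mxE eqxx andbT H /= ?negbK ?codom_f //.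
by rewrite (inj_eq (@tsrc_inj _ t)) eq_sym scaler_nat.
Qed.

Definition chart_ring t : comAlgType k := coordinate_ring k (chart_free t).
Definition chart_rep t : rep n (chart_ring t) :=
  universal_rep (chart_free t) (chart_value t).

Lemma chart_rep_normal t : normal_for t (chart_rep t).
Proof. by apply/normal_forP => v; exact: universal_rep_fixed. Qed.

Lemma chart_rep_lift t C (m : rep n C) : normal_for t m ->
  exists phi : {lrmorphism chart_ring t -> C}, phi \o chart_rep t = m.
Proof. by move=> /normal_forP; exact: universal_rep_lift. Qed.

Lemma chart_rep_ext t C (phi psi : {lrmorphism chart_ring t -> C}) :
  phi \o chart_rep t = psi \o chart_rep t -> phi =1 psi.
Proof. exact: universal_rep_ext. Qed.

(** The point of U with the global trivialisation m. *)
Definition orbit A (m : rep n A) : rep_family n A := fun C g m' =>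
  normal m' /\ iso (g \o m) m'.

Lemma orbit_is_point A (m : rep n A) : normal m -> is_point (orbit m).
Proof.
move=> nm; split.
- move=> C g m1 [nm1 im1] D h gh E m2.
  have i1 : iso (gh \o m) (h \o m1).
    have -> : gh \o m = h \o (g \o m) by apply/funext => v; exact: E.
    exact: iso_map.
  split=> -[nm2 im2]; split=> //; last exact: iso_trans im2.
  exact: iso_trans (iso_sym i1) im2.
- apply: locally_all => C g; exists (g \o m); split; first exact: normal_map.
  exact: iso_refl.
- move=> C g m' nm' L; split=> //; apply: locally_iso => //; first exact: normal_map.
  by apply: locally_impl L => D h [].
Qed.

Definition orbit_point A (m : rep n A) (nm : normal m) : moduli n A :=
  moduli_of_point (orbit_is_point nm).

Lemma fam_orbit A (m : rep n A) (nm : normal m) : fam (orbit_point nm) (lrid A) m.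
Proof. by apply/famE; split=> //; exact: iso_refl. Qed.

Lemma moduli_eq_of A (x y : moduli n A) m :
  fam x (lrid A) m -> fam y (lrid A) m -> x = y.
Proof.
move=> xm ym; apply: moduli_eq => C g m' xm'.
have xgm : fam x g (g \o m) by apply: point_map xm => //; exact: fam_point.
have ygm : fam y g (g \o m) by apply: point_map ym => //; exact: fam_point.
apply: (point_move (fam_point y) ygm).
  exact: point_normal (fam_point x) _ _ _ xm'.
exact: point_iso (fam_point x) _ _ _ _ xgm xm'.
Qed.

Definition chart t : moduli_functor k n (chart_ring t) :=
  orbit_point (ex_intro _ t (chart_rep_normal t)).

Lemma chart_imageP t A (x : moduli n A) : image_of (chart t) x <->
  exists m, normal_for t m /\ fam x (lrid A) m.
Proof.
have chart_map B (phi : {lrmorphism chart_ring t -> B}) :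
    fam (moduli_map phi (chart t)) (lrid B) (phi \o chart_rep t).
  by apply/fam_map; apply: point_map (fam_orbit _) => //; exact: fam_point.
split=> [[phi <-]|[m [nm xm]]].
  exists (phi \o chart_rep t); split; last exact: chart_map.
  exact/normal_for_map/chart_rep_normal.
have [phi phiE] := chart_rep_lift nm; exists phi.
by apply: moduli_eq_of xm; rewrite -phiE; exact: chart_map.
Qed.

(** The adjugate matrix inverts the frame. *)
Lemma normalise_det t C (m : rep n C) : invertible (\det (frame t m)) ->
  exists m', normal_for t m' /\ iso m m'.
Proof.
move=> [b db]; pose g := b *: \adj (frame t m).
have gf : g *m frame t m = 1%:M.
  by rewrite -scalemxAl mul_adj_mx scale_scalar_mx mulrC db.
exists (transport g (frame t m) m); split; first exact: normalise.
exact: transport_iso.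
Qed.

Lemma normal_frame_det t C (m m' : rep n C) : normal_for t m -> iso m m' ->
  invertible (\det (frame t m')).
Proof.
move=> nm [g [ig [g' gg']]]; rewrite -(frame_intertwines t ig) (frame_normal nm).
by exists (\det g'); rewrite mulmx1 -det_mulmx gg' det1.
Qed.

Definition has_form t A (x : moduli n A) : algpred A := fun C g =>
  exists m, normal_for t m /\ fam x g m.

(** A t-normal form is unique, so local ones glue. *)
Lemma has_form_glue t A B (x : moduli n A) (h : {lrmorphism A -> B}) :
  locally (fun C g => has_form t x (lrcomp g h)) -> has_form t x h.
Proof.
move=> L; have px := fam_point x.
have [|C g m m' [nm xm] [nm' xm']|//|m {}L] := @locally_glue k B (slot n : finType)
    (fun C g m => normal_for t m /\ fam x (lrcomp g h) m).
- move=> C D g d gd m E [nm xm]; split; first exact: normal_for_map.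
  by apply: point_map xm => // a /=; rewrite E.
- by rewrite (normal_iso_eq nm nm') //; exact: point_iso xm xm'.
have nm : normal_for t m.
  by apply: locally_normal_for; apply: locally_impl L => C g [].
exists m; split=> //; apply: point_sheaf => //; first by exists t.
by apply: locally_impl L => C g [].
Qed.

(** Having a t-normal form is the invertibility of the determinant of the t-frame,
    an open condition.  The determinant is defined only over the members of a
    cover that trivialises x, so J is taken to be the set of all a such that x
    has a t-normal form over D(a). *)
Lemma chart_open t A (x : moduli n A) : exists J : set A,
  forall B (h : {lrmorphism A -> B}),
    has_form t x h <-> ideal_gen [set h a | a in J]%classic 1.
Proof.
have px := fam_point x; exists (holds_on (has_form t x)) => B h; split; last first.
  move=> H; apply: has_form_glue; apply: ideal_gen_min H.
    exact: ideal_gen_is_ideal.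
  by move=> _ [a ga <-]; apply: ideal_gen_sub => C g; exact: (ga C (lrcomp g h)).
move=> [m [nm xm]]; set J := ideal_gen _; have idJ : is_ideal J := ideal_gen_is_ideal _.
have [_ /locally_cover[N [s [E [l [s1 /all_and2[loc xE]]]]]] _] := px.
have hs1 : ideal_gen (range (h \o s)) 1.
  rewrite -(rmorph1 h); apply: ideal_gen_map s1; first exact: ideal_gen_is_ideal.
  by move=> _ [i _ <-]; apply: ideal_gen_sub; exists i.
apply: (unit_ideal_of_powers idJ _ hs1) => _ [i _ <-] /=.
apply: power_in_ideal idJ _ => D d locD.
have [mi xmi] := xE i; have dhs : invertible (d (h (s i))) by case: locD.
have [e eE] := localisation_lift (loc i) (g := lrcomp d h) dhs.
have [p [a pa]] : exists p a, l i (s i) ^+ p * \det (frame t mi) = l i a.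
  by case: (loc i) => _ + _; apply.
have saJ : J (h (s i * a)).
  apply: ideal_gen_sub; exists (s i * a) => // C g; rewrite rmorphM => gsa.
  have [f fE] := localisation_lift (loc i) (invertible_mull gsa).
  have : invertible (f (\det (frame t mi))).
    have : invertible (f (l i a)) by rewrite [f _]fE; exact: invertible_mulr gsa.
    by rewrite -pa rmorphM; exact: invertible_mulr.
  rewrite -det_map_mx -frame_map => /normalise_det[m' [nm' im']].
  exists m'; split=> //; apply: (point_move px _ _ im'); last by exists t.
  by apply: point_map xmi => // b; rewrite fE.
have : invertible (e (\det (frame t mi))).
  rewrite -det_map_mx -frame_map; apply: (@normal_frame_det t _ (d \o m)).
    exact: normal_for_map.
  apply: (point_iso px (g := lrcomp d h)); first exact: point_map xm.
  by apply: point_map xmi => // b; rewrite eE.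
move=> de; exists (h (s i * a)) => //.
have -> : d (h (s i * a)) = d (h (s i)) ^+ p.+1 * e (\det (frame t mi)).
  rewrite !rmorphM exprS -mulrA; congr (_ * _).
  transitivity (e (l i a)); first exact: esym (eE a).
  by rewrite -pa rmorphM rmorphXn /= [e (l i _)]eE.
exact/invertibleM/de/invertibleX.
Qed.


(** Points of the chart are t-normal representations, and two isomorphic ones are
    equal. *)
Lemma chart_immersion t : open_immersion (chart t).
Proof.
split=> [A phi psi E|A x].
  have pc := fam_point (chart t).
  have xphi : fam (chart t) (lrcomp (lrid A) phi) (phi \o chart_rep t).
    by apply: point_map (fam_orbit _).
  have xpsi : fam (chart t) (lrcomp (lrid A) psi) (psi \o chart_rep t).
    by apply: point_map (fam_orbit _).
  apply: chart_rep_ext; apply: (@normal_iso_eq _ _ t).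
  - exact/normal_for_map/chart_rep_normal.
  - exact/normal_for_map/chart_rep_normal.
  - apply: (point_iso (fam_point (moduli_map psi (chart t))) (g := lrid A)).
      by rewrite -[moduli_map psi _]E; apply/fam_map.
    exact/fam_map.
have [J JE] := chart_open t x; exists J => B h; rewrite -JE.
split=> [/chart_imageP[m [nm /fam_map xm]]|[m [nm xm]]].
  exists m; split=> //; apply: point_ext xm => //; exact: fam_point.
apply/chart_imageP; exists m; split=> //; apply/fam_map.
by apply: point_ext xm => //; exact: fam_point.
Qed.

Lemma chart_field_cover A (x : moduli n A) : is_field A ->
  exists t, image_of (chart t) x.
Proof.
move=> Af; have [_ [w wS w1] _] := fam_point x.
have [c cw c0] : exists2 c, c \in w & c.2 != 0.
  apply: contrapT => H; have := oner_neq0 A; rewrite w1 big_seq big1 ?eqxx // => c cw.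
  by have [->|c0] := eqVneq c.2 0; [rewrite mulr0 | case: H; exists c].
have [m xm] := wS c cw A (lrid A) (Af _ c0).
have [t nm] := point_normal (fam_point x) xm.
by exists t; apply/chart_imageP; exists m.
Qed.

Lemma chart_cover : affine_open_cover (X := moduli_functor k n) chart.
Proof. by split=> [t|A x /chart_field_cover]; [exact: chart_immersion | apply]. Qed.

Lemma moduli_smooth : smooth (moduli_functor k n).
Proof.
exists (tree n), chart_ring, chart; split; first exact: chart_cover.
by move=> t; split; [exact: mpoly_finitely_generated | exact: mpoly_formally_smooth].
Qed.

Lemma moduli_scheme : is_scheme (moduli_functor k n).
Proof.
split; first exact: moduli_sheaf.
by exists (tree n), chart_ring, chart; exact: chart_cover.
Qed.

Lemma moduli_finite_cover : exists (N : nat) (R : 'I_N -> comAlgType k)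
    (u : forall i, moduli_functor k n (R i)),
  affine_open_cover u /\ (forall i, finitely_generated (R i) /\ reduced (R i)).
Proof.
exists #|{: tree n}|, (fun i => chart_ring (enum_val i)), (fun i => chart (enum_val i)).
split; last by move=> i; split; [exact: mpoly_finitely_generated | exact: mpoly_reduced].
split=> [i|A x Af]; first exact: chart_immersion.
have [t xt] := chart_field_cover x Af; exists (enum_rank t).
by rewrite enum_rankK.
Qed.

End Charts.

(** * Separatedness *)

Section Separated.
Variable k : fieldType.
Implicit Types A B C D : comAlgType k.

(** J consists of the elements that lie in the local ideals over every member of
    the cover.  If z in the ideal over A_i is a fraction a / s_i^p, then a power
    of s_i times a is in J: over the quotient of A_j by its ideal Phi holds, hence
    it holds after localising at s_i, and there z vanishes. *)
Lemma locally_closed A (Phi : algpred A) :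
  (forall C D (g : {lrmorphism A -> C}) (h : {lrmorphism C -> D})
     (gh : {lrmorphism A -> D}), gh =1 h \o g -> Phi C g -> Phi D gh) ->
  (forall C (g : {lrmorphism A -> C}),
     locally (fun D (h : {lrmorphism C -> D}) => Phi D (lrcomp h g)) -> Phi C g) ->
  locally (fun C (g : {lrmorphism A -> C}) => exists E : set C,
    forall D (h : {lrmorphism C -> D}), Phi D (lrcomp h g) <-> forall e, E e -> h e = 0) ->
  exists J : set A, forall B (h : {lrmorphism A -> B}),
    Phi B h <-> (forall a, J a -> h a = 0).
Proof.
move=> mono loc /locally_cover[N [s [B [l [s1 /all_and2[ll H]]]]]].
pose E i := projT1 (cid (H i)).
have EP i D (h : {lrmorphism B i -> D}) : Phi D (lrcomp h (l i)) <-> forall e, E i e -> h e = 0.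
  exact: (projT2 (cid (H i))).
have kill i D (h : {lrmorphism B i -> D}) a : Phi D (lrcomp h (l i)) ->
    ideal_gen (E i) a -> h a = 0.
  move=> /EP hE; apply: (ideal_gen_min (J := fun a => h a = 0)) => //.
  split; first by rewrite rmorph0.
    by move=> p q pE qE; rewrite rmorphD /= pE qE addr0.
  by move=> b p pE; rewrite rmorphM /= pE mulr0.
exists (fun a => forall i, ideal_gen (E i) (l i a)) => D h; split.
  move=> Ph a Ja; apply: locally_eq.
  apply: locally_impl (locally_base h (locally_of_cover s1 ll)) => F f [i [e eE]].
  rewrite rmorph0 [f (h a)](esym (eE a)); apply: (kill i F e _ _ (Ja i)).
  by apply: mono Ph => b; exact: eE.
move=> hJ; apply: loc.
apply: locally_impl (locally_base h (locally_of_cover s1 ll)) => F f [i [e eE]].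
apply: (mono F F (lrcomp e (l i)) (lrid F)) => [a|]; first exact: esym (eE a).
apply/EP => z Ez.
have lsi : invertible (l i (s i)) by case: (ll i).
have [p [a pa]] : exists p a, l i (s i) ^+ p * z = l i a by case: (ll i) => _ + _; apply.
have [M MJ] : exists M, forall j, ideal_gen (E j) (l j (s i ^+ M * a)).
  apply: uniform_bound => [j M M' MM'|j].
    rewrite -(subnK MM') exprD -mulrA [l j (_ * (_ * _))]rmorphM.
    by case: (ideal_gen_is_ideal (E j)) => _ _; apply.
  have [J1|J1] := pselect (ideal_gen (E j) 1).
    exists 0; rewrite -[l j _]mulr1.
    by case: (ideal_gen_is_ideal (E j)) => _ _; apply.
  have [Q [pr [_ prE]]] := quotient_exists (ideal_gen_is_ideal (E j)) J1.
  have PQ : Phi Q (lrcomp pr (l j)) by apply/EP => y Ey; apply/prE/ideal_gen_sub.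
  have [[M sM]|[Q' [q locq]]] := localisation_exists (pr (l j (s i))).
    exists M; apply/prE; rewrite !rmorphM !rmorphXn /= sM mul0r //.
  have [qs _ kerq] := locq.
  have [e' e'E] := localisation_lift (ll i) (g := lrcomp q (lrcomp pr (l j))) qs.
  have e'z : e' z = 0.
    have : Phi Q' (lrcomp e' (l i)).
      by apply: (mono _ _ (lrcomp pr (l j)) q _ _ PQ) => b; rewrite /= [e' _]e'E.
    by move/EP; apply.
  have /kerq[M ME] : q (pr (l j a)) = 0.
    have <- : e' (l i a) = q (pr (l j a)) by exact: e'E.
    by rewrite -pa rmorphM /= e'z mulr0.
  by exists M; apply/prE; rewrite !rmorphM !rmorphXn.
have : f (h (s i ^+ M * a)) = 0 by rewrite (hJ _ MJ) rmorph0.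
rewrite -[f (h _)]/((f \o h) _) -eE /= !rmorphM /= -pa rmorphM !rmorphXn /=.
have es : invertible (e (l i (s i))) by exact: invertible_map.
rewrite mulrA -exprD -[RHS](mulr0 (e (l i (s i)) ^+ (M + p))).
by move/(invertible_inj (invertibleX _ es)).
Qed.

Variable n : nat.

Lemma iso_closed C (m m' : rep n C) : normal m -> normal m' ->
  exists E : set C, forall D (h : {lrmorphism C -> D}),
    iso (h \o m) (h \o m') <-> forall e, E e -> h e = 0.
Proof.
move=> [t nm] nm'; pose g := frame t m'.
pose E1 : set C := fun e => exists c p, e = (g *m rvec m c - rvec m' c) p 0.
pose E2 : set C := fun e => exists i p q, e = (g *m rmx m i - rmx m' i *m g) p q.
pose E3 : set C := fun e => exists p, e = (rform m - rform m' *m g) 0 p.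
exists (fun e => [\/ E1 e, E2 e | E3 e]) => D h.
rewrite (normal_iso (normal_for_map h nm) (normal_map h nm')) frame_map -/g.
have sub0 a b (M M' : 'M[C]_(a, b)) : map_mx h M = map_mx h M' <->
    forall i j, h ((M - M') i j) = 0.
  split=> [/matrixP E i j|E]; last apply/matrixP => i j; last apply/eqP.
    by have := E i j; rewrite !mxE rmorphB /= => ->; rewrite subrr.
  by have := E i j; rewrite !mxE rmorphB /= => /eqP; rewrite subr_eq0.
have sub1 a b (M M' : 'M[C]_(a, b)) i j : map_mx h M = map_mx h M' -> h ((M - M') i j) = 0.
  by move/sub0; apply.
split=> [[gv gX gw] e|H].
  case=> [[c [p ->]]|[i [p [q ->]]]|[p ->]].
  - by apply: sub1; rewrite map_mxM -!rvec_map gv.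
  - by apply: sub1; rewrite !map_mxM -!rmx_map gX.
  - by apply: sub1; rewrite map_mxM -!rform_map gw.
split=> [c|i|]; rewrite ?rvec_map ?rmx_map ?rform_map -?map_mxM; apply/sub0 => p q.
- by apply: H; constructor 1; exists c, p; rewrite ord1.
- by apply: H; constructor 2; exists i, p, q.
- by apply: H; constructor 3; exists q; rewrite ord1.
Qed.

Lemma moduli_separated : separated (moduli_functor k n).
Proof.
move=> A x y; apply: (@locally_closed A (fun B h => moduli_map h x = moduli_map h y)).
- by move=> C D g h gh E xy; rewrite !(moduli_map_comp _ E) xy.
- move=> C g L; apply: moduli_eq => D d m /fam_map xm; apply/fam_map.
  apply: (point_sheaf (fam_point y)); first exact: point_normal (fam_point x) _ _ _ xm.
  apply: locally_impl (locally_base d L) => F f E.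
  have : fam (moduli_map (lrcomp (lrcomp f d) g) x) (lrid F) (f \o m).
    by apply/fam_map; apply: point_map xm => //; exact: fam_point.
  by rewrite E => /fam_map; apply: point_ext => //; exact: fam_point.
- apply: locally_impl (locally_and (point_locally (fam_point x) (lrid A))
                                   (point_locally (fam_point y) (lrid A))) => C g [[m xm] [m' ym]].
  have {}xm : fam x g m by apply: point_ext xm => //; exact: fam_point.
  have {}ym : fam y g m' by apply: point_ext ym => //; exact: fam_point.
  have nm := point_normal (fam_point x) xm; have nm' := point_normal (fam_point y) ym.
  have [E HE] := iso_closed nm nm'; exists E => D h; rewrite -HE.
  have xhm : fam (moduli_map (lrcomp h g) x) (lrid D) (h \o m).
    by apply/fam_map; apply: point_map xm => //; exact: fam_point.
  have yhm : fam (moduli_map (lrcomp h g) y) (lrid D) (h \o m').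
    by apply/fam_map; apply: point_map ym => //; exact: fam_point.
  split=> [xy|im].
    by rewrite xy in xhm; apply: point_iso xhm yhm; exact: fam_point.
  apply: moduli_eq_of xhm _; apply: (point_move (fam_point _) yhm).
    exact: normal_map.
  exact: iso_sym.
Qed.

End Separated.

(** * Irreducibility *)

Section Irreducible.
Variables (k : fieldType) (n : nat).
Implicit Types A B C D : comAlgType k.
Implicit Type t : tree n.

Let chain : {ffun 'I_n -> source n} := [ffun j : 'I_n =>
  if j == 0%N :> nat then inl ca
  else inr (ix, Ordinal (leq_ltn_trans (leq_pred j) (ltn_ord j)))].

Lemma chain_valid : valid_tree chain.
Proof.
apply/andP; split.
  apply/injectiveP => i j; rewrite !ffunE.
  case: (i =P 0%N :> nat) => [i0|i0]; case: (j =P 0%N :> nat) => [j0|j0] //.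
    by move=> _; apply/val_inj; rewrite /= i0 j0.
  case=> E; apply/val_inj => /=; case: (i : nat) (j : nat) E i0 j0 => [|i'] [|j'] //=.
  by move=> ->.
apply/forallP => j; rewrite ffunE; case: (j =P 0%N :> nat) => [//|j0] /=.
by case: (j : nat) j0.
Qed.

Definition generic_ring : comAlgType k := @coordinate_ring k n predT.
Definition generic_rep : rep n generic_ring := universal_rep predT (fun=> 0).

Lemma generic_rep_lift C (m : rep n C) :
  exists phi : {lrmorphism generic_ring -> C}, phi \o generic_rep = m.
Proof. exact: universal_rep_lift. Qed.

Lemma generic_localisation (a : generic_ring) : a != 0 ->
  exists B (h : {lrmorphism generic_ring -> B}), is_localisation a h.
Proof.
move=> a0; have [[m am]|//] := localisation_exists a.
by case/eqP: a0; exact: mpoly_reduced am.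
Qed.

Lemma generic_mul_neq0 (a b : generic_ring) : a != 0 -> b != 0 -> a * b != 0.
Proof. by move=> a0 b0; rewrite mulf_neq0. Qed.

(** A nonempty open subfunctor meets some chart, and there it contains a basic
    open set of the polynomial ring. *)
Lemma open_chart (V : forall A, set (moduli_functor k n A)) A (x : moduli n A) :
  open_subfunctor V -> V A x ->
  exists t (f : chart_ring k t), f != 0 /\
    forall C (psi : {lrmorphism chart_ring k t -> C}), invertible (psi f) ->
      V C (moduli_map psi (chart k t)).
Proof.
move=> oV Vx; have [_ /locally_cover[N [s [B [l [s1 /all_and2[ll H]]]]]] _] := fam_point x.
have [i _] : exists i : 'I_N, True.
  case: N s B l s1 ll H => [s B l [w ws w1]|N *]; last by exists ord0.
  have := oner_neq0 A; rewrite w1 big_seq big1 ?eqxx // => c cw.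
  by case: (ws c cw) => -[].
have [m xm] := H i; have [t nm] := point_normal (fam_point x) xm.
have [phi phiE] := chart_rep_lift nm.
have xE : moduli_map phi (chart k t) = moduli_map (l i) x.
  apply: (@moduli_eq_of _ _ _ _ _ m); apply/fam_map.
    rewrite -phiE; apply: point_map (fam_orbit _) => //; exact: fam_point.
  by apply: point_ext xm => //; exact: fam_point.
have Vlx : V (B i) (moduli_map (l i) x).
  have [J JE] := oV A x; apply/JE.
  have /JE J1 : V A (moduli_map (lrid A) x) by rewrite moduli_map_id.
  rewrite -(rmorph1 (l i)); apply: ideal_gen_map J1; first exact: ideal_gen_is_ideal.
  by move=> _ [a Ja <-]; apply: ideal_gen_sub; exists a.
have [J JE] := oV _ (chart k t); exists t.
have [f [Jf f0]] : exists f, J f /\ f != 0.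
  move: Vlx; rewrite -xE => /JE[w ws w1]; apply: contrapT => H0.
  have := oner_neq0 (B i); rewrite w1 big_seq big1 ?eqxx // => c cw.
  have [a Ja <-] := ws c cw; have [->|a0] := eqVneq a 0; first by rewrite rmorph0 mulr0.
  by case: H0; exists a.
exists f; split=> // C psi [b fb]; apply/JE; rewrite -fb mulrC.
by case: (ideal_gen_is_ideal [set psi a | a in J]%classic) => _ _; apply; apply: ideal_gen_sub; exists f.
Qed.

(** The generic representation has a t-normal form where the determinant of its
    t-frame is invertible.  This identifies the chart ring with a subring of the
    localised generic ring: specialising the generic representation to the chart
    is a retraction.  So f stays nonzero, and a is its numerator times the
    determinant. *)
Lemma generic_chart t (f : chart_ring k t) : f != 0 ->
  exists a : generic_ring, a != 0 /\
    forall C (g : {lrmorphism generic_ring -> C}), invertible (g a) ->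
    exists psi : {lrmorphism chart_ring k t -> C},
      iso (g \o generic_rep) (psi \o chart_rep k t) /\ invertible (psi f).
Proof.
move=> f0; have [phi phiE] := generic_rep_lift (chart_rep k t).
set d := \det (frame t generic_rep).
have phid : phi d = 1.
  by rewrite /d -det_map_mx -frame_map phiE frame_normal ?det1 //; exact: chart_rep_normal.
have d0 : d != 0 by apply: contra_eq_neq phid => ->; rewrite rmorph0 eq_sym oner_neq0.
have [B [l ll]] := generic_localisation d0.
have [|m [nm im]] := @normalise_det k n t B (l \o generic_rep).
  by rewrite frame_map det_map_mx; case: ll.
have [psi psiE] := chart_rep_lift nm.
have [p [a pa]] : exists p a, l d ^+ p * psi f = l a by case: ll => _ + _; apply.
have [e eE] : exists e : {lrmorphism B -> chart_ring k t}, e \o l =1 phi.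
  by apply: localisation_lift ll _; rewrite phid; exact: invertible1.
have epsi : e \o psi =1 id.
  apply: (@chart_rep_ext _ _ _ _ (lrcomp e psi) (lrid _)); apply: (@normal_iso_eq _ _ t).
  - exact/normal_for_map/chart_rep_normal.
  - exact/normal_for_map/chart_rep_normal.
  - have -> : lrcomp e psi \o chart_rep k t = e \o m by rewrite -psiE.
    have -> : lrid _ \o chart_rep k t = e \o (l \o generic_rep).
      by rewrite -phiE; apply/funext => v; exact: esym (eE _).
    exact/iso_sym/iso_map.
have a0 : a != 0.
  apply: contra_neq f0 => a0; rewrite -[f]epsi /=; suff -> : psi f = 0 by rewrite rmorph0.
  have ld : invertible (l d) by case: ll.
  by apply: (invertible_inj (invertibleX p ld)); rewrite pa a0 rmorph0 mulr0.
exists (d * a); split; first exact: generic_mul_neq0.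
move=> C g; rewrite rmorphM => gda.
have [e' e'E] := localisation_lift ll (invertible_mull gda).
exists (lrcomp e' psi); split.
  have -> : lrcomp e' psi \o chart_rep k t = e' \o m by rewrite -psiE.
  have -> : g \o generic_rep = e' \o (l \o generic_rep).
    by apply/funext => v; exact: esym (e'E _).
  exact: iso_map.
have : invertible (e' (l a)) by rewrite [e' _]e'E; exact: invertible_mulr gda.
by rewrite -pa rmorphM; exact: invertible_mulr.
Qed.

(** Two nonzero elements of the generic ring have a nonzero product; where it is
    invertible the generic representation lies in both open subfunctors. *)
Lemma moduli_irreducible : irreducible (moduli_functor k n).
Proof.
split.
  exists (chart_ring k (exist _ chain chain_valid)).
  by constructor; exact: chart.
move=> V W oV oW [A [x Vx]] [B [y Wy]].
have [t [f [f0 Vf]]] := open_chart oV Vx.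
have [t' [f' [f0' Wf]]] := open_chart oW Wy.
have [a [a0 aE]] := generic_chart f0; have [b [b0 bE]] := generic_chart f0'.
have [C [h [hab _ _]]] := generic_localisation (generic_mul_neq0 a0 b0).
rewrite rmorphM in hab.
have [psi [ipsi psif]] := aE C h (invertible_mull hab).
have [psi' [ipsi' psif']] := bE C h (invertible_mulr hab).
exists C, (moduli_map psi (chart k t)); split; first exact: Vf.
suff -> : moduli_map psi (chart k t) = moduli_map psi' (chart k t') by exact: Wf.
have cE (u : tree n) (chi : {lrmorphism chart_ring k u -> C}) :
    fam (moduli_map chi (chart k u)) (lrid C) (chi \o chart_rep k u).
  by apply/fam_map; apply: point_map (fam_orbit _) => //; exact: fam_point.
apply: (@moduli_eq_of _ _ _ _ _ (psi \o chart_rep k t)); first exact: cE.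
apply: (point_move (fam_point (moduli_map psi' (chart k t'))) (cE t' psi')).
  by exists t; exact/normal_for_map/chart_rep_normal.
exact: iso_trans (iso_sym ipsi') ipsi.
Qed.

Lemma moduli_variety : variety (moduli_functor k n).
Proof.
split; [exact: moduli_scheme | exact: moduli_separated
      | exact: moduli_irreducible | exact: moduli_finite_cover].
Qed.

End Irreducible.

(** * Dual numbers and the derivative of the potential *)

Section DualNumbers.
Variables (k : fieldType) (A : comAlgType k).

Definition dual : Type := (A * A)%type.
HB.instance Definition _ := GRing.Lmodule.copy dual (A * A)%type.

Definition dual_one : dual := (1, 0).
Definition dual_mul (x y : dual) : dual := (x.1 * y.1, x.1 * y.2 + x.2 * y.1).

Fact dual_mulA : associative dual_mul.
Proof. by move=> x y z; rewrite /dual_mul /=; congr (_, _); ring. Qed.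
Fact dual_mulC : commutative dual_mul.
Proof. by move=> x y; rewrite /dual_mul /=; congr (_, _); ring. Qed.
Fact dual_mul1 : left_id dual_one dual_mul.
Proof. by move=> [x y]; rewrite /dual_mul /= !mul1r mul0r addr0. Qed.
Fact dual_mulDl : left_distributive dual_mul +%R.
Proof. by move=> x y z; rewrite /dual_mul /=; congr (_, _) => /=; ring. Qed.
Fact dual_one_neq0 : dual_one != 0.
Proof. by apply/eqP => -[/eqP]; rewrite oner_eq0. Qed.
HB.instance Definition _ := GRing.Zmodule_isComNzRing.Build dual
  dual_mulA dual_mulC dual_mul1 dual_mulDl dual_one_neq0.
Fact dual_scaleAl (c : k) (x y : dual) : c *: (x * y) = (c *: x : dual) * y.
Proof.
have E : ((c *: (x.1 * y.1), c *: (x.1 * y.2 + x.2 * y.1)) : dual) =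
  ((c *: x.1) * y.1, (c *: x.1) * y.2 + (c *: x.2) * y.1).
  by rewrite scalerDr !scalerAl.
exact: E.
Qed.
HB.instance Definition _ := GRing.Lmodule_isLalgebra.Build k dual dual_scaleAl.
Fact dual_scaleAr (c : k) (x y : dual) : c *: (x * y) = x * (c *: y).
Proof. by rewrite mulrC dual_scaleAl mulrC. Qed.
HB.instance Definition _ := GRing.Lalgebra_isAlgebra.Build k dual dual_scaleAr.

Definition dual_fst (x : dual) : A := x.1.
Definition dual_snd (x : dual) : A := x.2.

Fact dual_fst_additive : zmod_morphism dual_fst. Proof. by []. Qed.
HB.instance Definition _ := GRing.isZmodMorphism.Build dual A dual_fst dual_fst_additive.
Fact dual_fst_multiplicative : monoid_morphism dual_fst. Proof. by []. Qed.
HB.instance Definition _ := GRing.isMonoidMorphism.Build dual A dual_fst dual_fst_multiplicative.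
Fact dual_fst_scalable : scalable dual_fst. Proof. by []. Qed.
HB.instance Definition _ := GRing.isScalable.Build k dual A *:%R dual_fst dual_fst_scalable.
Fact dual_snd_additive : zmod_morphism dual_snd. Proof. by []. Qed.
HB.instance Definition _ := GRing.isZmodMorphism.Build dual A dual_snd dual_snd_additive.

Lemma dual_sndM x y : dual_snd (x * y) = dual_fst x * dual_snd y + dual_snd x * dual_fst y.
Proof. by []. Qed.

Lemma dual_invertible (x : dual) : invertible (dual_fst x) -> invertible x.
Proof.
move=> [a xa]; exists ((a, - (a * a * x.2)) : dual); congr (_, _) => //=.
have -> : x.1 * - (a * a * x.2) + x.2 * a = (1 - x.1 * a) * (x.2 * a) by ring.
by rewrite [x.1 * a]xa subrr mul0r.
Qed.

End DualNumbers.

Section DualHom.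
Variables (k : fieldType) (R A : comAlgType k).

Lemma dual_hom (phi : {lrmorphism R -> A}) (delta : R -> A) :
  {morph delta : a b / a + b} -> (forall c, {morph delta : a / c *: a}) ->
  (forall a b, delta (a * b) = phi a * delta b + delta a * phi b) ->
  exists Phi : {lrmorphism R -> dual A},
    (forall r, dual_fst (Phi r) = phi r) /\ (forall r, dual_snd (Phi r) = delta r).
Proof.
move=> dD dZ dM; have d1 : delta 1 = 0.
  have := dM 1 1; rewrite mulr1 rmorph1 mul1r mulr1.
  by move/eqP; rewrite -subr_eq0 opprD addNKr oppr_eq0 => /eqP.
have [||||Phi PhiE] := @lrmorphism_of k R (dual A) (fun r => (phi r, delta r)).
- by move=> a b; rewrite rmorphD dD.
- by move=> a b; rewrite rmorphM dM.
- by rewrite rmorph1 d1.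
- by move=> c a; rewrite linearZ dZ.
by exists Phi; split=> r; rewrite PhiE.
Qed.

End DualHom.

(** The derivative of the potential in the direction (dX, dY, dZ, da, db, dw).
    Cyclic invariance of the trace moves each direction to the front. *)
Lemma trace_variation (C : comNzRingType) n (X Y Z dX dY dZ : 'M[C]_n)
    (a b da db : 'cV[C]_n) (w dw : 'rV[C]_n) :
  \tr (X *m (Y *m dZ + dY *m Z - (Z *m dY + dZ *m Y)) + dX *m (Y *m Z - Z *m Y))
  + \tr (w *m (Y *m da + dY *m a - (X *m db + dX *m b)) + dw *m (Y *m a - X *m b)) =
  \tr (dX *m (Y *m Z - Z *m Y - b *m w)) + \tr (dY *m (Z *m X - X *m Z + a *m w))
  + \tr (dZ *m (X *m Y - Y *m X)) + \tr (dw *m (Y *m a - X *m b))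
  + \tr (w *m Y *m da - w *m X *m db).
Proof.
have tD p (M N : 'M[C]_p) : \tr (M + N) = \tr M + \tr N by exact: mxtraceD.
have tN p (M : 'M[C]_p) : \tr (- M) = - \tr M by exact: linearN.
have cyc (P Q S : 'M[C]_n) : \tr (P *m (Q *m S)) = \tr (S *m (P *m Q)).
  by rewrite mulmxA mxtrace_mulC.
have outer (D : 'M[C]_n) u : \tr (D *m (u *m w)) = \tr (w *m (D *m u)).
  by rewrite mulmxA mxtrace_mulC.
rewrite [RHS]addrAC !(tD _ (X *m _)) (tD _ (w *m _)) -!mulmxA.
rewrite !(opprD, mulmxDr, mulmxN, tD, tN) !outer.

rewrite (cyc X Y dZ) (cyc X Z dY) (cyc X dY Z) (cyc X dZ Y) (cyc Z X dY) (cyc Y X dZ).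

ring.
Qed.

Section Variation.
Variables (k : fieldType) (n : nat) (C : comAlgType k).

Local Notation fmx := (map_mx (@dual_fst k C)).
Local Notation smx := (map_mx (@dual_snd k C)).

Lemma smx_mul a b c (M : 'M[dual C]_(a, b)) (N : 'M_(b, c)) :
  smx (M *m N) = fmx M *m smx N + smx M *m fmx N.
Proof.
apply/matrixP => i j; rewrite !mxE raddf_sum -big_split; apply: eq_bigr => l _.
by rewrite !mxE; exact: dual_sndM.
Qed.

(** The coefficient of eps in the potential of m is the derivative of the
    potential at the constant part of m in the direction of the eps-part. *)
Lemma potential_variation (m : rep n (dual C)) :
  let m0 := @dual_fst k C \o m in let d := @dual_snd k C \o m in
  let X := rmx m0 in let a := rvec m0 in let w := rform m0 in
  dual_snd (potential m) =
    \tr (rmx d ix *m (X iy *m X iz - X iz *m X iy - a cb *m w))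
    + \tr (rmx d iy *m (X iz *m X ix - X ix *m X iz + a ca *m w))
    + \tr (rmx d iz *m (X ix *m X iy - X iy *m X ix))
    + \tr (rform d *m (X iy *m a ca - X ix *m a cb))
    + \tr (w *m X iy *m rvec d ca - w *m X ix *m rvec d cb).
Proof.
move=> m0 d X a w.
have Xs i : smx (rmx m i) = rmx d i by apply/matrixP => p q; rewrite !mxE.
have as_ c : smx (rvec m c) = rvec d c by apply/colP => p; rewrite !mxE.
have ws : smx (rform m) = rform d by apply/rowP => p; rewrite !mxE.
have Xf i : fmx (rmx m i) = X i by rewrite /X rmx_map.
have af c : fmx (rvec m c) = a c by rewrite /a rvec_map.
have wf : fmx (rform m) = w by rewrite /w rform_map.
have str l (M : 'M[dual C]_l) : dual_snd (\tr M) = \tr (smx M).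
  by rewrite raddf_sum; apply: eq_bigr => i _; rewrite mxE.
rewrite /potential -trace_mx11 raddfD /= !str -trace_variation.
rewrite (smx_mul (rmx m ix)) (smx_mul (rform m)) !map_mxB !smx_mul !map_mxM.
by rewrite !(Xs, Xf, as_, af) ws wf.
Qed.

End Variation.

(** * Critical points of the potential *)

Section Equations.
Variables (C : comNzRingType) (n : nat).

(** The equations of the Quot scheme of the ideal (x, y). *)
Definition line_equations (m : rep n C) : Prop :=
  [/\ rform m = 0,
      forall i j, rmx m i *m rmx m j = rmx m j *m rmx m i
    & rmx m iy *m rvec m ca = rmx m ix *m rvec m cb].

Lemma trace_form0 (M : 'M[C]_n) : (forall D : 'M[C]_n, \tr (D *m M) = 0) -> M = 0.
Proof.
move=> H; apply/matrixP => i j; rewrite [RHS]mxE -(H (delta_mx j i)) /mxtrace.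
rewrite (bigD1 j) //= [X in _ + X]big1 => [|l lj]; last first.
  by rewrite mxE big1 // => p _; rewrite mxE (negPf lj) mul0r.
rewrite addr0 mxE (bigD1 i) //= mxE !eqxx mul1r big1 ?addr0 // => p pi.
by rewrite mxE (negPf pi) andbF mul0r.
Qed.

(** The covector vanishes on all words applied to a and b, by the computation in
    the introduction; the vectors of the tree basis are such words. *)
Lemma line_equations_of_critical t (m : rep n C) : normal_for t m ->
  let X := rmx m in let a := rvec m in let w := rform m in
  X iy *m X iz - X iz *m X iy = a cb *m w ->
  X iz *m X ix - X ix *m X iz = - (a ca *m w) ->
  X ix *m X iy = X iy *m X ix ->
  X iy *m a ca = X ix *m a cb -> w *m X iy = 0 -> w *m X ix = 0 ->
  line_equations m.
Proof.
move=> nm X a w yz zx xy ab wy wx.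
pose Z N := iter N (mulmx (X iz)) 1%:M.
have ZC N : Z N *m X iz = X iz *m Z N.
  by elim: N => [|N IHN] /=; rewrite ?mul1mx ?mulmx1 // -mulmxA IHN.
have trZ (N : nat) (P : 'M[C]_n) : \tr (Z N *m (P *m X iz - X iz *m P)) = 0.
  rewrite mulmxBr linearB /= [Z N *m (X iz *m P)]mulmxA ZC mulmxA.
  by rewrite [X in X - _]mxtrace_mulC !mulmxA subrr.
have wZ0 N c : w *m Z N *m a c = 0.
  have E : \tr (Z N *m (a c *m w)) = 0.
    have [->|->] := ord2P c; last by rewrite -yz; exact: trZ.
    rewrite -[a ca *m w]opprK -zx opprB; exact: trZ.
  apply/matrixP => p q; rewrite !ord1 [RHS]mxE -trace_mx11 -[RHS]E.
  by rewrite [in RHS]mulmxA [RHS]mxtrace_mulC mulmxA.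
have wZS N : w *m Z N.+1 = w *m Z N *m X iz by rewrite -mulmxA ZC.
have wZX N i : i != iz -> w *m Z N *m X i = 0.
  elim: N i => [|N IHN] i iZ.
    by rewrite mulmx1; have [->|->|E] := ord3P i => //; rewrite E in iZ.
  have [c [e E]] : exists c e, X iz *m X i = X i *m X iz + e *: (a c *m w).
    have [->|->|E] := ord3P i; last by rewrite E in iZ.
      by exists ca, (-1); rewrite scaleN1r -zx addrC subrK.
    by exists cb, (-1); rewrite scaleN1r -yz opprB addrC subrK.
  rewrite wZS -mulmxA E mulmxDr mulmxA (IHN _ iZ) mul0mx add0r.
  by rewrite -scalemxAr mulmxA wZ0 mul0mx scaler0.
have w0 : w = 0.
  rewrite -[w]mulmx1 -(frame_normal nm); apply: eq_cols => j.
  rewrite col_mulmx frame_col col0.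
  suff H N : w *m Z N *m tree_eval t a (fun i v => X i *m v) j = 0.
    by have := H 0%N; rewrite mulmx1.
  move: j N; apply: (@tree_ind _ t) => j IH N.
  rewrite tree_evalE; case jE: (tsrc t j) => [c|[i j']]; first exact: wZ0.
  rewrite mulmxA; have [->|iz'] := eqVneq i iz; last by rewrite wZX // mul0mx.
  by rewrite -wZS (IH _ _ jE).
move/eqP: yz; rewrite w0 mulmx0 subr_eq0 => /eqP yz.
move/eqP: zx; rewrite w0 mulmx0 oppr0 subr_eq0 => /eqP zx.
by split=> // i j; have [->|->|->] := ord3P i; have [->|->|->] := ord3P j.
Qed.

End Equations.

Section Critical.
Variables (k : fieldType) (n : nat).
Implicit Types A B C D : comAlgType k.

Let f := moduli_function k n.

Lemma line_equations_variation C (m : rep n (dual C)) :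
  line_equations (@dual_fst k C \o m) -> dual_snd (potential m) = 0.
Proof.
move=> [w0 XC Ya]; rewrite potential_variation w0 !mulmx0 !mul0mx subrr addr0 subr0.
rewrite (XC iy iz) (XC iz ix) (XC ix iy) Ya !subrr.
by rewrite !mulmx0 !mxtrace0 !addr0.
Qed.

(** A derivation of R and a point of R give a lift of this point to the dual
    numbers.  Because eps is nilpotent the lift has a normal form for the same
    tree, and by [line_equations_variation] the potential of this form has no
    eps-part. *)
Lemma in_crit_of_equations A (x : moduli n A) :
  (forall C (g : {lrmorphism A -> C}) m, fam x g m -> line_equations m) ->
  in_crit f x.
Proof.
move=> xE R u ou B h psi uE D derD; apply: locally_eq; have px := fam_point x.
apply: locally_impl (point_locally px h) => C g [m xm].
rewrite rmorph0; have [t nm] := point_normal px xm.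
have [|||Psi [Psi1 Psi2]] := @dual_hom k R C (lrcomp g psi) (fun r => g (psi (D r))).
- by move=> a b; rewrite linearD /= !rmorphD.
- by move=> c a; rewrite linearZ /= !linearZ.
- by move=> a b; rewrite derD !rmorphD !rmorphM /=; congr (_ + _); exact: mulrC.
pose z : moduli n (dual C) := moduli_map Psi u.
have zE : moduli_map (@dual_fst k C) z = moduli_map (lrcomp g h) x.
  rewrite -(@moduli_map_comp _ _ _ _ _ _ _ (lrcomp g psi)); last by move=> r; rewrite /= Psi1.
  rewrite (@moduli_map_comp _ _ _ _ _ psi g (lrcomp g psi)) //.
  by rewrite [moduli_map psi u]uE (@moduli_map_comp _ _ _ _ _ h g (lrcomp g h)).
have fst_form : has_form t z (@dual_fst k C).
  exists m; split=> //.
  have : fam (moduli_map (lrcomp g h) x) (lrid C) m.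
    by apply/fam_map; apply: point_ext xm.
  by rewrite -zE => /fam_map; apply: point_ext => //; exact: fam_point.
have [J JE] := chart_open t z.
have [mt [nmt zmt]] : has_form t z (lrid (dual C)).
  apply/JE; have /JE[w ws w1] := fst_form.
  have idJ := ideal_gen_is_ideal [set lrid (dual C) a | a in J]%classic.
  (* lift a combination equal to 1 from C to the dual numbers *)
  have [v [vJ v1]] : exists v : dual C, ideal_gen [set lrid (dual C) a | a in J]%classic v /\ dual_fst v = 1.
    rewrite w1; elim: w ws {w1} => [|c w IH] ws.
      by exists 0; split; [case: idJ | rewrite big_nil].
    have [|v [vJ vE]] := IH; first by move=> e ew; apply: ws; rewrite inE ew orbT.
    have [a Ja ac] : [set @dual_fst k C a | a in J]%classic c.2 by apply: ws; exact: mem_head.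
    exists (((c.1, 0) : dual C) * a + v); split; last first.
      by rewrite big_cons -vE -ac.
    case: idJ => _ JD JM; apply: JD => //; apply: (JM).
    by apply: ideal_gen_sub; exists a.
  have [|b vb] := @dual_invertible k C v; first by rewrite v1; exact: invertible1.
  by rewrite -vb mulrC; case: idJ => _ _; apply.
have Emt : line_equations (@dual_fst k C \o mt).
  apply: (xE C (lrcomp g h)).
  have : fam (moduli_map (@dual_fst k C) z) (lrid C) (@dual_fst k C \o mt).
    by apply/fam_map; apply: point_map zmt => //; exact: fam_point.
  by rewrite zE => /fam_map; apply: point_ext => //; exact: fam_point.
have := line_equations_variation Emt.
rewrite (moduli_valueE zmt) /= [moduli_value z]moduli_value_natural.
by rewrite Psi2.
Qed.

(** The chart of the tree of m sees only directions that keep m in normal form.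
    For any other direction, renormalising over the dual numbers leaves the
    potential unchanged and the constant part equal to m.  So the derivative of
    the potential at m vanishes in all directions, and elementary directions give
    the equations one by one. *)
Lemma equations_of_in_crit A (x : moduli n A) : in_crit f x ->
  forall C (g : {lrmorphism A -> C}) m, fam x g m -> line_equations m.
Proof.
move=> cx C g m xm; have [t nm] := point_normal (fam_point x) xm.
have var (mt : rep n (dual C)) : @dual_fst k C \o mt = m ->
    dual_snd (potential mt) = 0.
  move=> mtE.
  have [|m' [nm' im']] := @normalise_det k n t (dual C) mt.
    apply: dual_invertible; rewrite -det_map_mx -frame_map mtE frame_normal // det1.
    exact: invertible1.
  have m'E : @dual_fst k C \o m' = m.
    apply: normal_iso_eq nm _; first exact: normal_for_map.
    by rewrite -mtE; apply/iso_sym/iso_map.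
  rewrite (potential_iso im'); have [Phi PhiE] := chart_rep_lift nm'.
  rewrite -PhiE potential_map; set r := potential _.
  pose phi : {lrmorphism chart_ring k t -> C} := lrcomp (@dual_fst k C) Phi.
  have crit0 i : phi (mderiv i r) = 0.
    have -> : r = f _ (chart k t).
      rewrite /r (moduli_valueE (fam_orbit (ex_intro _ t (chart_rep_normal k t)))).
      by [].
    apply: (cx _ (chart k t) (chart_immersion k t) C g phi _ (mderiv i)).
      apply: (@moduli_eq_of _ _ _ _ _ m); apply/fam_map.
        have -> : m = phi \o chart_rep k t by rewrite -m'E -PhiE.
        by apply: point_map (fam_orbit _) => //; exact: fam_point.
      by apply: point_ext xm => //; exact: fam_point.
    by move=> a b; rewrite [LHS](mderivM i) addrC; congr (_ + _); exact: mulrC.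
  pose y i := dual_snd (Phi 'X_i).
  have [|||Psi [Psi1 Psi2]] := @dual_hom k (chart_ring k t) C phi
      (fun p => \sum_i phi (mderiv i p) * y i).
  - move=> a b; rewrite -big_split; apply: eq_bigr => i _.
    by rewrite linearD rmorphD mulrDl.
  - move=> c a; rewrite scaler_sumr; apply: eq_bigr => i _.
    by rewrite !linearZ scalerAl.
  - move=> a b; rewrite mulr_sumr mulr_suml -big_split; apply: eq_bigr => i _ /=.
    have -> : mderiv i (a * b) = mderiv i a * b + a * mderiv i b by exact: mderivM.
    by rewrite rmorphD !rmorphM /=; ring.
  (* two morphisms out of a polynomial ring that agree on the variables *)
  have E : Phi r = Psi r.
    apply: mpoly_hom_ext => i.
    have eq_dual (u v : dual C) : dual_fst u = dual_fst v -> dual_snd u = dual_snd v -> u = v.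
      by case: u v => [u1 u2] [v1 v2] /= -> ->.
    apply: eq_dual; first by rewrite Psi1.
    have dX j : mderiv j ('X_i : {mpoly k[_]}) = (i == j)%:R.
      rewrite mderivX mnmE; have [->|_] := eqVneq i j; last by rewrite scale0r.
      by rewrite scale1r -{1}[U_(j)%MM]add0m addmK mpolyX0.
    rewrite Psi2 (bigD1 i) //= big1 => [|j ji].
      by rewrite dX eqxx rmorph1 mul1r addr0.
    by rewrite dX eq_sym (negPf ji) rmorph0 mul0r.
  transitivity (dual_snd (Psi r)); first by congr dual_snd; exact: E.
  by rewrite Psi2 big1 // => i _; rewrite crit0 mul0r.
have var2 (d : rep n C) :
  let X := rmx m in let a := rvec m in let w := rform m in
    \tr (rmx d ix *m (X iy *m X iz - X iz *m X iy - a cb *m w))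
    + \tr (rmx d iy *m (X iz *m X ix - X ix *m X iz + a ca *m w))
    + \tr (rmx d iz *m (X ix *m X iy - X iy *m X ix))
    + \tr (rform d *m (X iy *m a ca - X ix *m a cb))
    + \tr (w *m X iy *m rvec d ca - w *m X ix *m rvec d cb) = 0.
  by have := var (fun v => (m v, d v)) erefl; rewrite potential_variation.
pose X := rmx m; pose a := rvec m; pose w := rform m.
have tr0 p : \tr (0 : 'M[C]_p) = 0 by exact: mxtrace0.
have varX (D : 'I_3 -> 'M[C]_n) : 
    \tr (D ix *m (X iy *m X iz - X iz *m X iy - a cb *m w))
    + \tr (D iy *m (X iz *m X ix - X ix *m X iz + a ca *m w))
    + \tr (D iz *m (X ix *m X iy - X iy *m X ix)) = 0.
  have := var2 (mk_rep (fun=> 0) D 0).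
  by rewrite /= !rvec_mk !rmx_mk rform_mk mul0mx !mulmx0 subrr !tr0 !addr0.
apply: (line_equations_of_critical nm).
- apply/eqP; rewrite -subr_eq0; apply/eqP/trace_form0 => D.
  have := varX (fun i => if i == ix then D else 0).
  by rewrite /= !mul0mx !tr0 !addr0.
- apply/eqP; rewrite -subr_eq0 opprK; apply/eqP/trace_form0 => D.
  have := varX (fun i => if i == iy then D else 0).
  by rewrite /= !mul0mx !tr0 addr0 add0r.
- apply/eqP; rewrite -subr_eq0; apply/eqP/trace_form0 => D.
  have := varX (fun i => if i == iz then D else 0).
  by rewrite /= !mul0mx !tr0 !add0r.
- apply/eqP; rewrite -subr_eq0; apply/eqP/colP => p.
  have := var2 (mk_rep (fun=> 0) (fun=> 0) (delta_mx 0 p)).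
  rewrite /= !rvec_mk !rmx_mk rform_mk !mul0mx !mulmx0 subrr !tr0 addr0 !add0r.
  by rewrite -rowE trace_mx11 !mxE.
- apply/rowP => p.
  have := var2 (mk_rep (fun c => if c == ca then delta_mx p 0 else 0) (fun=> 0) 0).
  rewrite /= !rvec_mk !rmx_mk rform_mk !mul0mx !mulmx0 subr0 !tr0 !add0r /=.
  by rewrite -colE trace_mx11 !mxE.
- apply/rowP => p.
  have := var2 (mk_rep (fun c => if c == cb then delta_mx p 0 else 0) (fun=> 0) 0).
  rewrite /= !rvec_mk !rmx_mk rform_mk !mul0mx !mulmx0 sub0r !tr0 !add0r /=.
  by rewrite -colE linearN /= trace_mx11 !mxE => /eqP; rewrite oppr_eq0 => /eqP.
Qed.

End Critical.

(** * Normal forms exist locally *)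

Section Generation.
Variables (n : nat) (C : comNzRingType).
Implicit Type m : rep n C.

(** The submodule generated by a and b under X, Y and Z. *)
Inductive reach m : 'cV[C]_n -> Prop :=
| reach_vec c : reach m (rvec m c)
| reach_mx i v : reach m v -> reach m (rmx m i *m v)
| reach_zero : reach m 0
| reach_add v v' : reach m v -> reach m v' -> reach m (v + v')
| reach_scale (a : C) v : reach m v -> reach m (a *: v).

Definition generating m : Prop := forall v, reach m v.

Lemma reach_sum m (I : Type) (r : seq I) (F : I -> 'cV[C]_n) :
  (forall i, reach m (F i)) -> reach m (\sum_(i <- r) F i).
Proof. by move=> H; elim/big_ind: _ => //; [exact: reach_zero | exact: reach_add]. Qed.

Lemma generating_delta m : (forall j, reach m (delta_mx j 0)) -> generating m.
Proof.
move=> H v; rewrite [v]matrix_sum_delta; apply: reach_sum => i.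
by rewrite big_ord1; apply: reach_scale.
Qed.

Lemma generating_iso m m' : iso m m' -> generating m -> generating m'.
Proof.
move=> [g [[gv gX _] [g' gg']]] gen v; rewrite -[v]mul1mx -gg' -mulmxA.
elim: {v}(gen (g' *m v)) => [c|i v _ IH||v v' _ IH _ IH'|a v _ IH].
- by rewrite gv; exact: reach_vec.
- by rewrite mulmxA gX -mulmxA; exact: reach_mx.
- by rewrite mulmx0; exact: reach_zero.
- by rewrite mulmxDr; exact: reach_add.
- by rewrite -scalemxAr; exact: reach_scale.
Qed.

(** The transvection 1 + (x - u) l, whose inverse is
    1 - (x - u) l / (l x). *)
Lemma basis_change (x u : 'cV[C]_n) (l : 'rV[C]_n) (y : C) :
  l *m u = 1%:M -> (l *m x) 0 0 * y = 1 ->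
  exists g g' : 'M[C]_n, [/\ g *m g' = 1%:M, g *m u = x
    & forall v : 'cV[C]_n, l *m v = 0 -> g *m v = v].
Proof.
move=> lu lxy; pose a := x - u; exists (1%:M + a *m l), (1%:M - y *: (a *m l)).
have lxu : l *m a = ((l *m x) 0 0 - 1)%:M.
  rewrite mulmxBr lu; apply/matrixP => p q; rewrite !ord1 [LHS]mxE [RHS]mxE.
  by rewrite [X in _ + X]mxE [X in _ - X]mxE eqxx !mulr1n.
have au : a + u = x by rewrite /a subrK.
move: a lxu au => a lxu au; split=> [||v lv].
- rewrite mulmxBr mulmx1 mulmxDl mul1mx -scalemxAr mulmxA -[_ *m l *m _]mulmxA lxu.
  rewrite mul_mx_scalar -scalemxAl scalerA -scalerDl mulrBr mulr1 [y * _]mulrC lxy.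
  by rewrite [y + _]addrC subrK scale1r addrK.
- by rewrite mulmxDl mul1mx -mulmxA lu mulmx1 addrC.
- by rewrite mulmxDl mul1mx -mulmxA lv mulmx0 addr0.
Qed.

(** Sources whose parent is among the first N basis vectors. *)
Definition admissible (N : nat) (s : source n) : bool :=
  if s is inr (_, j) then (j < N)%N else true.

Definition partly_normal (N : nat) m : Prop := exists t : 'I_n -> source n,
  forall j : 'I_n, (j < N)%N -> admissible j (t j) /\ rcol m (t j) = delta_mx j 0.

Lemma partly_normal_full m : partly_normal n m -> normal m.
Proof.
move=> [t tP]; pose f := [ffun j => t j].
have fv : valid_tree f.
  apply/andP; split; last first.
    apply/forallP => j; rewrite ffunE; have [] := tP j (ltn_ord j).
    by case: (t j) => [//|[]].
  apply/injectiveP => i j; rewrite !ffunE => E.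
  have [[_ ei] [_ ej]] := (tP i (ltn_ord i), tP j (ltn_ord j)).
  apply/eqP; have /colP/(_ i) : delta_mx i 0 = delta_mx j 0 :> 'cV[C]_n by rewrite -ei -ej E.
  rewrite !mxE !eqxx !andbT; case: (i == j) => // /eqP.
  by rewrite oner_eq0.
exists (exist _ f fv) => j; rewrite /tsrc /= ffunE.
by case: (tP j (ltn_ord j)).
Qed.

(** Modulo the ideal of these entries the span of the first j0 basis vectors
    contains a and b and is stable under X, Y and Z.  Generation puts e_j0 into
    this span, so 1 lies in the ideal. *)
Lemma pivot_ideal m (j0 : 'I_n) : generating m ->
  ideal_gen [set c | exists s (i : 'I_n),
    [/\ admissible j0 s, (j0 <= i)%N & c = rcol m s i 0]]%classic 1.
Proof.
move=> gen; set E := mkset _; have idJ := ideal_gen_is_ideal E; have [J0 JD JM] := idJ.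
suff H v : reach m v -> forall i : 'I_n, (j0 <= i)%N -> ideal_gen E (v i 0).
  by have := H _ (gen (delta_mx j0 0)) j0 (leqnn _); rewrite mxE !eqxx.
elim=> [c|x w _ IH||w w' _ IH _ IH'|a w _ IH] i ji.
- by apply: ideal_gen_sub; exists (inl c), i.
- rewrite mxE; apply: ideal_sum => // j _.
  have [jj0|jj0] := ltnP j j0; last by apply: (JM); exact: IH.
  rewrite mulrC; apply: (JM); apply: ideal_gen_sub; exists (inr (x, j)), i.
  by split=> //; rewrite !mxE.
- by rewrite mxE.
- by rewrite mxE; apply: JD; [exact: IH | exact: IH'].
- by rewrite mxE; apply: (JM); exact: IH.
Qed.

(** A column with an invertible entry in row i >= j0 can be moved to e_j0 by a
    change of basis that fixes the earlier basis vectors. *)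
Lemma partly_normal_step m (j0 i : 'I_n) s : partly_normal j0 m ->
  admissible j0 s -> (j0 <= i)%N -> invertible (rcol m s i 0) ->
  exists m', iso m m' /\ partly_normal j0.+1 m'.
Proof.
move=> [t tP] sj0 ji [b ub]; set u := rcol m s in ub.
have [l [y [lu ly l0]]] : exists (l : 'rV[C]_n) y, [/\ l *m u = 1%:M,
    (l *m (delta_mx j0 0 : 'cV_n)) 0 0 * y = 1
    & forall j : 'I_n, (j < j0)%N -> l *m (delta_mx j 0 : 'cV_n) = 0].
  have dE (p q : 'I_n) : (delta_mx 0 p : 'rV[C]_n) *m delta_mx q 0 = (p == q)%:R%:M.
    by rewrite -rowE; apply/matrixP => x z; rewrite !ord1 !mxE eqxx andbT mulr1n.
  have dv (p : 'I_n) (v : 'cV[C]_n) : (delta_mx 0 p : 'rV[C]_n) *m v = (v p 0)%:M.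
    by rewrite -rowE; apply/matrixP => x z; rewrite !ord1 !mxE mulr1n.
  have [ij|ij] := eqVneq i j0.
    exists (b *: delta_mx 0 j0), (u i 0); split.
    - by rewrite -scalemxAl dv -ij scale_scalar_mx mulrC ub.
    - by rewrite -scalemxAl dE eqxx scale_scalar_mx mulr1 mxE mulr1n mulrC.
    - move=> j jj0; rewrite -scalemxAl dE; case: eqP jj0 => [->|_ _].
        by rewrite ltnn.
      by rewrite raddf0 scaler0.
  (* l is e_j0 corrected along e_i so that l u = 1 and l e_j0 = 1 *)
  exists (delta_mx 0 j0 + (b * (1 - u j0 0)) *: delta_mx 0 i), 1; split.
  - rewrite mulmxDl -scalemxAl !dv scale_scalar_mx -raddfD /=; congr (_%:M).
    by rewrite mulrAC [b * _]mulrC ub mul1r addrC subrK.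
  - rewrite mulmxDl -scalemxAl !dE eqxx (negPf ij) raddf0 scaler0 addr0.
    by rewrite mxE mulr1n mulr1.
  - move=> j jj0; rewrite mulmxDl -scalemxAl !dE.
    rewrite -!val_eqE /= (gtn_eqF jj0) (gtn_eqF (leq_trans jj0 ji)).
    by rewrite !raddf0 ?scaler0 addr0.
have [g [g' [gg' gu gf]]] := basis_change lu ly.
have g'g := mulmx1C gg'.
have gd (j : 'I_n) : (j < j0)%N -> g *m delta_mx j 0 = delta_mx j 0 :> 'cV_n by move=> /l0/gf.
have g'd (j : 'I_n) : (j < j0)%N -> g' *m delta_mx j 0 = delta_mx j 0 :> 'cV_n.
  by move=> jj; rewrite -[in LHS](gd _ jj) mulmxA g'g mul1mx.
exists (transport g g' m); split; first exact: transport_iso.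
have colE s' : admissible j0 s' -> rcol (transport g g' m) s' = g *m rcol m s'.
  case: s' => [c|[x j]] /= aj; first exact: rvec_mk.
  by rewrite !rcol_mx rmx_mk -!mulmxA g'd.
exists (fun j => if j == j0 then s else t j) => j; rewrite ltnS leq_eqVlt.
have [->|jj0] := eqVneq j j0; first by rewrite colE.
rewrite (inj_eq val_inj) (negPf jj0) /= => lj; have [aj tj] := tP j lj; split=> //.
rewrite colE ?tj ?gd //; case: (t j) aj => [//|[x j']] /= j'j.
exact: ltn_trans lj.
Qed.

End Generation.

Section LocalNormalForm.
Variables (k : fieldType) (n : nat).
Implicit Types C D : comAlgType k.

Lemma reach_map C D (h : {lrmorphism C -> D}) (m : rep n C) v :
  reach m v -> reach (h \o m) (map_mx h v).
Proof.
elim=> [c|i w _ IH||w w' _ IH _ IH'|a w _ IH].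
- by rewrite -rvec_map; exact: reach_vec.
- by rewrite map_mxM -rmx_map; exact: reach_mx.
- by rewrite map_mx0; exact: reach_zero.
- by rewrite map_mxD; exact: reach_add.
- by rewrite map_mxZ; exact: reach_scale.
Qed.

Lemma generating_map C D (h : {lrmorphism C -> D}) (m : rep n C) :
  generating m -> generating (h \o m).
Proof.
move=> gen; apply: generating_delta => j.
by rewrite -(map_delta_mx h); exact: reach_map.
Qed.

Lemma partly_normal_map C D (h : {lrmorphism C -> D}) (m : rep n C) N :
  partly_normal N m -> partly_normal N (h \o m).
Proof.
move=> [t tP]; exists t => j /tP[aj tj]; split=> //.
by rewrite rcol_map tj map_delta_mx.
Qed.

(** Gaussian elimination along the tree: by [pivot_ideal] the next pivot exists
    over the members of a cover. *)
Lemma generating_locally_normal C (m : rep n C) : generating m ->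
  locally (fun D (h : {lrmorphism C -> D}) => exists m', normal m' /\ iso (h \o m) m').
Proof.
suff H d N D (m0 : rep n D) : (N + d)%N = n -> generating m0 -> partly_normal N m0 ->
    locally (fun E (h : {lrmorphism D -> E}) => exists m', normal m' /\ iso (h \o m0) m').
  move=> gen; apply: (H n 0%N) => //; exists (fun=> inl ca) => j.
  by rewrite ltn0.
elim: d N D m0 => [|d IH] N D m0.
  rewrite addn0 => -> _ /partly_normal_full nm; apply: locally_all => E h.
  by exists (h \o m0); split; [exact: normal_map | exact: iso_refl].
move=> Nd gen pn; have Nn : (N < n)%N by rewrite -Nd addnS ltnS leq_addr.
have LP := pivot_ideal (Ordinal Nn) gen.
apply: (@locally_trans _ _ (fun E h => exists m', normal m' /\ iso (h \o m0) m')).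
  move=> E g g' gg' [m' [nm' im']]; exists m'; split=> //.
  by have -> : g' \o m0 = g \o m0 by apply/funext => v; rewrite /= gg'.
apply: ideal_gen_min LP; first exact: ideal_gen_is_ideal.
move=> _ [s [i [sN Ni ->]]]; apply: ideal_gen_sub => E h hu.
have [|m1 [i1 pn1]] := @partly_normal_step n E (h \o m0) (Ordinal Nn) i s
    (partly_normal_map h pn) sN Ni.
  by rewrite rcol_map mxE.
have gen1 : generating m1 by apply: generating_iso i1 _; exact: generating_map.
have := IH N.+1 E m1 _ gen1 pn1; rewrite addSnnS => /(_ Nd).
apply: locally_impl => F f [m' [nm' im']]; exists m'; split=> //.
exact: iso_trans (iso_map f i1) im'.
Qed.

End LocalNormalForm.

(** * The monomial basis of the ideal (x, y) *)

Section Monomials.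

(** The monomials in the ideal (x, y). *)
Definition line_mon (u : 'X_{1..3}) : bool := (u ix != 0%N) || (u iy != 0%N).
Definition line_gen (c : 'I_2) : 'I_3 := if c == ca then ix else iy.

Lemma line_monDr u v : line_mon v -> line_mon (u + v)%MM.
Proof.
rewrite /line_mon !mnmDE !addn_eq0 !negb_and => /orP[] -> //; rewrite ?orbT //.
Qed.

Lemma line_mon_gen c : line_mon U_(line_gen c)%MM.
Proof. by rewrite /line_mon !mnm1E; have [->|->] := ord2P c. Qed.

Lemma mnm_ind (P : 'X_{1..3} -> Prop) : P 0%MM ->
  (forall i u, P u -> P (U_(i) + u)%MM) -> forall u, P u.
Proof.
move=> P0 PS u; have [N] := ubnP (mdeg u); elim: N u => // N IHN u uN.
have [->//|u0] := eqVneq u 0%MM.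
have [i ui] : exists i, u i != 0%N.
  apply: contrapT => H; case/eqP: u0; apply/mnmP => i; rewrite mnm0E.
  by apply/eqP; apply: contrapT => /negP ui; apply: H; exists i.
have E : u = (U_(i) + (u - U_(i)))%MM by rewrite addmC submK // lep1mP.
by rewrite E; apply: PS; apply: IHN; rewrite E mdegD mdeg1 in uN.
Qed.

(** Taking a letter away from a monomial of the ideal leaves a monomial of the
    ideal or a power of z; in the second case the letters z are taken away first. *)
Lemma line_mon_ind (P : 'X_{1..3} -> Prop) :
  (forall c, P U_(line_gen c)%MM) ->
  (forall i u, line_mon u -> P u -> P (U_(i) + u)%MM) ->
  forall u, line_mon u -> P u.
Proof.
move=> Pg PS; apply: mnm_ind => [|i u IH iu]; first by rewrite /line_mon !mnm0E.
have [lu|lu] := boolP (line_mon u); first by apply: PS => //; exact: IH.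
move: iu lu; rewrite /line_mon !mnmDE !mnm1E negb_or !negbK => iu /andP[/eqP ux /eqP uy].
have {}iu : i != iz.
  by move: iu; rewrite ux uy; have [->|->|->] := ord3P i.
pose Q v := P (U_(i) + v)%MM.
suff: u ix = 0%N -> u iy = 0%N -> Q u by apply.
move: u {ux uy IH}; apply: mnm_ind => [_ _|j v IH].
  rewrite /Q addm0; move: iu; have [->|->|->] := ord3P i => // _.
    exact: (Pg ca).
  exact: (Pg cb).
rewrite !mnmDE !mnm1E; have [->|->|->] := ord3P j => //= vx vy.
rewrite /Q addmA [(U_(i) + _)%MM]addmC -addmA; apply: PS; last exact: IH.
rewrite /line_mon !mnmDE !mnm1E !addn_eq0 !negb_and; move: iu.
by have [->|->|->] := ord3P i; rewrite ?orbT.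
Qed.

End Monomials.

Section LinePolynomials.
Variable C : comNzRingType.
Implicit Types p q : {mpoly C[3]}.

Definition line_poly p : Prop := forall u, ~~ line_mon u -> p@_u = 0.

Lemma line_poly_ideal : is_ideal line_poly.
Proof.
split=> [u _|p q lp lq u nu|a p lp u nu]; first exact: mcoeff0.
  by rewrite mcoeffD lp // lq // addr0.
rewrite mcoeffM big1 // => v /eqP uE; rewrite [p@__]lp ?mulr0 //.
by apply: contra nu => lv; rewrite uE line_monDr.
Qed.

Lemma line_polyX u : line_mon u -> line_poly 'X_[u].
Proof. by move=> lu v nv; rewrite mcoeffX; case: eqP nv => // <-; rewrite lu. Qed.

Lemma line_polyZ a p : line_poly p -> line_poly (a *: p).
Proof. by move=> lp u nu; rewrite mcoeffZ lp // mulr0. Qed.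

Lemma line_polyB p q : line_poly p -> line_poly q -> line_poly (p - q).
Proof. by move=> lp lq u nu; rewrite mcoeffB lp // lq // subrr. Qed.

Lemma line_poly_sum (I : finType) (F : I -> {mpoly C[3]}) :
  (forall i, line_poly (F i)) -> line_poly (\sum_i F i).
Proof. by move=> H; apply: ideal_sum => //; exact: line_poly_ideal. Qed.

Lemma line_poly_ind (P : {mpoly C[3]} -> Prop) : P 0 ->
  (forall p q, P p -> P q -> P (p + q)) ->
  (forall a u, line_mon u -> P (a *: 'X_[u])) ->
  forall p, line_poly p -> P p.
Proof.
move=> P0 PD PX p lp; rewrite [p]mpolyE big_seq; elim/big_ind: _ => // u up.
apply: PX; apply: contraT => /lp /eqP; rewrite mcoeff_eq0.
by rewrite up.
Qed.

End LinePolynomials.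

Section PullbackLine.
Variables (k : fieldType) (C : comAlgType k).

Lemma pullback_lineP (p : {mpoly C[3]}) : pullback (line_ideal k) p <-> line_poly p.
Proof.
split.
  apply: extend_min; first exact: line_poly_ideal.
  move=> q; apply: (ideal_gen_map (line_poly_ideal C)) => _ [->|->].
    by rewrite /= map_mpolyX; apply: line_polyX; rewrite /line_mon !mnm1E.
  by rewrite /= map_mpolyX; apply: line_polyX; rewrite /line_mon !mnm1E.
have [J0 JD JM] := extend_ideal (in_alg C) (line_ideal k).
move: p; apply: line_poly_ind => // a; apply: line_mon_ind => [c|i u _ IH].
  rewrite -mul_mpolyC; apply: (JM); rewrite -(map_mpolyX (in_alg C)); apply: extend_map.
  by apply: ideal_gen_sub; have [->|->] := ord2P c; [left | right].
by rewrite mpolyXD scalerAr; exact: JM.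
Qed.

End PullbackLine.

Section PolyVec.
Variables (C : comNzRingType) (n : nat) (m : rep n C).

Let pw i e (v : 'cV[C]_n) := iter e (mulmx (rmx m i)) v.

(** The value at x^i y^j z^l of the map I_C -> C^n that sends x to a and y to b.
    The letter split off is x whenever i > 0, and otherwise y. *)
Definition mono_vec (u : 'X_{1..3}) : 'cV[C]_n :=
  match u ix, u iy with
  | a.+1, b => pw ix a (pw iy b (pw iz (u iz) (rvec m ca)))
  | 0%N, b.+1 => pw iy b (pw iz (u iz) (rvec m cb))
  | 0%N, 0%N => 0
  end.

Definition poly_vec (p : {mpoly C[3]}) : 'cV[C]_n :=
  \sum_(u <- msupp p) p@_u *: mono_vec u.

Lemma poly_vecE p d : (msize p <= d)%N ->
  poly_vec p = \sum_(u : 'X_{1..3 < d}) p@_u *: mono_vec u.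
Proof.
move=> pd; pose I : subFinType _ := 'X_{1..3 < d}.
rewrite /poly_vec (big_mksub I) ?msupp_uniq //=; first last.
  by move=> x /msize_mdeg_lt /leq_trans; apply.
by rewrite big_rmcond //= => j /memN_msupp_eq0 ->; rewrite scale0r.
Qed.

Fact poly_vec_linear : linear poly_vec.
Proof.
move=> a p q; pose d := maxn (msize (a *: p + q)) (maxn (msize p) (msize q)).
have d1 : (msize (a *: p + q) <= d)%N by rewrite leq_maxl.
have d2 : (msize p <= d)%N by rewrite !leq_max leqnn !orbT.
have d3 : (msize q <= d)%N by rewrite !leq_max leqnn !orbT.
rewrite (poly_vecE d1) (poly_vecE d2) (poly_vecE d3) scaler_sumr -big_split.
by apply: eq_bigr => u _; rewrite mcoeffD mcoeffZ scalerDl scalerA.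
Qed.
HB.instance Definition _ := GRing.isLinear.Build C {mpoly C[3]} 'cV[C]_n *:%R
  poly_vec poly_vec_linear.

Lemma poly_vecX u : poly_vec 'X_[u] = mono_vec u.
Proof. by rewrite /poly_vec msuppX big_seq1 mcoeffX eqxx scale1r. Qed.

Lemma mono_vec_gen c : mono_vec U_(line_gen c) = rvec m c.
Proof. by rewrite /mono_vec !mnm1E; have [->|->] := ord2P c. Qed.

Hypothesis line_m : line_equations m.

Let pwC i j e v : rmx m i *m pw j e v = pw j e (rmx m i *m v).
Proof.
case: line_m => _ XC _; elim: e => //= e <-.
by rewrite !mulmxA XC.
Qed.

(** Multiplying a multiple of y by x changes the letter that is split off; this
    is where Y a = X b enters. *)
Lemma mono_vec_mul i u : line_mon u -> mono_vec (U_(i) + u) = rmx m i *m mono_vec u.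
Proof.
case: (line_m) => _ XC Ya; rewrite /line_mon /mono_vec !mnmDE !mnm1E.
case: (u ix) => [|a]; case: (u iy) => [|b] // _; have [->|->|->] := ord3P i;
  rewrite /= ?addn0 ?add0n ?add1n ?pwC //=.
- by rewrite Ya.
- by rewrite !mulmxA XC.
Qed.

Lemma poly_vec_mulX i p : line_poly p -> poly_vec ('X_i * p) = rmx m i *m poly_vec p.
Proof.
move: p; apply: line_poly_ind => [|p q pE qE|a u lu].
- by rewrite mulr0 linear0 mulmx0.
- by rewrite mulrDr !linearD /= pE qE.
- by rewrite -scalerAr -mpolyXD !linearZ /= !poly_vecX mono_vec_mul.
Qed.

Lemma poly_vec_mul0 a p : line_poly p -> poly_vec p = 0 -> poly_vec (a * p) = 0.
Proof.
move=> lp p0; rewrite [a]mpolyE mulr_suml linear_sum big1 // => u _.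
rewrite -scalerAl linearZ /=; suff -> : poly_vec ('X_[u] * p) = 0 by rewrite scaler0.
move: u; apply: mnm_ind => [|i u IH]; first by rewrite mpolyX0 mul1r.
rewrite mpolyXD -mulrA poly_vec_mulX ?IH ?mulmx0 //.
by case: (line_poly_ideal C) => _ _; apply.
Qed.

Lemma poly_vec_unique (kappa : {mpoly C[3]} -> 'cV[C]_n) :
  (forall a p q, line_poly p -> line_poly q -> kappa (a *: p + q) = a *: kappa p + kappa q) ->
  (forall c, kappa 'X_(line_gen c) = rvec m c) ->
  (forall i p, line_poly p -> kappa ('X_i * p) = rmx m i *m kappa p) ->
  forall p, line_poly p -> kappa p = poly_vec p.
Proof.
move=> kl kg kX p lp.
have l0 : line_poly (0 : {mpoly C[3]}) by case: (line_poly_ideal C).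
have k0 : kappa 0 = 0.
  by have := kl (-1) 0 0 l0 l0; rewrite scaler0 addr0 scaleN1r addNr.
suff [] : line_poly p /\ kappa p = poly_vec p by [].
move: p lp; apply: line_poly_ind => [|p q [lp pE] [lq qE]|a u lu].
- by rewrite k0 linear0.
- split; first by case: (line_poly_ideal C) => _ + _; apply.
  by rewrite linearD /= -pE -qE -[p]scale1r kl // !scale1r.
- have lau : line_poly (a *: 'X_[u] : {mpoly C[3]}) by exact/line_polyZ/line_polyX.
  split=> //; rewrite linearZ /= poly_vecX -[a *: _]addr0 kl //; last exact: line_polyX.
  rewrite k0 addr0; congr (_ *: _); move: u lu {lau}.
  apply: line_mon_ind => [c|i u lu IH]; first by rewrite kg mono_vec_gen.
  by rewrite mpolyXD kX ?IH ?mono_vec_mul //; exact: line_polyX.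
Qed.

End PolyVec.

Section TreeMonomials.
Variables (n : nat) (t : tree n).

(** The monomial obtained by following the recipe of the tree in I_C. *)
Definition tree_mon : 'I_n -> 'X_{1..3} :=
  tree_eval t (fun c => U_(line_gen c)%MM) (fun i u => (U_(i) + u)%MM).

Lemma tree_mon_line j : line_mon (tree_mon j).
Proof.
move: j; apply: (@tree_ind _ t) => j IH; rewrite /tree_mon tree_evalE.
case jE: (tsrc t j) => [c|[i j']]; first exact: line_mon_gen.
by apply: line_monDr; exact: IH jE.
Qed.

Lemma mono_vec_tree (C : comNzRingType) (m : rep n C) j : line_equations m ->
  mono_vec m (tree_mon j) = col j (frame t m).
Proof.
move=> lm; rewrite frame_col; move: j; apply: (@tree_ind _ t) => j IH.
rewrite tree_evalE /tree_mon tree_evalE; case jE: (tsrc t j) => [c|[i j']].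
  exact: mono_vec_gen.
by rewrite mono_vec_mul // ?(IH _ _ jE) //; exact: tree_mon_line.
Qed.

Lemma poly_vec_tree (C : comNzRingType) (m : rep n C) j : line_equations m ->
  normal_for t m -> poly_vec m 'X_[tree_mon j] = delta_mx j 0.
Proof. by move=> lm nm; rewrite poly_vecX mono_vec_tree // frame_normal // col1. Qed.

End TreeMonomials.

Section MapPolyVec.
Variables (C D : comNzRingType) (n : nat).

Lemma mono_vec_map (h : {rmorphism C -> D}) (m : rep n C) u :
  mono_vec (h \o m) u = map_mx h (mono_vec m u).
Proof.
have pwE i e v : map_mx h (iter e (mulmx (rmx m i)) v) =
    iter e (mulmx (rmx (h \o m) i)) (map_mx h v).
  by elim: e => //= e <-; rewrite map_mxM rmx_map.
rewrite /mono_vec; case: (u ix) => [|a]; case: (u iy) => [|b];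
  by rewrite ?map_mx0 // !pwE rvec_map.
Qed.

Lemma poly_vec_map (h : {rmorphism C -> D}) (m : rep n C) p :
  poly_vec (h \o m) (map_mpoly h p) = map_mx h (poly_vec m p).
Proof.
pose d := maxn (msize (map_mpoly h p)) (msize p).
rewrite (@poly_vecE _ _ _ _ d) ?leq_maxl // (@poly_vecE _ _ _ _ d) ?leq_maxr //.
rewrite raddf_sum; apply: eq_bigr => u _.
by rewrite mcoeff_map_mpoly mono_vec_map /= map_mxZ.
Qed.

Lemma poly_vec_iso (g : 'M[C]_n) (m m' : rep n C) p : intertwines g m m' ->
  poly_vec m' p = g *m poly_vec m p.
Proof.
move=> [gv gX _]; rewrite mulmx_sumr; apply: eq_bigr => u _.
rewrite -scalemxAr; congr (_ *: _).
have pwE i e v : g *m (iter e (mulmx (rmx m i)) v) = iter e (mulmx (rmx m' i)) (g *m v).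
  by elim: e => //= e <-; rewrite !mulmxA gX.
rewrite /mono_vec; case: (u ix) => [|a]; case: (u iy) => [|b];
  by rewrite ?mulmx0 // !pwE gv.
Qed.

End MapPolyVec.

Lemma line_equations_iso (C : comNzRingType) n (m m' : rep n C) : iso m m' ->
  line_equations m -> line_equations m'.
Proof.
move=> [g [[gv gX gw] [g' gg']]] [w0 XC Ya]; have g'g := mulmx1C gg'.
have X'E i : rmx m' i = g *m rmx m i *m g' by rewrite gX -mulmxA gg' mulmx1.
have E i j : rmx m' i *m rmx m' j = g *m (rmx m i *m rmx m j) *m g'.
  by rewrite !X'E !mulmxA -[_ *m g' *m g]mulmxA g'g mulmx1.
split=> [|i j|].
- by rewrite -[rform m']mulmx1 -gg' mulmxA -gw w0 mul0mx.
- by rewrite !E XC.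
- by rewrite -!gv !mulmxA -!gX -!mulmxA Ya.
Qed.

Lemma line_equations_map (C D : comNzRingType) n (h : {rmorphism C -> D}) (m : rep n C) :
  line_equations m -> line_equations (h \o m).
Proof.
move=> [w0 XC Ya]; split=> [|i j|].
- by rewrite rform_map w0 map_mx0.
- by rewrite !rmx_map -!map_mxM XC.
- by rewrite !rmx_map !rvec_map -!map_mxM Ya.
Qed.

(** * Kernels of representations *)

Section LocalMembership.
Variables (k : fieldType) (r : nat).
Implicit Types A B C D : comAlgType k.

Lemma ideal_scale (A : comNzRingType) (K : set {mpoly A[r]}) a p :
  is_ideal K -> K p -> K (a *: p).
Proof. by move=> [_ _ KM] Kp; rewrite -mul_mpolyC; exact: KM. Qed.

Lemma localisation_mpoly A B (s : A) (l : {lrmorphism A -> B}) (q : {mpoly A[r]}) :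
  is_localisation s l -> map_mpoly l q = 0 -> exists M, s ^+ M *: q = 0.
Proof.
move=> loc q0.
have [M ME] : exists M, forall u : 'X_{1..r < msize q}, s ^+ M * q@_u = 0.
  apply: (common_annihilator loc) => u; rewrite -[l _](mcoeff_map_mpoly l) q0; exact: mcoeff0.
exists M; apply/mpolyP => u; rewrite mcoeffZ mcoeff0.
have [lt|le] := ltnP (mdeg u) (msize q); first exact: (ME (BMultinom lt)).
rewrite memN_msupp_eq0 ?mulr0 //; apply: contraL le => /msize_mdeg_lt.
by rewrite -ltnNge.
Qed.

(** Clear the denominators of a combination of elements of K over
    the localisation at s. *)
Lemma locally_extend A (K : set {mpoly A[r]}) p : is_ideal K ->
  locally (fun C (g : {lrmorphism A -> C}) => extend g K (map_mpoly g p)) -> K p.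
Proof.
move=> idK L; case: (idK) => K0 KD KM.
pose J : set A := fun c => K (c *: p).
rewrite -[p]scale1r; apply: (unit_ideal_of_powers (J := J) _ _ L).
  split=> [|a b Ja Jb|a b Jb]; rewrite /J ?scale0r ?scalerDl //; first exact: KD.
  by rewrite -scalerA; exact: ideal_scale.
move=> s gs; have [[m sm]|[B [l loc]]] := localisation_exists s.
  by exists m; rewrite /J sm scale0r.
have [ls _ _] := loc.
have [w wK] := extend_span idK (gs B l ls); rewrite big_tnth => pE.
pose c (i : 'I_(size w)) := (tnth (in_tuple w) i).1.
pose q (i : 'I_(size w)) := (tnth (in_tuple w) i).2.
have Kq i : K (q i) by apply: wK; exact: mem_tnth.
have [M [a aE]] := common_denominator c loc.
have [M' M'E] : exists M', s ^+ M' *: (s ^+ M *: p - \sum_i a i *: q i) = 0.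
  apply: (localisation_mpoly loc).
  rewrite rmorphB /= map_mpolyZ pE scaler_sumr rmorph_sum /=.
  apply/eqP; rewrite subr_eq0; apply/eqP; apply: eq_bigr => i _.
  by rewrite scalerA rmorphXn map_mpolyZ; congr (_ *: _); exact: aE.
exists (M' + M)%N; rewrite /J exprD -scalerA.
have -> : s ^+ M' *: (s ^+ M *: p) = s ^+ M' *: \sum_i a i *: q i.
  by apply/eqP; rewrite -subr_eq0 -scalerBr M'E.
apply: ideal_scale => //; apply: ideal_sum => // i _.
exact: ideal_scale.
Qed.

End LocalMembership.

Section QuotToModuli.
Variables (k : fieldType) (n : nat).
Implicit Types A B C D : comAlgType k.

Definition kernel_of C (m : rep n C) (K : set {mpoly C[3]}) : Prop :=
  forall p, line_poly p -> K p <-> poly_vec m p = 0.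

Lemma poly_vec_comb C (m : rep n C) (sigma : 'I_n -> {mpoly C[3]}) (v : 'cV_n) :
  (forall j, poly_vec m (sigma j) = delta_mx j 0) ->
  poly_vec m (\sum_j v j 0 *: sigma j) = v.
Proof.
move=> sE; rewrite linear_sum [RHS]matrix_sum_delta; apply: eq_bigr => j _.
by rewrite big_ord1 linearZ /= sE.
Qed.

(** A section sigma of the map attached to m reduces each polynomial to a linear
    combination of the sigma j, modulo K and hence modulo its extension. *)
Lemma kernel_of_map C D (h : {lrmorphism C -> D}) (m : rep n C) K
    (sigma : 'I_n -> {mpoly C[3]}) :
  is_ideal K -> (forall p, K p -> line_poly p) ->
  (forall j, line_poly (sigma j)) -> (forall j, poly_vec m (sigma j) = delta_mx j 0) ->
  kernel_of m K -> kernel_of (h \o m) (extend h K).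
Proof.
move=> idK KI sI sE Km p lp; have idE := extend_ideal h K; have [E0 ED EM] := idE.
split=> [/(extend_span idK)[w wK ->]|p0].
  rewrite linear_sum big_seq big1 // => c cw; rewrite linearZ /= poly_vec_map.
  by have Kc := wK c cw; have /Km -> := Kc; rewrite ?map_mx0 ?scaler0 //; exact: KI.
have red q : line_poly q -> K (q - \sum_j poly_vec m q j 0 *: sigma j).
  move=> lq; apply/Km.
    by apply: line_polyB => //; apply: line_poly_sum => j; exact: line_polyZ.
  by rewrite linearB /= poly_vec_comb // subrr.
suff H : extend h K (p - \sum_j poly_vec (h \o m) p j 0 *: map_mpoly h (sigma j)).
  by move: H; rewrite p0 big1 ?subr0 // => j _; rewrite mxE scale0r.
move: {p0} p lp; apply: line_poly_ind => [|p q Ep Eq|a u lu].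
- by rewrite linear0 big1 ?subr0 // => j _; rewrite mxE scale0r.
- rewrite linearD /= (_ : _ - _ = (p - \sum_j poly_vec (h \o m) p j 0 *: map_mpoly h (sigma j))
    + (q - \sum_j poly_vec (h \o m) q j 0 *: map_mpoly h (sigma j))); first exact: ED.
  rewrite addrACA -opprD -big_split /=; congr (_ - _); apply: eq_bigr => j _.
  by rewrite mxE scalerDl.
- have := extend_map h (red 'X_[u] (line_polyX _ lu)) => /(ideal_scale a idE).
  rewrite rmorphB /= map_mpolyX scalerBr rmorph_sum /= scaler_sumr linearZ /=.
  suff -> : \sum_j a *: map_mpoly h (poly_vec m 'X_[u] j 0 *: sigma j) =
     \sum_j (a *: poly_vec (h \o m) 'X_[u]) j 0 *: map_mpoly h (sigma j) by [].
  apply: eq_bigr => j _; rewrite map_mpolyZ scalerA; congr (_ *: _).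
  by rewrite -(map_mpolyX h) poly_vec_map !mxE.
Qed.

Lemma line_poly_mulX (C : comNzRingType) i (p : {mpoly C[3]}) :
  line_poly p -> line_poly ('X_i * p).
Proof. by case: (line_poly_ideal C) => _ _; apply. Qed.

Lemma tree_mon_poly (C : comNzRingType) (t : tree n) j : line_poly ('X_[tree_mon t j] : {mpoly C[3]}).
Proof. exact/line_polyX/(@tree_mon_line n). Qed.

Lemma kernel_of_iso C (m m' : rep n C) K : iso m m' -> kernel_of m K -> kernel_of m' K.
Proof.
move=> im Km p lp; have [g [ig _]] := im; have [g' [ig' _]] := iso_sym im.
rewrite (Km p lp); split=> p0; first by rewrite (poly_vec_iso _ ig) p0 mulmx0.
by rewrite (poly_vec_iso _ ig') p0 mulmx0.
Qed.

(** Both maps I_C -> C^n have the same kernel, so they differ by an automorphism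
    of C^n; it sends the standard basis to the t-frame of m'. *)
Lemma iso_of_kernel C (m m' : rep n C) K : normal m -> normal m' ->
  line_equations m -> line_equations m' -> kernel_of m K -> kernel_of m' K -> iso m m'.
Proof.
move=> [t nm] nm' lm lm' Km Km'; apply/(normal_iso nm nm').
have gE p : line_poly p -> frame t m' *m poly_vec m p = poly_vec m' p.
  move=> lp; pose q := \sum_j poly_vec m p j 0 *: 'X_[tree_mon t j] : {mpoly C[3]}.
  have lq : line_poly q.
    by apply: line_poly_sum => j; apply: line_polyZ; exact: tree_mon_poly.
  have qE (m1 : rep n C) : line_equations m1 -> poly_vec m1 q = frame t m1 *m poly_vec m p.
    move=> l1; rewrite linear_sum /= [X in _ *m X]matrix_sum_delta mulmx_sumr.
    apply: eq_bigr => j _; rewrite big_ord1 linearZ /= poly_vecX mono_vec_tree //.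
    by rewrite -scalemxAr colE.
  have /Km' : K (p - q).
    apply/Km; first exact: line_polyB.
    by rewrite linearB /= qE // frame_normal // mul1mx subrr.
  move/(_ (line_polyB lp lq))/eqP; rewrite linearB /= subr_eq0 qE // => /eqP.
  exact: esym.
have lX (c : 'I_2) : line_poly ('X_(line_gen c) : {mpoly C[3]}).
  exact/line_polyX/line_mon_gen.
split=> [c|i|]; last by case: lm lm' => -> _ _ [-> _ _]; rewrite mul0mx.
  by have := gE _ (lX c); rewrite !poly_vecX !mono_vec_gen.
apply: eq_cols => j; rewrite !col_mulmx.
have lt := tree_mon_poly C t j.
have := gE _ (line_poly_mulX i lt).
rewrite !poly_vec_mulX // poly_vec_tree // poly_vecX mono_vec_tree //.
by rewrite -colE.
Qed.

End QuotToModuli.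

(** * From the Quot scheme to U *)

Section Fibre.
Variables (k : fieldType) (n : nat) (C : comAlgType k).
Variables (K : set {mpoly C[3]}) (e : 'I_n -> {mpoly C[3]}).
Hypothesis idK : is_ideal K.
Hypothesis le : forall j, line_poly (e j).
Hypothesis span : forall q, line_poly q -> exists c : 'cV[C]_n, K (q - \sum_j c j 0 *: e j).
Hypothesis free : forall c : 'cV[C]_n, K (\sum_j c j 0 *: e j) -> c = 0.

(** A basis of I_C / K turns multiplication by x, y, z on the quotient into
    matrices. *)
Lemma quotient_rep : exists m : rep n C, [/\ generating m, line_equations m,
  kernel_of m K & forall j, poly_vec m (e j) = delta_mx j 0].
Proof.
have [K0 KD KM] := idK.
have KB p q : K p -> K q -> K (p - q).
  by move=> Kp Kq; apply: KD => //; rewrite -mulN1r; exact: KM.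
have /boolp.choice[kap kapP] q : exists c : 'cV[C]_n,
    line_poly q -> K (q - \sum_j c j 0 *: e j).
  have [/span[c Kc]|nq] := pselect (line_poly q); first by exists c.
  by exists 0.
have comb0 : \sum_j (0 : 'cV[C]_n) j 0 *: e j = 0.
  by rewrite big1 // => j _; rewrite mxE scale0r.
have combL a (c d : 'cV[C]_n) : \sum_j (a *: c + d) j 0 *: e j =
    a *: (\sum_j c j 0 *: e j) + \sum_j d j 0 *: e j.
  rewrite scaler_sumr -big_split; apply: eq_bigr => j _.
  by rewrite !mxE scalerDl scalerA.
have combB (c d : 'cV[C]_n) : \sum_j (c - d) j 0 *: e j =
    \sum_j c j 0 *: e j - \sum_j d j 0 *: e j.
  by rewrite addrC -scaleN1r combL scaleN1r addrC.
have kapE q (c : 'cV[C]_n) : line_poly q -> K (q - \sum_j c j 0 *: e j) -> kap q = c.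
  move=> lq Kc; apply/eqP; rewrite -subr_eq0; apply/eqP/free; rewrite combB.
  have := KB _ _ Kc (kapP q lq).
  by rewrite opprB [X in K X]addrC addrA addrNK.
have kapL a p q : line_poly p -> line_poly q -> kap (a *: p + q) = a *: kap p + kap q.
  move=> lp lq; apply: kapE.
    by case: (line_poly_ideal C) => _ + _; apply => //; exact: line_polyZ.
  rewrite combL opprD addrACA -scalerBr; apply: KD; last exact: kapP.
  by apply: ideal_scale => //; exact: kapP.
have kap0 q : line_poly q -> K q <-> kap q = 0.
  move=> lq; split=> [Kq|q0]; first by apply: kapE => //; rewrite comb0 subr0.
  by have := kapP q lq; rewrite q0 comb0 subr0.
have kap_e j : kap (e j) = delta_mx j 0.
  apply: kapE => //; rewrite (bigD1 j) //= mxE !eqxx scale1r big1 ?addr0 ?subrr //.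
  by move=> i ij; rewrite mxE (negPf ij) scale0r.
pose m := mk_rep (fun c => kap 'X_(line_gen c))
  (fun i => \matrix_(p, q) kap ('X_i * e q) p 0) 0.
have kapX i q : line_poly q -> kap ('X_i * q) = rmx m i *m kap q.
  move=> lq; pose s := \sum_j kap q j 0 *: e j.
  have ls : line_poly s by apply: line_poly_sum => j; exact: line_polyZ.
  have -> : kap ('X_i * q) = kap ('X_i * s).
    have -> : 'X_i * q = 1 *: ('X_i * (q - s)) + 'X_i * s.
      by rewrite scale1r mulrBr subrK.
    have lqs : line_poly ('X_i * (q - s)) by exact/line_poly_mulX/line_polyB.
    rewrite kapL //; last exact: line_poly_mulX.
    have -> : kap ('X_i * (q - s)) = 0 by apply/(kap0 _ lqs)/KM/kapP.
    by rewrite scaler0 add0r.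
  rewrite /s mulr_sumr [X in _ *m X]matrix_sum_delta mulmx_sumr.
  suff H (r : seq 'I_n) : line_poly (\sum_(j <- r) 'X_i * (kap q j 0 *: e j)) /\
      kap (\sum_(j <- r) 'X_i * (kap q j 0 *: e j)) =
      \sum_(j <- r) rmx m i *m \sum_(l < 1) kap q j l *: delta_mx j l.
    by case: (H (index_enum 'I_n)).
  elim: r => [|j r [lr IH]].
    rewrite !big_nil; split; first by case: (line_poly_ideal C).
    by apply/(kap0 _) => //; case: (line_poly_ideal C).
  have lj : line_poly ('X_i * e j) by exact: line_poly_mulX.
  rewrite !big_cons -scalerAr; split.
    by case: (line_poly_ideal C) => _ + _; apply => //; exact: line_polyZ.
  rewrite kapL // IH; congr (_ + _); rewrite big_ord1 -scalemxAr; congr (_ *: _).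
  by rewrite -colE; apply/colP => p; rewrite rmx_mk !mxE.
have lX c : line_poly ('X_(line_gen c) : {mpoly C[3]}) by exact/line_polyX/line_mon_gen.
have lm : line_equations m.
  split; first exact: rform_mk.
    move=> i j; apply: eq_cols => q; rewrite !colE -!mulmxA -kap_e.
    by rewrite -!kapX //; try exact: line_poly_mulX; rewrite mulrCA.
  rewrite [rvec m ca]rvec_mk [rvec m cb]rvec_mk -(kapX iy _ (lX ca)) -(kapX ix _ (lX cb)).
  have ga : line_gen ca = ix by [].
  have gb : line_gen cb = iy by [].
  by rewrite ga gb [X in kap X = _]mulrC.
have kapv p : line_poly p -> kap p = poly_vec m p.
  by apply: poly_vec_unique => // c; rewrite rvec_mk.
exists m; split=> //; last first.
- by move=> j; rewrite -kapv.
- by move=> p lp; rewrite -kapv //; exact: kap0.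
apply: generating_delta => j; rewrite -kap_e kapv //.
move: (e j) (le j); apply: line_poly_ind => [|p q rp rq|a u lu].
- by rewrite linear0; exact: reach_zero.
- by rewrite linearD; exact: reach_add.
- rewrite linearZ /= poly_vecX; apply: reach_scale; move: u lu.
  apply: line_mon_ind => [c|i u lu IH]; first by rewrite mono_vec_gen; exact: reach_vec.
  by rewrite mono_vec_mul //; exact: reach_mx.
Qed.

End Fibre.

Section QuotPoint.
Variables (k : fieldType) (n : nat).
Implicit Types A B C D : comAlgType k.

Definition quot_family A (K : set {mpoly A[3]}) : rep_family n A := fun C g m =>
  [/\ normal m, line_equations m & kernel_of m (extend g K)].

Variables (A : comAlgType k) (K : set {mpoly A[3]}).
Hypothesis qK : is_quot (line_ideal k) n K.

Let idK : is_ideal K. Proof. by case: qK. Qed.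

Let lK p : K p -> line_poly p.
Proof. by case: qK => _ H _ /H /pullback_lineP. Qed.

Lemma line_poly_map C D (h : {lrmorphism C -> D}) (p : {mpoly C[3]}) :
  line_poly p -> line_poly (map_mpoly h p).
Proof. by move=> lp u nu; rewrite mcoeff_map_mpoly lp ?raddf0. Qed.

Lemma extend_lrcomp B C D (g : {lrmorphism B -> C}) (h : {lrmorphism C -> D})
    (L : set {mpoly B[3]}) : extend (lrcomp h g) L = extend h (extend g L).
Proof. exact: extend_comp. Qed.

Lemma line_poly_extend C D (h : {lrmorphism C -> D}) (L : set {mpoly C[3]}) :
  (forall p, L p -> line_poly p) -> forall p, extend h L p -> line_poly p.
Proof.
move=> lL; apply: extend_min; first exact: line_poly_ideal.
by move=> p /lL; exact: line_poly_map.
Qed.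

Lemma kernel_of_base C D (h : {lrmorphism C -> D}) (m : rep n C) L :
  is_ideal L -> (forall p, L p -> line_poly p) -> normal m -> line_equations m ->
  kernel_of m L -> kernel_of (h \o m) (extend h L).
Proof.
move=> idL lL [t nm] lm; apply: (@kernel_of_map k n _ _ h m L (fun j => 'X_[tree_mon t j])) => // j.
  exact: tree_mon_poly.
exact: poly_vec_tree.
Qed.

Lemma locally_line_equations C (m : rep n C) :
  locally (fun D (h : {lrmorphism C -> D}) => line_equations (h \o m)) ->
  line_equations m.
Proof.
move=> L; split=> [|i j|]; apply: locally_mx_eq; apply: locally_impl L => D h [w0 XC Ya].
- by rewrite -rform_map w0 map_mx0.
- by rewrite !map_mxM -!rmx_map XC.
- by rewrite !map_mxM -!rmx_map -!rvec_map Ya.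
Qed.

(** Local existence: where the quotient is free, [quotient_rep] gives a generating
    representation, and [generating_locally_normal] brings it to normal form. *)
Lemma quot_family_point : is_point (quot_family K).
Proof.
split.
- move=> C g m [nm lm Km] D h gh E m'.
  have KE : extend gh K = extend h (extend g K) by exact: extend_comp.
  have lhm := line_equations_map h lm.
  have Khm : kernel_of (h \o m) (extend gh K).
    rewrite KE; apply: kernel_of_base => //; first exact: extend_ideal.
    exact: line_poly_extend.
  split=> [[nm' lm' Km']|[nm' im']].
    by split=> //; apply: iso_of_kernel lhm lm' Khm Km' => //; exact: normal_map.
  split=> //; first exact: line_equations_iso im' lhm.
  exact: kernel_of_iso im' Khm.
- apply: (@locally_trans _ _ (fun C g => exists m, quot_family K g m)).
    move=> C g g' gg' [m [nm lm Km]]; exists m; split=> //.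
    suff -> : extend g' K = extend g K by [].
    rewrite (@extend_comp 3 _ _ _ g (lrid C) g'); last by move=> a; exact: esym (gg' a).
    by apply: extend_id => //; exact: extend_ideal.
  have [_ _ [S S1 HS]] := qK; apply: ideal_gen_min S1; first exact: ideal_gen_is_ideal.
  move=> s Ss; apply: ideal_gen_sub => C g gs.
  have [e [eI span free]] := HS s Ss.
  have idE := extend_ideal g K.
  have lE := line_poly_extend (h := g) lK.
  have le j : line_poly (map_mpoly g (e j)).
    exact/line_poly_map/pullback_lineP.
  have [||m0 [gm lm Km em]] := @quotient_rep k n C (extend g K) _ idE le.
  - move=> q lq; have [M [c Kc]] := span_extend g (line_ideal_is_ideal k) idK span
        ((pullback_lineP q).2 lq).
    have [y yE] := invertibleX M gs; exists (\col_j (y * c j)).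
    have := ideal_scale y idE Kc; rewrite scalerBr scalerA [y * _]mulrC yE scale1r scaler_sumr.
    by under [X in _ -> extend _ _ (_ - X)]eq_bigr => j _ do rewrite mxE -scalerA.
  - move=> c Kc; have [//|M ME] := free_extend (line_ideal_is_ideal k) idK eI span free
        (c := fun j => c j 0) _ Kc; first by case: qK.
    apply/colP => j; apply: (invertible_inj (invertibleX M gs)).
    by rewrite ME mxE mulr0.
  apply: locally_impl (generating_locally_normal gm) => D h [m' [nm' im']].
  exists m'; split=> //; first exact: line_equations_iso im' (line_equations_map h lm).
  apply: kernel_of_iso im' _; rewrite extend_lrcomp.
  exact: kernel_of_map em Km.
- move=> C g m nm L; have lm : line_equations m.
    by apply: locally_line_equations; apply: locally_impl L => D h [].
  split=> // p lp; have lhp D (h : {lrmorphism C -> D}) : line_poly (map_mpoly h p).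
    exact: line_poly_map.
  split=> [Kp|p0].
    apply: locally_mx_eq; apply: locally_impl L => D h [_ _ Km].
    rewrite map_mx0 -poly_vec_map; apply/Km; first exact: line_poly_map.
    by rewrite extend_lrcomp; exact: extend_map.
  apply: locally_extend; first exact: extend_ideal.
  apply: locally_impl L => D h [_ _ Km].
  rewrite -extend_lrcomp; apply/Km; first exact: line_poly_map.
  by rewrite poly_vec_map p0 map_mx0.
Qed.

Definition quot_moduli : moduli n A := moduli_of_point quot_family_point.

End QuotPoint.

(** * The Quot scheme is the critical locus *)

Section QuotCritical.
Variables (k : fieldType) (n : nat).
Implicit Types A B C D : comAlgType k.

Lemma quot_moduliE A (K : set {mpoly A[3]}) (qK : is_quot (line_ideal k) n K) C
    (g : {lrmorphism A -> C}) m : fam (quot_moduli qK) g m <-> quot_family K g m.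
Proof. exact: famE. Qed.

Lemma quot_moduli_natural A B (h : {lrmorphism A -> B}) (K : set {mpoly A[3]})
    (qK : is_quot (line_ideal k) n K) (qE : is_quot (line_ideal k) n (extend h K)) :
  quot_moduli qE = moduli_map h (quot_moduli qK).
Proof.
apply: moduli_eq => C g m /quot_moduliE[nm lm Km]; apply/fam_map/quot_moduliE.
by split=> //; rewrite extend_lrcomp.
Qed.

Lemma quot_moduli_crit A (K : set {mpoly A[3]}) (qK : is_quot (line_ideal k) n K) :
  in_crit (moduli_function k n) (quot_moduli qK).
Proof. by apply: in_crit_of_equations => C g m /quot_moduliE[]. Qed.

Lemma quot_moduli_inj A (K L : set {mpoly A[3]}) (qK : is_quot (line_ideal k) n K)
    (qL : is_quot (line_ideal k) n L) : quot_moduli qK = quot_moduli qL -> K = L.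
Proof.
suff H (K' L' : set {mpoly A[3]}) (qK' : is_quot (line_ideal k) n K') (qL' : is_quot (line_ideal k) n L') :
    quot_moduli qK' = quot_moduli qL' -> forall p, K' p -> L' p.
  by move=> E; apply/seteqP; split=> p; [exact: H E p | exact: H (esym E) p].
move: K' L' qK' qL' => {}K {}L {}qK {}qL.
move=> E p Kp. apply: locally_extend; first by case: (qL).
apply: locally_impl (point_locally (fam_point (quot_moduli qK)) (lrid A)) => C g [m Km].
have {}Km : fam (quot_moduli qK) g m by apply: point_ext Km => //; exact: fam_point.
have Lm : fam (quot_moduli qL) g m by rewrite -E.
have /quot_moduliE[_ _ {}Km] := Km; have /quot_moduliE[_ _ {}Lm] := Lm.
have lp : line_poly (map_mpoly g p).
  by apply/line_poly_map/pullback_lineP; case: (qK) => _ + _; apply.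
by apply/(Lm _ lp)/(Km _ lp); exact: extend_map.
Qed.

Section Surjective.
Variables (A : comAlgType k) (x : moduli n A).
Hypothesis cx : in_crit (moduli_function k n) x.

(** The kernel cut out by all trivialisations of x at once, so that it is defined
    over A. *)
Definition crit_kernel : set {mpoly A[3]} := fun p => line_poly p /\
  forall C (g : {lrmorphism A -> C}) m, fam x g m -> poly_vec m (map_mpoly g p) = 0.

Let eqs C (g : {lrmorphism A -> C}) m : fam x g m -> line_equations m.
Proof. by move=> xm; exact: (equations_of_in_crit cx xm). Qed.

Lemma crit_kernel_ideal : is_ideal crit_kernel.
Proof.
have [J0 JD JM] := line_poly_ideal A; split.
- by split=> // C g m _; rewrite rmorph0 linear0.
- move=> p q [lp p0] [lq q0]; split=> [|C g m xm]; first exact: JD.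
  by rewrite rmorphD linearD /= (p0 _ _ _ xm) (q0 _ _ _ xm) addr0.
- move=> a p [lp p0]; split=> [|C g m xm]; first exact: JM.
  rewrite rmorphM /=; apply: (poly_vec_mul0 (eqs xm)); first exact: line_poly_map.
  exact: p0 xm.
Qed.

(** Membership in the kernel can be tested on finitely many trivialisations, and
    this makes one exponent sufficient. *)
Lemma crit_kernel_localisation (s : A) B (l : {lrmorphism A -> B}) m q :
  is_localisation s l -> fam x l m -> line_poly q ->
  poly_vec m (map_mpoly l q) = 0 -> exists M, crit_kernel (s ^+ M *: q).
Proof.
move=> loc xm lq q0; have px := fam_point x.
have [_ /locally_cover[N [s' [B' [h [s1 /all_and2[loc' H]]]]]] _] := px.
pose m' i := projT1 (cid (H i)).
have xm' i : fam x (h i) (m' i) := projT2 (cid (H i)).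
have [M ME] : exists M, forall i : 'I_N,
    h i s ^+ M *: poly_vec (m' i) (map_mpoly (h i) q) = 0.
  apply: uniform_bound => [i a b ab E|i].
    by rewrite -(subnK ab) exprD -scalerA E scaler0.
  have [[M sM]|[D [d locD]]] := localisation_exists (h i s).
    by exists M; rewrite sM scale0r.
  have [ds _ _] := locD.
  have [l' l'E] := localisation_lift (g := lrcomp d (h i)) loc ds.
  have im : iso (l' \o m) (d \o m' i).
    apply: (point_iso px (g := lrcomp d (h i))).
      by apply: point_map xm => // a; rewrite l'E.
    exact: point_map (xm' i).
  have dq : d \o h i =1 l' \o l by move=> a; rewrite l'E.
  have dv0 : map_mx d (poly_vec (m' i) (map_mpoly (h i) q)) = 0.
    have [g [ig _]] := im.
    rewrite -poly_vec_map (poly_vec_iso _ ig).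
    have -> : map_mpoly d (map_mpoly (h i) q) = map_mpoly l' (map_mpoly l q).
      by apply/mpolyP => u; rewrite !mcoeff_map_mpoly; exact: dq.
    by rewrite poly_vec_map q0 map_mx0 mulmx0.
  have [M ME] : exists M, forall j : 'I_n, h i s ^+ M * poly_vec (m' i) (map_mpoly (h i) q) j 0 = 0.
    by apply: (common_annihilator locD) => j; have /colP/(_ j) := dv0; rewrite !mxE.
  by exists M; apply/colP => j; rewrite !mxE ME.
exists M; split=> [|C g m0 xm0]; first exact: line_polyZ.
apply: locally_mx_eq.
apply: locally_impl (locally_base g (locally_of_cover s1 loc')) => D d [i [l' l'E]].
have [g' [ig _]] : iso (l' \o m' i) (d \o m0).
  apply: (point_iso px (g := lrcomp d g)); last exact: point_map xm0.
  by apply: point_map (xm' i) => // a; rewrite l'E.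
rewrite map_mx0 -poly_vec_map (poly_vec_iso _ ig).
have -> : map_mpoly d (map_mpoly g (s ^+ M *: q)) =
    map_mpoly l' (h i s ^+ M *: map_mpoly (h i) q).
  apply/mpolyP => u; rewrite mcoeff_map_mpoly mcoeff_map_mpoly [RHS]mcoeff_map_mpoly.
  rewrite !mcoeffZ mcoeff_map_mpoly /= -rmorphXn -rmorphM.
  exact: esym (l'E _).
by rewrite poly_vec_map linearZ /= ME map_mx0 mulmx0.
Qed.

Let form_set : set A := fun s => exists t, holds_on (has_form t x) s.

Let form_set1 : ideal_gen form_set 1.
Proof.
have px := fam_point x.
have [_ /locally_cover[N [s [B [h [s1 /all_and2[loc H]]]]]] _] := px.
apply: ideal_gen_min s1; first exact: ideal_gen_is_ideal.
move=> _ [i _ <-]; apply: ideal_gen_sub.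
have [m xm] := H i; have [t nm] := point_normal px xm; exists t => C g gs.
have [l lE] := localisation_lift (loc i) gs.
exists (l \o m); split; first exact: normal_for_map.
by apply: point_map xm => // a; rewrite lE.
Qed.

(** The map attached to a t-normal trivialisation sends the monomials of t to the
    standard basis; [crit_kernel_localisation] carries this from the localisation
    to A. *)
Lemma crit_kernel_basis s t : holds_on (has_form t x) s ->
  let e j : {mpoly A[3]} := 'X_[tree_mon t j] in
  [/\ forall j, pullback (line_ideal k) (e j),
      forall p, pullback (line_ideal k) p -> exists m (c : 'I_n -> A),
        crit_kernel (s ^+ m *: p - \sum_j c j *: e j)
    & forall c : 'I_n -> A, crit_kernel (\sum_j c j *: e j) ->
        exists m, forall j, s ^+ m * c j = 0].
Proof.
move=> gs e; rewrite {}/e; have [K0 _ _] := crit_kernel_ideal.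
have lt j := @tree_mon_poly n A t j.
have [[M sM]|[B [l loc]]] := localisation_exists s.
  split.
  - by move=> j; apply/pullback_lineP.
  - move=> p _; exists M, (fun=> 0); rewrite sM scale0r big1 ?subr0 // => j _.
    by rewrite scale0r.
  - by move=> c _; exists M => j; rewrite sM mul0r.
have [ls _ _] := loc; have [m [nm xm]] := gs B l ls.
have lm := eqs xm.
have mt j : poly_vec m (map_mpoly l 'X_[tree_mon t j]) = delta_mx j 0.
  by rewrite map_mpolyX poly_vec_tree.
have comb (c : 'I_n -> A) : poly_vec m (map_mpoly l (\sum_j c j *: 'X_[tree_mon t j])) =
    \col_j l (c j).
  rewrite rmorph_sum linear_sum [RHS]matrix_sum_delta; apply: eq_bigr => j _.
  by rewrite /= map_mpolyZ linearZ /= mt big_ord1 mxE.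
split.
- by move=> j; apply/pullback_lineP.
- move=> p /pullback_lineP lp.
  have [M [c cE]] := common_denominator (fun j => poly_vec m (map_mpoly l p) j 0) loc.
  pose q := s ^+ M *: p - \sum_j c j *: 'X_[tree_mon t j].
  have lq : line_poly q.
    apply: line_polyB; first exact: line_polyZ.
    by apply: line_poly_sum => j; exact: line_polyZ.
  have [M' KM'] : exists M', crit_kernel (s ^+ M' *: q).
    apply: (crit_kernel_localisation loc xm lq).
    rewrite rmorphB linearB /= comb map_mpolyZ linearZ /= rmorphXn.
    by apply/colP => j; rewrite !mxE cE subrr.
  exists (M' + M)%N, (fun j => s ^+ M' * c j).
  move: KM'; rewrite /q scalerBr scalerA -exprD scaler_sumr.
  by under eq_bigr => j _ do rewrite scalerA.
- move=> c [_ c0]; have := c0 _ _ _ xm; rewrite comb => /colP lc.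
  by apply: (common_annihilator loc) => j; have := lc j; rewrite !mxE.
Qed.

Lemma crit_kernel_quot : is_quot (line_ideal k) n crit_kernel.
Proof.
split; first exact: crit_kernel_ideal.
  by move=> p [lp _]; apply/pullback_lineP.
exists form_set => // s [t gs]; exists (fun j => 'X_[tree_mon t j]).
exact: crit_kernel_basis.
Qed.

(** It is enough that each trivialisation of x has the extension of the kernel as
    its own kernel.  A polynomial killed by it is, over D(s), a combination of
    the monomials of a tree modulo the kernel, with coefficients that vanish. *)
Lemma crit_kernel_moduli : quot_moduli crit_kernel_quot = x.
Proof.
have px := fam_point x; symmetry; apply: moduli_eq => C g m xm; apply/quot_moduliE.
have lm := eqs xm; split=> //; first exact: point_normal xm.
have idK := crit_kernel_ideal.
have kill D (d : {lrmorphism A -> D}) m1 q : fam x d m1 -> extend d crit_kernel q ->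
    poly_vec m1 q = 0.
  move=> xm1 /(extend_span idK)[w wK ->].
  rewrite linear_sum big_seq big1 // => c cw; rewrite linearZ /=.
  by have [_ c0] := wK c cw; rewrite (c0 _ _ _ xm1) scaler0.
move=> p lp; split=> [|p0]; first exact: kill.
apply: locally_extend; first exact: extend_ideal.
have LS : locally (fun D (d : {lrmorphism A -> D}) =>
    exists s t, holds_on (has_form t x) s /\ invertible (d s)).
  apply: ideal_gen_min form_set1; first exact: ideal_gen_is_ideal.
  by move=> s [t gs]; apply: ideal_gen_sub => D d ds; exists s, t.
apply: locally_impl (locally_base g LS) => D d [s [t [gs ds]]].
rewrite -extend_lrcomp; have [_ span _] := crit_kernel_basis gs.
have idE := extend_ideal (lrcomp d g) crit_kernel.
have [m1 [nm1 xm1]] := gs D (lrcomp d g) ds.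
have [h [ih _]] : iso (d \o m) m1.
  by apply: (point_iso px (g := lrcomp d g)) xm1; exact: point_map xm.
have [M [c Kc]] := span_extend (lrcomp d g) (line_ideal_is_ideal k) idK span
  ((pullback_lineP _).2 (line_poly_map d lp)).
have := kill _ _ _ _ xm1 Kc.
have E : \sum_j c j *: map_mpoly (lrcomp d g) 'X_[tree_mon t j] =
    \sum_j (\col_j c j) j 0 *: ('X_[tree_mon t j] : {mpoly D[3]}).
  by apply: eq_bigr => j _; rewrite mxE map_mpolyX.
rewrite linearB linearZ /= (poly_vec_iso _ ih) poly_vec_map p0 map_mx0 mulmx0 scaler0.
rewrite E poly_vec_comb; last by move=> j; apply: poly_vec_tree => //; exact: eqs xm1.
rewrite sub0r => /eqP; rewrite oppr_eq0 => /eqP c0.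
move: Kc; rewrite E c0 big1 ?subr0 => [Kq|j _]; last by rewrite mxE scale0r.
have [y yE] := invertibleX M ds.
have := ideal_scale y idE Kq; rewrite scalerA mulrC yE scale1r //.
Qed.

End Surjective.

Definition quot_to_crit_pt A (K : Quot (line_ideal_is_ideal k) n A) :
    crit (moduli_function k n) A :=
  exist _ (quot_moduli (svalP K)) (@quot_moduli_crit A (sval K) (svalP K)).

Lemma quot_to_crit_natural A B (h : {lrmorphism A -> B})
    (K : Quot (line_ideal_is_ideal k) n A) :
  quot_to_crit_pt (fmap h K) = fmap h (quot_to_crit_pt K).
Proof. by apply: eq_exist; exact: quot_moduli_natural. Qed.

Definition quot_to_crit : nattrans (Quot (line_ideal_is_ideal k) n)
    (crit (moduli_function k n)) :=
  NatTrans quot_to_crit_natural.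

Lemma quot_to_crit_bijective A : bijective (quot_to_crit A).
Proof.
have inj (K L : Quot (line_ideal_is_ideal k) n A) :
    quot_to_crit A K = quot_to_crit A L -> K = L.
  case: K L => [K qK] [L qL] /(congr1 sval) E.
  by apply: eq_exist; exact: quot_moduli_inj E.
have surj (y : crit (moduli_function k n) A) : exists K, quot_to_crit A K = y.
  case: y => x cx; exists (exist _ (crit_kernel x) (crit_kernel_quot cx)).
  by apply: eq_exist; rewrite /= -[RHS](crit_kernel_moduli cx); congr quot_moduli; exact: Prop_irrelevance.
have [G GE] := boolp.choice surj.
by exists G => [K|y]; [apply: inj; rewrite GE | rewrite GE].
Qed.

Lemma quot_isomorphic_crit :
  isomorphic (Quot (line_ideal_is_ideal k) n) (crit (moduli_function k n)).
Proof. by exists quot_to_crit; exact: quot_to_crit_bijective. Qed.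

End QuotCritical.

Theorem theorem1 (R : realType) (n : nat) :
  exists (U : kfunctor R[i]) (f : nattrans U (affine_line R[i])),
    [/\ variety U, smooth U &
      isomorphic (Quot (line_ideal_is_ideal R[i]) n) (crit f)].
Proof.
exists (moduli_functor R[i] n), (moduli_function R[i] n); split.
- exact: moduli_variety.
- exact: moduli_smooth.
- exact: quot_isomorphic_crit.
Qed.
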